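(* Let $n\geqslant 1$ and let $R$ be a ring that is torsion free over $\mathbb Z$. Then for any morphism of group functors $\Phi:(L^nK^M_{n+1})_R\to(\mathbb G_m)_R$ over $R$, there is a locally constant integer $\underline i\in\underline{\mathbb Z}(R)$ such that $\Phi=(CC_n)^{\underline i}$, where $CC_n:L^nK^M_{n+1}\to\mathbb G_m$ is the $n$-dimensional Contou-Carrère symbol.
   Context: All rings are commutative, associative and unital. A group functor (over a ring $R$) is a covariant functor from rings ($R$-algebras) to abelian groups; $F_R$ is the restriction of $F$ to $R$-algebras. $A((t))=A[[t]][t^{-1}]$ and $L^nF(A)=F\big(A((t_1))\ldots((t_n))\big)$. $\mathbb G_m(A)=A^*$. $\underline{\mathbb Z}(A)$ is the group of locally constant functions $\mathrm{Spec}(A)\to\mathbb Z$; for $a\in A^*$ the power $a^{\underline i}$ is taken on each factor of a finite decomposition of $A$ on which $\underline i$ is constant. A ring is torsion free over $\mathbb Z$ if it has no torsion as a $\mathbb Z$-module. Milnor $K$-groups: $K^M_m(A)$ is the quotient of $(A^* )^{\otimes m}$ by the subgroup generated by all $a_1\otimes\ldots\otimes a_i\otimes a\otimes(1-a)\otimes a_{i+3}\otimes\ldots\otimes a_m$; $\{a_1,\ldots,a_m\}$ is the class of $a_1\otimes\ldots\otimes a_m$. $K_m(A)$ denotes Quillen's algebraic $K$-groups; the Loday product of elements of $A^*\subset K_1(A)$ gives a morphism $K^M_m\to K_m$, $\{a_1,\ldots,a_m\}\mapsto a_1\cdot\ldots\cdot a_m$. Boundary map $\partial_{m+1}:K_{m+1}(A((t)))\to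 K_m(A)$, $m\geqslant0$: let $\mathcal H(A)$ be the exact category of $A[[t]]$-modules annihilated by a power of $t$ that admit a resolution of length one by finitely generated projective $A[[t]]$-modules; let $\mathcal P^1(A[[t]])$ be the exact category of all $A[[t]]$-modules with a resolution of length one by finitely generated projective $A[[t]]$-modules; let $\mathcal V(A)$ be the exact category of finitely generated projective $A((t))$-modules that are localizations of finitely generated projective $A[[t]]$-modules, and $\mathcal V^1(A)$ that of $A((t))$-modules with a resolution of length one by modules in $\mathcal V(A)$. The sequence $\mathcal H(A)\to\mathcal P^1(A[[t]])\to\mathcal V^1(A)$ induces a homotopy fibration of the spaces $\mathrm{BQ}$ (Grayson), and $K_m(\mathcal V^1(A))\simeq K_m(\mathcal V(A))\simeq K_m(A((t)))$ for $m\geqslant1$ (resolution theorem and cofinality), which gives $K_{m+1}(A((t)))\to K_m(\mathcal H(A))$. Modules in $\mathcal H(A)$ are finitely generated projective over $A$, so there is a forgetful exact functor $\mathcal H(A)\to\mathcal P(A)$ to finitely generated projective $A$-modules; composing with the induced map $K_m(\mathcal H(A))\to K_m(A)$ gives $\partial_{m+1}$. It is functorial in $A$, and the normalization is such that $\partial_{m+1}(\lambda(\alpha)\cdot t)=\bar\alpha$ for $\alpha\in K_m(A[[t]])$, where $\lambda$ is induced by $A[[t]]\to A((t))$ and $\alpha\mapsto\bar\alpha$ by $t\mapsto0$. The Contou-Carrère symbol $CC_n:L^nK^M_{n+1}\to\mathbb G_m$ is the morphism of group functors given by the composition $$K^M_{n+1}\big(A((t_1))\ldots((t_n))\big)\to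 K_{n+1}\big(A((t_1))\ldots((t_n))\big)\xrightarrow{\partial_{n+1}}K_n\big(A((t_1))\ldots((t_{n-1}))\big)\to\ldots\to K_2\big(A((t_1))\big)\xrightarrow{\partial_2}K_1(A)\xrightarrow{\det}A^*,$$ the successive boundary maps being taken with respect to $t_n,t_{n-1},\ldots,t_1$. *)

(* Defs.v *)
From HB Require Import structures.
From mathcomp.multinomials Require Import freeg.
From mathcomp Require Import all_boot all_order all_algebra.
From mathcomp Require Import all_classical all_reals all_analysis.
From mathcomp Require Import Rstruct Rstruct_topology.
From Stdlib Require Import Relation_Operators.

Set Implicit Arguments.
Unset Strict Implicit.
Unset Printing Implicit Defensive.
Import Order.TTheory GRing.Theory Num.Theory.
Import numFieldNormedType.Exports.
Local Open Scope ring_scope.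
Local Open Scope quotient_scope.

Local Notation RR := Rdefinitions.R.

Record pseries (A : comPzRingType) : Type := PSeries { pcoef :> nat -> A }.

Section PowerSeries.
Variable A : comPzRingType.
Implicit Types f g h : pseries A.

HB.instance Definition _ := gen_eqMixin (pseries A).
HB.instance Definition _ := gen_choiceMixin (pseries A).

Lemma pseriesP f g : (forall k, f k = g k) -> f = g.
Proof. by case: f g => f [g] /= /funext ->. Qed.

Definition ps_zero : pseries A := PSeries (fun _ => 0).
Definition ps_opp f : pseries A := PSeries (fun k => - f k).
Definition ps_add f g : pseries A := PSeries (fun k => f k + g k).
Definition ps_const (a : A) : pseries A :=
  PSeries (fun k => if k is 0%N then a else 0).
Definition ps_mul f g : pseries A :=
  PSeries (fun k => \sum_(i < k.+1) f i * g (k - i)%N).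

Fact ps_addA : associative ps_add.
Proof. by move=> f g h; apply: pseriesP => k; rewrite /= addrA. Qed.
Fact ps_addC : commutative ps_add.
Proof. by move=> f g; apply: pseriesP => k; rewrite /= addrC. Qed.
Fact ps_add0 : left_id ps_zero ps_add.
Proof. by move=> f; apply: pseriesP => k; rewrite /= add0r. Qed.
Fact ps_addN : left_inverse ps_zero ps_opp ps_add.
Proof. by move=> f; apply: pseriesP => k; rewrite /= addNr. Qed.
HB.instance Definition _ :=
  GRing.isZmodule.Build (pseries A) ps_addA ps_addC ps_add0 ps_addN.

Fact ps_mulC : commutative ps_mul.
Proof.
move=> f g; apply: pseriesP => k; rewrite /= (reindex_inj rev_ord_inj) /=.
apply: eq_bigr => i _; rewrite subSS mulrC subKn //.
by rewrite -ltnS.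
Qed.
Fact ps_mulA : associative ps_mul.
Proof.
move=> f g h; apply: pseriesP => k; rewrite /=.
pose G (i j : nat) := f i * (g j * h (k - i - j)%N).
transitivity (\sum_(i < k.+1) \sum_(j < k.+1 | (i + j <= k)%N) G i j).
  apply: eq_bigr => i _; rewrite mulr_sumr.
  rewrite (big_ord_widen_cond k.+1 predT (fun j => f i * (g j * h (k - i - j)%N)));
    last by rewrite ltnS leq_subr.
  apply: eq_bigl => j /=; rewrite ltnS.
  by have := ltn_ord i; rewrite ltnS => hi; rewrite leq_subRL.
transitivity (\sum_(l < k.+1) \sum_(i < k.+1 | (i <= l)%N) G i (l - i)%N); last first.
  apply: eq_bigr => l _; rewrite mulr_suml.
  rewrite (big_ord_widen_cond k.+1 predT (fun i => f i * g (l - i)%N * h (k - l)%N));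
    last by [].
  apply: eq_big => i /=; first by rewrite ltnS.
  by move=> hi; rewrite /G -mulrA -subnDA subnKC.
rewrite [in RHS](exchange_big_dep predT) //=.
apply: eq_bigr => i _.
have hik : (i <= k)%N by rewrite -ltnS.
rewrite -(big_mkord (fun j => i + j <= k)%N (G i)).
rewrite -(big_mkord (fun l => i <= l)%N (fun l => G i (l - i)%N)).
rewrite [RHS](@big_cat_nat _ _ _ i 0 k.+1) //=; last by rewrite ltnW.
rewrite [X in _ = X + _]big_nat_cond [X in _ = X + _]big_pred0 ?add0r; last first.
  by move=> l; apply/negP => /andP[/andP[_ hl]] /(leq_ltn_trans)/(_ hl); rewrite ltnn.
rewrite [LHS](@big_cat_nat _ _ _ (k.+1 - i) 0 k.+1) //=; last exact: leq_subr.
rewrite [X in _ + X = _]big_nat_cond [X in _ + X = _]big_pred0 ?addr0; last first.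
  move=> l; apply/negP => /andP[/andP[hl _] hl2].
  by move: hl2; rewrite -ltnS -ltn_subRL ltnNge hl.
move: (i : nat) hik => {}i hik.
rewrite [in RHS](_ : index_iota i k.+1 = index_iota (0 + i) k.+1) // big_addn.
rewrite [LHS]big_nat_cond [RHS]big_nat_cond; apply: eq_big.
  move=> l; rewrite leq_addl andbT /=; case: (ltnP l (k.+1 - i)) => //= hl.
  by rewrite -ltnS -ltn_subRL hl.
by move=> l _; rewrite addnK.
Qed.
Fact ps_mul1 : left_id (ps_const 1) ps_mul.
Proof.
move=> f; apply: pseriesP => k; rewrite /= big_ord_recl /= mul1r subn0.
by rewrite big1 ?addr0 // => i _; rewrite mul0r.
Qed.
Fact ps_mulDl : left_distributive ps_mul +%R.
Proof.
move=> f g h; apply: pseriesP => k; rewrite /=.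
by rewrite -big_split; apply: eq_bigr => i _; exact: mulrDl.
Qed.
HB.instance Definition _ := GRing.Zmodule_isComPzRing.Build (pseries A)
  ps_mulA ps_mulC ps_mul1 ps_mulDl.

Definition ps_ev0 f : A := f 0%N.

Fact ps_const_is_zmod_morphism : zmod_morphism ps_const.
Proof. by move=> a b; apply: pseriesP => -[|k] //=; rewrite subr0. Qed.
Fact ps_const_is_monoid_morphism : monoid_morphism ps_const.
Proof.
split=> // a b; apply: pseriesP => k; rewrite /=.
rewrite big_ord_recl subn0 big1 => [|i _]; last by rewrite mul0r.
by case: k => [|k] /=; rewrite ?mulr0 addr0.
Qed.
HB.instance Definition _ :=
  GRing.isZmodMorphism.Build A (pseries A) ps_const ps_const_is_zmod_morphism.
HB.instance Definition _ :=
  GRing.isMonoidMorphism.Build A (pseries A) ps_const ps_const_is_monoid_morphism.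

Fact ps_ev0_is_zmod_morphism : zmod_morphism ps_ev0.
Proof. by []. Qed.
Fact ps_ev0_is_monoid_morphism : monoid_morphism ps_ev0.
Proof.
split=> // f g; rewrite /ps_ev0 /=.
by rewrite big_ord_recl big_ord0 addr0.
Qed.
HB.instance Definition _ :=
  GRing.isZmodMorphism.Build (pseries A) A ps_ev0 ps_ev0_is_zmod_morphism.
HB.instance Definition _ :=
  GRing.isMonoidMorphism.Build (pseries A) A ps_ev0 ps_ev0_is_monoid_morphism.

Definition psX : pseries A := PSeries (fun k => (k == 1%N)%:R).

Lemma ps_mulXE f k : (psX * f) k = if k is k'.+1 then f k' else 0.
Proof.
case: k => [|k] /=.
  by rewrite big_ord_recl big_ord0 /psX /= mul0r addr0.
rewrite big_ord_recl big_ord_recl /psX /= mul0r add0r mul1r subSS subn0.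
by rewrite big1 ?addr0 // => i _; rewrite mul0r.
Qed.

End PowerSeries.

Record laurent (A : comPzRingType) : Type := Laurent {
  lcoef :> int -> A ;
  lcoefP : exists N : nat, forall i : int, i < - N%:Z -> lcoef i = 0 }.

Section LaurentSeries.
Variable A : comPzRingType.
Implicit Types f g h : laurent A.
Implicit Types p q : pseries A.

HB.instance Definition _ := gen_eqMixin (laurent A).
HB.instance Definition _ := gen_choiceMixin (laurent A).

Lemma laurentP f g : (forall i, f i = g i) -> f = g.
Proof.
case: f g => [f hf] [g hg] /= /funext fg; subst g.
by congr Laurent; exact: Prop_irrelevance.
Qed.

(* [ls_of_ps N p] is [t^(-N) * p]; [ps_of_ls N f] is [t^N * f], provided that
   [f] has no term of degree less than [-N]. *)
Definition ls_coef_of_ps (N : nat) p (i : int) : A :=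
  if i + N%:Z is Posz k then p k else 0.
Fact ls_of_ps_subproof N p :
  exists M : nat, forall i : int, i < - M%:Z -> ls_coef_of_ps N p i = 0.
Proof.
exists N => i hi; rewrite /ls_coef_of_ps.
have : i + N%:Z < 0 by rewrite -ltrBrDr sub0r.
by case: (i + N%:Z) => // k; rewrite ltNge le0z_nat.
Qed.
Definition ls_of_ps N p : laurent A := Laurent (ls_of_ps_subproof N p).
Definition ps_of_ls (N : nat) (f : laurent A) : pseries A :=
  PSeries (fun k => f (k%:Z - N%:Z)).

Definition ls_bound f : nat := projT1 (cid (lcoefP f)).
Lemma ls_boundP f i : i < - (ls_bound f)%:Z -> f i = 0.
Proof. by rewrite /ls_bound; case: cid => N /= hN; exact: hN. Qed.

Lemma ps_of_lsK N f : (forall i : int, i < - N%:Z -> f i = 0) ->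
  ls_of_ps N (ps_of_ls N f) = f.
Proof.
move=> hN; apply: laurentP => i /=; rewrite /ls_coef_of_ps.
case E: (i + N%:Z) => [k|k].
  by rewrite /= -E addrK.
by rewrite hN // -[X in _ < X]sub0r ltrBrDr E.
Qed.
Lemma ls_ofK N : cancel (ls_of_ps N) (ps_of_ls N).
Proof. by move=> p; apply: pseriesP => k; rewrite /= /ls_coef_of_ps subrK. Qed.

Lemma ls_of_psS N M p : ls_of_ps (M + N) (psX A ^+ M * p) = ls_of_ps N p.
Proof.
elim: M => [|M <-]; first by rewrite expr0 mul1r.
rewrite exprS -mulrA; set q := _ * p; apply: laurentP => i /=.
rewrite /ls_coef_of_ps addSn -addn1 PoszD addrA.
case: (i + _) => [k|[|k]].
- have -> : k%:Z + 1 = k.+1%:Z by rewrite -addn1.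
  by rewrite ps_mulXE.
- by have -> : Negz 0 + 1 = 0%:Z by []; rewrite ps_mulXE.
- by [].
Qed.
Lemma ls_of_ps_surj f : exists N p, f = ls_of_ps N p.
Proof. by exists (ls_bound f), (ps_of_ls (ls_bound f) f); rewrite ps_of_lsK //; apply: ls_boundP. Qed.

Fact ls_zero_subproof : exists N : nat, forall i : int, i < - N%:Z -> (0 : A) = 0.
Proof. by exists 0%N. Qed.
Fact ls_opp_subproof f :
  exists N : nat, forall i : int, i < - N%:Z -> - f i = 0.
Proof. by case: f => f [N hN] /=; exists N => i /hN ->; rewrite oppr0. Qed.
Fact ls_add_subproof f g :
  exists N : nat, forall i : int, i < - N%:Z -> f i + g i = 0.
Proof.
case: f g => f [N hN] [g [M hM]] /=; exists (N + M)%N => i hi.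
rewrite hN ?hM ?addr0 //; apply: (lt_le_trans hi); rewrite lerN2 lez_nat.
  exact: leq_addl.
exact: leq_addr.
Qed.
Definition ls_zero : laurent A := Laurent ls_zero_subproof.
Definition ls_opp f : laurent A := Laurent (ls_opp_subproof f).
Definition ls_add f g : laurent A := Laurent (ls_add_subproof f g).

Fact ls_addA : associative ls_add.
Proof. by move=> f g h; apply: laurentP => k; rewrite /= addrA. Qed.
Fact ls_addC : commutative ls_add.
Proof. by move=> f g; apply: laurentP => k; rewrite /= addrC. Qed.
Fact ls_add0 : left_id ls_zero ls_add.
Proof. by move=> f; apply: laurentP => k; rewrite /= add0r. Qed.
Fact ls_addN : left_inverse ls_zero ls_opp ls_add.
Proof. by move=> f; apply: laurentP => k; rewrite /= addNr. Qed.
HB.instance Definition _ :=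
  GRing.isZmodule.Build (laurent A) ls_addA ls_addC ls_add0 ls_addN.

Lemma ls_of_psD N p q : ls_of_ps N (p + q) = ls_of_ps N p + ls_of_ps N q.
Proof.
apply: laurentP => i; rewrite -[RHS]/(ls_of_ps N p i + ls_of_ps N q i) /=.
by rewrite /ls_coef_of_ps; case: (i + _) => // k; rewrite addr0.
Qed.

(* The Cauchy product, computed after clearing the denominators; [ls_mulE]
   shows that the choice of the bounds does not matter. *)
Definition ls_mul f g : laurent A :=
  ls_of_ps (ls_bound f + ls_bound g)
           (ps_of_ls (ls_bound f) f * ps_of_ls (ls_bound g) g).

Lemma ls_mulE N M p q :
  ls_mul (ls_of_ps N p) (ls_of_ps M q) = ls_of_ps (N + M) (p * q).
Proof.
set f := ls_of_ps N p; set g := ls_of_ps M q; rewrite /ls_mul.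
set a := ls_bound f; set b := ls_bound g.
have Hf : ls_of_ps a (ps_of_ls a f) = ls_of_ps N p.
  by rewrite ps_of_lsK //; apply: ls_boundP.
have Hg : ls_of_ps b (ps_of_ls b g) = ls_of_ps M q.
  by rewrite ps_of_lsK //; apply: ls_boundP.
move: (ps_of_ls a f) (ps_of_ls b g) Hf Hg => f' g' Hf Hg.
have E1 : psX A ^+ N * f' = psX A ^+ a * p.
  apply: (can_inj (ls_ofK (N + a))).
  by rewrite ls_of_psS [(N + a)%N]addnC ls_of_psS.
have E2 : psX A ^+ M * g' = psX A ^+ b * q.
  apply: (can_inj (ls_ofK (M + b))).
  by rewrite ls_of_psS [(M + b)%N]addnC ls_of_psS.
rewrite -(ls_of_psS (a + b) (N + M)) -(ls_of_psS (N + M) (a + b)).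
by rewrite [(a + b + _)%N]addnC !exprD mulrACA E1 E2 [in RHS]mulrACA.
Qed.

Fact ls_mulC : commutative ls_mul.
Proof. by move=> f g; rewrite /ls_mul addnC mulrC. Qed.
Fact ls_mulA : associative ls_mul.
Proof.
move=> f g h; have [N [p ->]] := ls_of_ps_surj f.
have [M [q ->]] := ls_of_ps_surj g; have [L [r ->]] := ls_of_ps_surj h.
by rewrite !ls_mulE mulrA addnA.
Qed.
Fact ls_mul1 : left_id (ls_of_ps 0 1) ls_mul.
Proof. by move=> f; have [N [p ->]] := ls_of_ps_surj f; rewrite ls_mulE mul1r. Qed.
Fact ls_mulDl : left_distributive ls_mul +%R.
Proof.
move=> f g h; have [N [p ->]] := ls_of_ps_surj f.
have [M [q ->]] := ls_of_ps_surj g; have [L [r ->]] := ls_of_ps_surj h.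
rewrite -(ls_of_psS N M p) -(ls_of_psS M N q) [(N + M)%N]addnC.
by rewrite -ls_of_psD !ls_mulE mulrDl ls_of_psD.
Qed.
HB.instance Definition _ := GRing.Zmodule_isComPzRing.Build (laurent A)
  ls_mulA ls_mulC ls_mul1 ls_mulDl.

Lemma ls_mulrE N M p q :
  ls_of_ps N p * ls_of_ps M q = ls_of_ps (N + M) (p * q).
Proof. exact: ls_mulE. Qed.

Definition ps_to_ls : pseries A -> laurent A := ls_of_ps 0.
Fact ps_to_ls_is_zmod_morphism : zmod_morphism ps_to_ls.
Proof.
move=> p q; apply: (addIr (ps_to_ls q)).
by rewrite -ls_of_psD !subrK.
Qed.
Fact ps_to_ls_is_monoid_morphism : monoid_morphism ps_to_ls.
Proof. by split=> // p q; rewrite ls_mulrE. Qed.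
HB.instance Definition _ :=
  GRing.isZmodMorphism.Build (pseries A) (laurent A) ps_to_ls ps_to_ls_is_zmod_morphism.
HB.instance Definition _ :=
  GRing.isMonoidMorphism.Build (pseries A) (laurent A) ps_to_ls ps_to_ls_is_monoid_morphism.

Definition ls_T : laurent A := ps_to_ls (psX A).
Fact ls_T_unit : ls_T * ls_of_ps 1 1 = 1.
Proof. by rewrite ls_mulrE mulr1 -{1}[psX A]mulr1 (ls_of_psS 0 1). Qed.

End LaurentSeries.

Section LaurentMap.
Variables (A B : comPzRingType) (f : {rmorphism A -> B}).

Fact laurent_map_subproof (x : laurent A) :
  exists N : nat, forall i : int, i < - N%:Z -> f (x i) = 0.
Proof. by case: x => x [N hN] /=; exists N => i /hN ->; rewrite rmorph0. Qed.
Definition laurent_map (x : laurent A) : laurent B := Laurent (laurent_map_subproof x).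

Fact laurent_map_is_zmod_morphism : zmod_morphism laurent_map.
Proof. by move=> x y; apply: laurentP => i /=; rewrite rmorphB. Qed.
Lemma laurent_map_of_ps N p :
  laurent_map (ls_of_ps N p) = ls_of_ps N (PSeries (fun k => f (p k))).
Proof.
apply: laurentP => i /=; rewrite /ls_coef_of_ps.
by case: (i + _) => // k; rewrite rmorph0.
Qed.
Fact laurent_map_is_monoid_morphism : monoid_morphism laurent_map.
Proof.
split.
  rewrite laurent_map_of_ps; congr ls_of_ps; apply: pseriesP => -[|k] /=.
    by rewrite rmorph1.
  by rewrite rmorph0.
move=> x y; have [N [p ->]] := ls_of_ps_surj x.
have [M [q ->]] := ls_of_ps_surj y.
rewrite ls_mulrE !laurent_map_of_ps ls_mulrE; congr ls_of_ps; apply: pseriesP => k.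
rewrite /= rmorph_sum.
by apply: eq_bigr => i _; rewrite rmorphM.
Qed.
HB.instance Definition _ := GRing.isZmodMorphism.Build
  (laurent A) (laurent B) laurent_map laurent_map_is_zmod_morphism.
HB.instance Definition _ := GRing.isMonoidMorphism.Build
  (laurent A) (laurent B) laurent_map laurent_map_is_monoid_morphism.
End LaurentMap.

Fixpoint iter_laurent (n : nat) (A : comPzRingType) : comPzRingType :=
  if n is n'.+1 then laurent (iter_laurent n' A) else A.

Fixpoint iter_laurent_map (n : nat) (A B : comPzRingType) (f : {rmorphism A -> B}) :
    {rmorphism iter_laurent n A -> iter_laurent n B} :=
  if n is n'.+1 then laurent_map (iter_laurent_map n' f) else f.

Definition Gm (A : comPzRingType) : Type := {a : A | `[< exists b, a * b = 1 >]}.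

Section Gm.
Variable A : comPzRingType.
HB.instance Definition _ := Choice.on (Gm A).
Implicit Types u v : Gm A.

Definition mkGm (a b : A) (ab : a * b = 1) : Gm A :=
  exist _ a (introT (asboolP _) (ex_intro _ b ab)).

Definition Gm_val u : A := \val u.
Fact Gm_invP u : exists b, Gm_val u * b = 1. Proof. exact: (asboolW (valP u)). Qed.
Definition Gm_invval u : A := projT1 (cid (Gm_invP u)).

Lemma Gm_mulV u : Gm_val u * Gm_invval u = 1.
Proof. by rewrite /Gm_invval; case: cid. Qed.

Definition Gm_expz u (k : int) : A :=
  match k with Posz n => Gm_val u ^+ n | Negz n => Gm_invval u ^+ n.+1 end.
End Gm.

Fact Gm_map_subproof (A B : comPzRingType) (f : {rmorphism A -> B}) (u : Gm A) :
  f (Gm_val u) * f (Gm_invval u) = 1.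
Proof. by rewrite -rmorphM Gm_mulV rmorph1. Qed.
Definition Gm_map (A B : comPzRingType) (f : {rmorphism A -> B}) (u : Gm A) : Gm B :=
  mkGm (Gm_map_subproof f u).

Section MilnorK.
Variables (m : nat) (A : comPzRingType).

(* The relations of [(A^* )^{\otimes m}], seen as a quotient of the free abelian
   group on [m]-tuples of units, together with the Steinberg relations. *)
Inductive KM_rel : {freeg (m.-tuple (Gm A)) / int} -> Prop :=
| KM_rel0 : KM_rel 0
| KM_relB x y : KM_rel x -> KM_rel y -> KM_rel (x - y)
| KM_rel_multilinear (i : 'I_m) (s s1 s2 : m.-tuple (Gm A)) :
    Gm_val (tnth s i) = Gm_val (tnth s1 i) * Gm_val (tnth s2 i) ->
    (forall j, j != i -> tnth s1 j = tnth s j /\ tnth s2 j = tnth s j) ->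
    KM_rel (<< s >> - << s1 >> - << s2 >>)
| KM_rel_steinberg (i j : 'I_m) (s : m.-tuple (Gm A)) :
    j = i.+1 :> nat -> Gm_val (tnth s i) + Gm_val (tnth s j) = 1 ->
    KM_rel << s >>.

Definition KM_sub : {pred {freeg (m.-tuple (Gm A)) / int}} := fun x => `[< KM_rel x >].
Fact KM_sub_zmod_closed : zmod_closed KM_sub.
Proof.
split=> [|x y /asboolP hx /asboolP hy]; apply/asboolP; first exact: KM_rel0.
exact: KM_relB.
Qed.
HB.instance Definition _ := GRing.isZmodClosed.Build _ KM_sub KM_sub_zmod_closed.

Definition KM : zmodType := Quotient.quot KM_sub.
Definition KM_symbol (s : m.-tuple (Gm A)) : KM := \pi_(Quotient.quot KM_sub) << s >>.
End MilnorK.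

Section MilnorKMap.
Variables (m : nat) (A B : comPzRingType) (f : {rmorphism A -> B}).

Let lift_symbols : {freeg (m.-tuple (Gm A)) / int} -> {freeg (m.-tuple (Gm B)) / int} :=
  fglift (fun s : m.-tuple (Gm A) => << [tuple of map (Gm_map f) s] >>).
Definition KM_map (x : KM m A) : KM m B :=
  \pi_(Quotient.quot (@KM_sub m B)) (lift_symbols (repr x)).

Let KM_mem_rel (x y : {freeg (m.-tuple (Gm B)) / int}) :
  \pi_(Quotient.quot (@KM_sub m B)) x = \pi_(Quotient.quot (@KM_sub m B)) y <->
  KM_rel (x - y).
Proof.
split=> [/eqP|] h; last apply/eqP; rewrite -?Quotient.idealrBE in h *.
  exact: asboolW h.
exact/asboolP.
Qed.

Let lift_symbolsB : {morph lift_symbols : x y / x - y}.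
Proof. exact: lift_is_additive. Qed.
Let lift_symbols1 s : lift_symbols << s >> = << [tuple of map (Gm_map f) s] >>.
Proof. by rewrite /lift_symbols liftU scale1r. Qed.
Let lift_symbols_rel x : KM_rel x -> KM_rel (lift_symbols x).
Proof.
elim=> [|{}x y _ hx _ hy|i s s1 s2 hi hj|i j s hij h].
- have := lift_symbolsB 0 0; rewrite !subrr => ->; exact: KM_rel0.
- by rewrite lift_symbolsB; apply: KM_relB.
- rewrite !lift_symbolsB !lift_symbols1; apply: (KM_rel_multilinear (i := i)).
    by rewrite !tnth_map /= -rmorphM -hi.
  by move=> j /hj[h1 h2]; rewrite !tnth_map h1 h2.
rewrite lift_symbols1; apply: (KM_rel_steinberg hij).
by rewrite !tnth_map /= -rmorphD /= h rmorph1.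
Qed.
Let KM_map_pi x :
  KM_map (\pi_(Quotient.quot (@KM_sub m A)) x) =
  \pi_(Quotient.quot (@KM_sub m B)) (lift_symbols x).
Proof.
apply/KM_mem_rel; rewrite -lift_symbolsB; apply: lift_symbols_rel.
have /eqP := reprK (\pi_(Quotient.quot (@KM_sub m A)) x).
by rewrite -Quotient.idealrBE => h; exact: asboolW h.
Qed.

Lemma KM_map_symbol (s : m.-tuple (Gm A)) :
  KM_map (KM_symbol s) = KM_symbol [tuple of map (Gm_map f) s].
Proof. by rewrite KM_map_pi lift_symbols1. Qed.

Fact KM_map_is_zmod_morphism : zmod_morphism KM_map.
Proof.
move=> x y; rewrite -[x]reprK -[y]reprK.
have piB C (a b : {freeg (m.-tuple (Gm C)) / int}) :
    \pi_(Quotient.quot (@KM_sub m C)) (a - b) =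
    \pi_(Quotient.quot (@KM_sub m C)) a - \pi_(Quotient.quot (@KM_sub m C)) b.
  by rewrite !piE.
by rewrite -piB !KM_map_pi lift_symbolsB piB.
Qed.
HB.instance Definition _ :=
  GRing.isZmodMorphism.Build (KM m A) (KM m B) KM_map KM_map_is_zmod_morphism.
End MilnorKMap.

Record simplex_map (p q : nat) : Type := SimplexMap {
  smap :> 'I_p.+1 -> 'I_q.+1 ;
  smapP : {homo smap : i j / (i <= j)%N} }.

Definition simplex_id p : simplex_map p p :=
  @SimplexMap p p id (fun i j h => h).
Definition simplex_comp p q r (g : simplex_map q r) (f : simplex_map p q) :
    simplex_map p r :=
  @SimplexMap p r (fun i => g (f i)) (fun i j h => smapP g (smapP f h)).

Record sset : Type := SSet {
  simp :> nat -> Type ;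
  sact : forall p q, simplex_map p q -> simp q -> simp p ;
  sact_id : forall p (x : simp p), sact (simplex_id p) x = x ;
  sact_comp : forall p q r (g : simplex_map q r) (f : simplex_map p q) x,
    sact (simplex_comp g f) x = sact f (sact g x) }.

Record sset_map (X Y : sset) : Type := SSetMap {
  sfun :> forall p, X p -> Y p ;
  sfun_act : forall p q (f : simplex_map p q) x, sfun (sact f x) = sact f (sfun x) }.

Record std_simplex (p : nat) : Type := StdSimplex {
  bary :> 'rV[RR]_p.+1 ;
  bary_ge0 : forall i, 0 <= bary 0 i ;
  bary_sum : \sum_i bary 0 i = 1 }.

Section Push.
Variables (p q : nat) (f : simplex_map p q) (u : std_simplex p).
Let push_coord : 'rV[RR]_q.+1 := \row_j \sum_(i | f i == j) u 0 i.
Fact push_ge0 j : 0 <= push_coord 0 j.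
Proof. by rewrite mxE sumr_ge0 // => i _; apply: bary_ge0. Qed.
Fact push_sum : \sum_j push_coord 0 j = 1.
Proof.
rewrite -(bary_sum u) [RHS](partition_big f predT) //=.
by apply: eq_bigr => j _; rewrite mxE.
Qed.
Definition simplex_push : std_simplex q := StdSimplex push_ge0 push_sum.
End Push.

Section Realization.
Variable X : sset.

Definition cell : Type := {p : nat & (X p * std_simplex p)%type}.
Definition mkcell p (x : X p) (u : std_simplex p) : cell := existT _ p (x, u).

Inductive glue : cell -> cell -> Prop :=
| Glue p q (f : simplex_map p q) (x : X q) (u : std_simplex p) :
    glue (mkcell (sact f x) u) (mkcell x (simplex_push f u)).

Definition glued : cell -> cell -> Prop := clos_refl_sym_trans cell glue.

Definition geom : Type := {C : cell -> Prop | exists a, C = glued a}.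
Definition point (a : cell) : geom := exist _ (glued a) (ex_intro _ a erefl).

Definition geom_open (U : geom -> Prop) : Prop :=
  forall p (x : X p), exists V : set 'rV[RR]_p.+1,
    open V /\ forall u : std_simplex p, U (point (mkcell x u)) <-> V u.
End Realization.

Section RealizationMap.
Variables (X Y : sset) (f : sset_map X Y).
Definition cell_map (a : cell X) : cell Y :=
  let: existT p xu := a in mkcell (f p xu.1) xu.2.
Fact cell_map_glued a b : glued a b -> glued (cell_map a) (cell_map b).
Proof.
elim=> [_ _ [p q g x u]|{}a|{}a {}b _ h|{}a {}b c _ h1 _ h2].
- by rewrite /= sfun_act; apply: rst_step; exact: (Glue g).
- exact: rst_refl.
- exact: rst_sym.
exact: rst_trans h1 h2.
Qed.
Fact geom_map_subproof (c : geom X) :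
  exists b, (fun d => exists2 a, sval c a & glued (cell_map a) d) = glued b.
Proof.
case: c => /= C [a ->]; exists (cell_map a); apply/funext => d.
apply/propext; split=> [[b ab bd]|ad].
  exact: rst_trans (cell_map_glued ab) bd.
by exists a => //; apply: rst_refl.
Qed.
Definition geom_map (c : geom X) : geom Y := exist _ _ (geom_map_subproof c).
Lemma geom_map_point a : geom_map (point a) = point (cell_map a).
Proof.
apply: eq_exist; apply/funext => d; apply/propext; split=> [[b ab bd]|ad].
  exact: rst_trans (cell_map_glued ab) bd.
by exists a => //; apply: rst_refl.
Qed.
End RealizationMap.

Fact simplex0_subproof1 i : 0 <= (const_mx 1 : 'rV[RR]_1) 0 i.
Proof. by rewrite mxE. Qed.
Fact simplex0_subproof2 : \sum_i (const_mx 1 : 'rV[RR]_1) 0 i = 1.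
Proof. by rewrite big_ord1 mxE. Qed.
Definition vertex (X : sset) (x : X 0%N) : geom X :=
  point (mkcell x (StdSimplex simplex0_subproof1 simplex0_subproof2)).

Definition clamp (s : RR) : RR := Num.min 1 (Num.max 0 s).
Definition seg_coord (s : RR) : 'rV[RR]_2 :=
  \row_(i < 2) if i == ord0 then 1 - clamp s else clamp s.
Fact seg_ge0 s i : 0 <= seg_coord s 0 i.
Proof.
rewrite mxE /clamp; case: ifP => _; first by rewrite subr_ge0 ge_min lexx.
by rewrite le_min ler01 le_max lexx.
Qed.
Fact seg_sum s : \sum_i seg_coord s 0 i = 1.
Proof. by rewrite !big_ord_recl big_ord0 !mxE /= addr0 subrK. Qed.
(* The point [(1 - s, s)] of the 1-simplex, for [0 <= s <= 1]. *)
Definition seg (s : RR) : std_simplex 1 := StdSimplex (seg_ge0 s) (seg_sum s).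

Definition snoc k (z : 'rV[RR]_k) (s : RR) : 'rV[RR]_k.+1 :=
  \row_i if unlift ord_max i is Some j then z 0 j else s.
Definition belast_row k (w : 'rV[RR]_k.+1) : 'rV[RR]_k :=
  \row_j w 0 (lift ord_max j).
Definition last_coord k (w : 'rV[RR]_k.+1) : RR := w 0 ord_max.
Definition set_first k (w : 'rV[RR]_k.+1) (s : RR) : 'rV[RR]_k.+1 :=
  \row_i if i == ord0 then s else w 0 i.

Definition in01 (s : RR) : Prop := 0 <= s <= 1.
Definition cube k (z : 'rV[RR]_k) : Prop := forall i, in01 (z 0 i).
Definition cube_bdry k (z : 'rV[RR]_k) : Prop :=
  cube z /\ exists i, z 0 i = 0 \/ z 0 i = 1.

Section Homotopy.
Variable X : sset.

(* Maps from the cube are represented by functions on the whole of [R^k], of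
   which only the restriction to the cube matters. *)
Definition cube_continuous k (f : 'rV[RR]_k -> geom X) : Prop :=
  forall U, geom_open U -> exists V : set 'rV[RR]_k,
    open V /\ forall z, cube z -> (U (f z) <-> V z).

Definition concat k (f g : 'rV[RR]_k.+1 -> geom X) (z : 'rV[RR]_k.+1) : geom X :=
  if 2 * z 0 ord0 <= 1 then f (set_first z (2 * z 0 ord0))
  else g (set_first z (2 * z 0 ord0 - 1)).

Variable x0 : X 0%N.

Definition sphere k (f : 'rV[RR]_k -> geom X) : Prop :=
  cube_continuous f /\ forall z, cube_bdry z -> f z = vertex x0.

Definition homotopic k (f g : 'rV[RR]_k -> geom X) : Prop :=
  exists2 H : 'rV[RR]_k.+1 -> geom X, cube_continuous H &
    (forall z, cube z -> H (snoc z 0) = f z /\ H (snoc z 1) = g z) /\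
    (forall z s, cube_bdry z -> in01 s -> H (snoc z s) = vertex x0).

(* The homotopy group [pi_k(|X|, x0)], as a set of homotopy classes. *)
Definition hgroup (k : nat) : Type :=
  {C : ('rV[RR]_k -> geom X) -> Prop |
    exists2 f, sphere f & C = (fun g => sphere g /\ homotopic f g)}.
Definition represents k (f : 'rV[RR]_k -> geom X) (x : hgroup k) : Prop := sval x f.

Definition hgroup_add k (x y z : hgroup k.+1) : Prop :=
  exists f g, [/\ represents f x, represents g y & represents (concat f g) z].
End Homotopy.

(* The map induced on homotopy groups by a map of simplicial sets, as a graph. *)
Definition hgroup_map (X Y : sset) (x0 : X 0%N) (y0 : Y 0%N) (f : sset_map X Y) k
    (x : hgroup x0 k) (y : hgroup y0 k) : Prop :=
  exists2 g, represents g x & represents (fun z => geom_map f (g z)) y.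

(* The map induced by a zigzag [X <- W -> Y] whose left leg is a weak
   equivalence. *)
Definition hgroup_zigzag (X W Y : sset) (x0 : X 0%N) (y0 : Y 0%N)
    (l : sset_map W X) (r : sset_map W Y) k
    (x : hgroup x0 k) (y : hgroup y0 k) : Prop :=
  exists2 w : 'rV[RR]_k -> geom W, cube_continuous w &
    represents (fun z => geom_map l (w z)) x /\
    represents (fun z => geom_map r (w z)) y.

(* A category, presented by its identities and its composition relation: this
   is what is needed to form its nerve. *)
Record relcat : Type := RelCat {
  rob :> Type ;
  rhom : rob -> rob -> Type ;
  ris_id : forall x, rhom x x -> Prop ;
  ris_comp : forall x y z, rhom x y -> rhom y z -> rhom x z -> Prop }.

Record relfun (C D : relcat) : Type := RelFun {
  fob :> C -> D ;
  fhom : forall x y, rhom x y -> rhom (fob x) (fob y) ;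
  fhom_id : forall x (f : rhom x x), ris_id f -> ris_id (fhom f) ;
  fhom_comp : forall x y z (f : rhom x y) (g : rhom y z) (h : rhom x z),
    ris_comp f g h -> ris_comp (fhom f) (fhom g) (fhom h) }.

Section Nerve.
Variable C : relcat.

(* Functors from the ordered set [{0 < ... < p}] to [C]. *)
Record chain (p : nat) : Type := Chain {
  chob : 'I_p.+1 -> C ;
  chhom : forall i j : 'I_p.+1, (i <= j)%N -> rhom (chob i) (chob j) ;
  chhom_id : forall (i : 'I_p.+1) (h : (i <= i)%N), ris_id (chhom h) ;
  chhom_comp : forall (i j k : 'I_p.+1) (ij : (i <= j)%N) (jk : (j <= k)%N)
    (ik : (i <= k)%N), ris_comp (chhom ij) (chhom jk) (chhom ik) }.

Definition chain_act p q (f : simplex_map p q) (c : chain q) : chain p :=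
  @Chain p (fun i => chob c (f i)) (fun i j h => chhom c (smapP f h))
    (fun i h => chhom_id c _)
    (fun i j k ij jk ik => chhom_comp c _ _ _).

Lemma chain_eq p (o : 'I_p.+1 -> C)
    (m m' : forall i j : 'I_p.+1, (i <= j)%N -> rhom (o i) (o j)) a b a' b' :
  (forall (i j : 'I_p.+1) (h : (i <= j)%N), m i j h = m' i j h) ->
  @Chain p o m a b = @Chain p o m' a' b'.
Proof.
move=> mm'.
have E : m = m' by do 3 (apply: functional_extensionality_dep => ?); exact: mm'.
by subst m'; congr Chain; exact: Prop_irrelevance.
Qed.

Fact chain_act_id p (c : chain p) : chain_act (simplex_id p) c = c.
Proof. by case: c => o m a b; apply: chain_eq => i j h; congr m; exact: bool_irrelevance. Qed.
Fact chain_act_comp p q r (g : simplex_map q r) (f : simplex_map p q) c :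
  chain_act (simplex_comp g f) c = chain_act f (chain_act g c).
Proof. by apply: chain_eq => i j h /=; congr chhom; exact: bool_irrelevance. Qed.

Definition nerve : sset := SSet chain_act_id chain_act_comp.
End Nerve.

Definition chain_map (C D : relcat) (F : relfun C D) p (c : chain C p) : chain D p :=
  @Chain D p (fun i => F (chob c i)) (fun i j h => fhom F (chhom c h))
    (fun i h => fhom_id F (chhom_id c h))
    (fun i j k ij jk ik => fhom_comp F (chhom_comp c ij jk ik)).
Definition nerve_map (C D : relcat) (F : relfun C D) : sset_map (nerve C) (nerve D) :=
  @SSetMap (nerve C) (nerve D) (@chain_map C D F) (fun p q f x => erefl).

Definition interval_cat : relcat :=
  @RelCat bool (fun b c => b ==> c) (fun _ _ => True) (fun _ _ _ _ _ _ => True).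

Fact interval_edge_subproof (i j : 'I_2) :
  (i <= j)%N -> (i == ord_max) ==> (j == ord_max).
Proof. by case: i j => [[|[|//]] ?] [[|[|//]] ?]. Qed.
Definition interval_edge : nerve interval_cat 1%N :=
  @Chain interval_cat 1 (fun i => i == ord_max) interval_edge_subproof
    (fun _ _ => I) (fun _ _ _ _ _ _ => I).
Definition interval_point (s : RR) : geom (nerve interval_cat) :=
  point (mkcell interval_edge (seg s)).

(* [C * {0 < 1}] *)
Definition cylinder (C : relcat) : relcat :=
  @RelCat (C * bool)%type (fun x y => rhom x.1 y.1 * (x.2 ==> y.2))%type
    (fun x f => ris_id f.1) (fun x y z f g h => ris_comp f.1 g.1 h.1).
Definition cylinder_fst C : relfun (cylinder C) C :=
  @RelFun (cylinder C) C fst (fun x y f => f.1) (fun x f h => h)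
    (fun x y z f g h e => e).
Definition cylinder_snd C : relfun (cylinder C) interval_cat :=
  @RelFun (cylinder C) interval_cat snd (fun x y f => f.2) (fun x f h => I)
    (fun x y z f g h e => I).

Section ModuleNotions.
Variable S : comPzRingType.

Definition short_exact (K L C : lmodType S) (k : {linear K -> L}) (c : {linear L -> C}) :=
  [/\ injective k, (forall y, c y = 0 <-> exists x, y = k x)
    & (forall z, exists y, z = c y)].

Definition fin_gen (M : lmodType S) : Prop :=
  exists n (g : 'I_n -> M), forall x, exists a : 'I_n -> S, x = \sum_i a i *: g i.
Definition projective (M : lmodType S) : Prop :=
  forall (N L : lmodType S) (e : {linear N -> L}) (f : {linear M -> L}),
    (forall z, exists y, z = e y) -> exists g : {linear M -> N}, forall x, e (g x) = f x.
Definition fg_projective (M : lmodType S) : Prop := fin_gen M /\ projective M.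

Definition res1 (P : lmodType S -> Prop) (M : lmodType S) : Prop :=
  exists (P1 P0 : lmodType S) (d : {linear P1 -> P0}) (e : {linear P0 -> M}),
    [/\ P P1, P P0 & short_exact d e].
End ModuleNotions.

(* An exact category of [S]-modules: a class of modules, the exact sequences
   being the exact sequences of modules with terms in the class. *)
Record modclass (S : comPzRingType) : Type := ModClass {
  mcls :> lmodType S -> Prop ;
  mcls0 : mcls 'rV[S]_0 }.

Lemma rV0_eq (S : comPzRingType) (x y : 'rV[S]_0) : x = y.
Proof. by rewrite [x]thinmx0 [y]thinmx0. Qed.

Section QCategory.
Variables (S : comPzRingType) (P : modclass S).

(* A morphism [M <<- L >-> N] of the Q-construction, up to isomorphism of [L],
   is recorded as the image of [L] in [M * N]; composition in [Q] is then the
   composition of relations. *)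
Definition is_Qmor (M N : lmodType S) (G : M -> N -> Prop) : Prop :=
  exists (K L C : lmodType S) (k : {linear K -> L}) (q : {linear L -> M})
         (i : {linear L -> N}) (c : {linear N -> C}),
    [/\ [/\ P K, P L & P C], short_exact k q, short_exact i c
      & forall x y, G x y <-> exists l, x = q l /\ y = i l].

Record modob : Type := ModOb { und_mod :> lmodType S ; modobP : P und_mod }.

Definition rel_id (M : Type) (G : M -> M -> Prop) : Prop :=
  forall x y, G x y <-> x = y.
Definition rel_comp (M N L : Type) (G : M -> N -> Prop) (H : N -> L -> Prop)
    (K : M -> L -> Prop) : Prop :=
  forall x z, K x z <-> exists y, G x y /\ H y z.

Definition Qcat : relcat :=
  @RelCat modob (fun M N => {G : M -> N -> Prop | is_Qmor G})
    (fun M G => rel_id (sval G))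
    (fun M N L G H K => rel_comp (sval G) (sval H) (sval K)).

Definition zero_ob : Qcat := ModOb (mcls0 P).

Fact zero_id_Qmor : is_Qmor (fun x y : 'rV[S]_0 => x = y).
Proof.
pose z : {linear 'rV[S]_0 -> 'rV[S]_0} := idfun.
exists 'rV[S]_0, 'rV[S]_0, 'rV[S]_0, z, z, z, z.
have zz : short_exact z z.
  split=> [x y _|y|y]; first exact: rV0_eq.
    by split=> _; [exists y|exact: rV0_eq].
  by exists y.
split=> //; first by have := mcls0 P.
by move=> x y; split=> [->|_]; [exists y | exact: rV0_eq].
Qed.

Fact zero_chain_id : ris_id (exist _ _ zero_id_Qmor : rhom zero_ob zero_ob).
Proof. by []. Qed.
Fact zero_chain_comp : let z : rhom zero_ob zero_ob := exist _ _ zero_id_Qmor in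
  ris_comp z z z.
Proof. by move=> z x y; split=> [->|[w [-> ->]]] //; exists y. Qed.
Definition base : nerve Qcat 0%N :=
  @Chain Qcat 0 (fun _ => zero_ob) (fun _ _ _ => exist _ _ zero_id_Qmor)
    (fun _ _ => zero_chain_id) (fun _ _ _ _ _ _ => zero_chain_comp).

(* Objects with an automorphism, and the morphisms of [Q] compatible with it. *)
Record autob : Type := AutOb {
  aut_ob :> modob ;
  aut : {linear aut_ob -> aut_ob} ;
  aut_inv : {linear aut_ob -> aut_ob} ;
  autK : cancel aut aut_inv ;
  aut_invK : cancel aut_inv aut }.

Definition Qautcat : relcat :=
  @RelCat autob
    (fun M N => {G : M -> N -> Prop |
       is_Qmor G /\ forall x y, G (aut M x) (aut N y) <-> G x y})
    (fun M G => rel_id (sval G))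
    (fun M N L G H K => rel_comp (sval G) (sval H) (sval K)).

Definition forget_aut : relfun Qautcat Qcat :=
  @RelFun Qautcat Qcat aut_ob
    (fun M N G => exist _ (sval G) (proj1 (svalP G)))
    (fun M G h => h) (fun M N L G H K h => h).

(* The functor [Qautcat * {0 < 1} -> Qcat] given by the automorphisms, seen as a
   natural automorphism of [forget_aut]. *)
Definition twist_rel (X Y : cylinder Qautcat) (G : X.1 -> Y.1 -> Prop) :
    X.1 -> Y.1 -> Prop :=
  if ~~ X.2 && Y.2 then fun x y => G (aut X.1 x) y else G.

Fact twist_rel_Qmor (X Y : cylinder Qautcat) (G : rhom X Y) :
  is_Qmor (twist_rel (sval G.1)).
Proof.
case: X Y G => [M b] [N c] [[/= G [hG cG]] _]; rewrite /twist_rel /=.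
case: ifP => // _.
case: hG => [K [L [C [k [q [i [d [hP kq id hG]]]]]]]].
exists K, L, C, k, [the {linear L -> M} of aut_inv M \o q], i, d.
split=> //.
  case: kq => [injk kerq surjq]; split=> //= [y|z].
    rewrite -kerq; split=> [h|->]; last by rewrite linear0.
    by rewrite -[q y](aut_invK (a := M)) h linear0.
  have [y hy] := surjq (aut M z); exists y.
  by rewrite -hy autK.
move=> x y; rewrite hG; split=> [[l [h1 h2]]|[l [-> h2]]]; exists l; split=> //=.
  by rewrite -h1 autK.
by rewrite aut_invK.
Qed.

Fact twist_id (X : cylinder Qautcat) (G : rhom X X) :
  ris_id G -> rel_id (twist_rel (sval G.1)).
Proof. by case: X G => [M b] [G h]; rewrite /twist_rel /= andNb. Qed.

Fact twist_comp (X Y Z : cylinder Qautcat) (G : rhom X Y) (H : rhom Y Z) (K : rhom X Z) :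
  ris_comp G H K ->
  rel_comp (twist_rel (sval G.1)) (twist_rel (sval H.1)) (twist_rel (sval K.1)).
Proof.
case: X Y Z G H K => [X a] [Y b] [Z c] [[/= G [qG cG]] ab] [[/= H [qH cH]] bc] [[/= K [qK cK]] ac].
rewrite /twist_rel /= => E.
case: a b c ab bc ac => [] [] [] //= _ _ _ x z; rewrite E //.
split=> [[y [h1 h2]]|[y [h1 h2]]].
  exists (aut_inv Y y); split; last by rewrite aut_invK.
  by rewrite -cG aut_invK.
by exists (aut Y y); rewrite cG.
Qed.

Definition twist : relfun (cylinder Qautcat) Qcat :=
  @RelFun (cylinder Qautcat) Qcat (fun X => aut_ob X.1)
    (fun X Y G => exist _ _ (twist_rel_Qmor G)) twist_id twist_comp.

Section UnitAut.
Variable a : Gm S.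

Fact scal_unitK (M : lmodType S) :
  cancel ( *:%R (Gm_val a) : M -> M) ( *:%R (Gm_invval a)).
Proof. by move=> x; rewrite scalerA mulrC Gm_mulV scale1r. Qed.
Fact scal_unit_invK (M : lmodType S) :
  cancel ( *:%R (Gm_invval a) : M -> M) ( *:%R (Gm_val a)).
Proof. by move=> x; rewrite scalerA Gm_mulV scale1r. Qed.

Definition unit_autob (M : Qcat) : Qautcat :=
  @AutOb M [the {linear M -> M} of *:%R (Gm_val a)]
    [the {linear M -> M} of *:%R (Gm_invval a)] (@scal_unitK M) (@scal_unit_invK M).

Fact unit_aut_comm (M N : Qcat) (G : rhom M N) (x : M) (y : N) :
  sval G (Gm_val a *: x) (Gm_val a *: y) <-> sval G x y.
Proof.
case: G => G [K [L [C [k [q [i [d [hP kq id hG]]]]]]]] /=; rewrite !hG.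
split=> [[l [h1 h2]]|[l [-> ->]]]; last by exists (Gm_val a *: l); rewrite !linearZ.
exists (Gm_invval a *: l); rewrite !linearZ -h1 -h2 /= !scalerA.
by rewrite mulrC Gm_mulV !scale1r.
Qed.

Definition unit_aut : relfun Qcat Qautcat :=
  @RelFun Qcat Qautcat unit_autob
    (fun M N G => exist _ (sval G) (conj (svalP G) (unit_aut_comm G)))
    (fun M G h => h) (fun M N L G H K h => h).
End UnitAut.
End QCategory.

Section QIncl.
Variables (S : comPzRingType) (P P' : modclass S).
Hypothesis PP' : forall M, P M -> P' M.

Fact Qincl_Qmor (M N : lmodType S) (G : M -> N -> Prop) : is_Qmor P G -> is_Qmor P' G.
Proof.
case=> [K [L [C [k [q [i [d [[hK hL hC] kq id hG]]]]]]]].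
by exists K, L, C, k, q, i, d; split=> //; split; exact: PP'.
Qed.
Definition Qincl : relfun (Qcat P) (Qcat P') :=
  @RelFun (Qcat P) (Qcat P') (fun M => ModOb (PP' (modobP M)))
    (fun M N G => exist _ (sval G) (Qincl_Qmor (svalP G)))
    (fun M G h => h) (fun M N L G H K h => h).
End QIncl.

(* The submodule of [N * N'] spanned by the image of a relation. *)
Inductive span_image (B : comPzRingType) (M M' : Type) (N N' : lmodType B)
    (u : M -> N) (u' : M' -> N') (G : M -> M' -> Prop) : N -> N' -> Prop :=
| SpanImage0 : span_image u u' G 0 0
| SpanImageD a x x' y y' : G x x' -> span_image u u' G y y' ->
    span_image u u' G (a *: u x + y) (a *: u' x' + y').

Section QTransport.
Variables (A B : comPzRingType) (P : modclass A) (P' : modclass B).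
Variable E : forall (M : lmodType A) (N : lmodType B), (M -> N) -> Prop.

(* The graph, up to isomorphism, of an exact functor [F : P -> P'] for which
   [E u] expresses that [u : M -> N] identifies [N] with [F M]: the first
   projection to [Qcat P] is an equivalence of categories. *)
Record transob : Type := TransOb {
  tr_src : Qcat P ;
  tr_tgt : Qcat P' ;
  tr_fun : tr_src -> tr_tgt ;
  tr_funP : E tr_fun }.

Definition Qtrans : relcat :=
  @RelCat transob
    (fun X Y => {GG : rhom (tr_src X) (tr_src Y) * rhom (tr_tgt X) (tr_tgt Y) |
       forall y y', sval GG.2 y y' <->
         span_image (@tr_fun X) (@tr_fun Y) (sval GG.1) y y'})
    (fun X GG => ris_id (sval GG).1 /\ ris_id (sval GG).2)
    (fun X Y Z GG HH KK => ris_comp (sval GG).1 (sval HH).1 (sval KK).1 /\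
       ris_comp (sval GG).2 (sval HH).2 (sval KK).2).

Definition Qtrans_src : relfun Qtrans (Qcat P) :=
  @RelFun Qtrans (Qcat P) tr_src (fun X Y GG => (sval GG).1)
    (fun X GG h => proj1 h) (fun X Y Z GG HH KK h => proj1 h).
Definition Qtrans_tgt : relfun Qtrans (Qcat P') :=
  @RelFun Qtrans (Qcat P') tr_tgt (fun X Y GG => (sval GG).2)
    (fun X GG h => proj2 h) (fun X Y Z GG HH KK h => proj2 h).
End QTransport.

Section BaseChange.
Variables (A B : comPzRingType) (f : {rmorphism A -> B}).

Definition semilinear (M : lmodType A) (N : lmodType B) (u : M -> N) : Prop :=
  forall a x y, u (a *: x + y) = f a *: u x + u y.

(* [u] identifies [N] with the tensor product of [M] and [B] over [A]. *)
Definition base_change (M : lmodType A) (N : lmodType B) (u : M -> N) : Prop :=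
  semilinear u /\
  forall (L : lmodType B) (v : M -> L), semilinear v ->
    exists2 w : {linear N -> L}, (forall x, v x = w (u x)) &
      forall w' : {linear N -> L}, (forall x, v x = w' (u x)) -> w' =1 w.

(* [u] identifies [M] with the [A]-module underlying the [B]-module [N]. *)
Definition restriction (N : lmodType B) (M : lmodType A) (u : N -> M) : Prop :=
  bijective u /\ forall a x y, u (f a *: x + y) = a *: u x + u y.
End BaseChange.

Section ZeroModules.
Variable S : comPzRingType.

Fact fg_projective0 : fg_projective 'rV[S]_0.
Proof.
split; first by exists 0%N, (fun _ => 0) => x; exists (fun _ => 0); exact: rV0_eq.
move=> N L e f _; exists [the {linear 'rV[S]_0 -> N} of \0] => x.
by rewrite linear0 [x](rV0_eq _ 0) linear0.
Qed.

Fact short_exact_id0 (M : lmodType S) :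
  short_exact [the {linear 'rV[S]_0 -> M} of \0] [the {linear M -> M} of idfun].
Proof.
split=> [x y _|y|z]; [exact: rV0_eq | | by exists z].
by rewrite /=; split=> [->|[x ->]] //; exists 0.
Qed.
Fact res1_incl (P : modclass S) (M : lmodType S) : P M -> res1 P M.
Proof.
move=> PM; exists 'rV[S]_0, M, [the {linear 'rV[S]_0 -> M} of \0],
  [the {linear M -> M} of idfun].
by split=> //; [exact: mcls0 | exact: short_exact_id0].
Qed.
End ZeroModules.

(* [P(A)] *)
Definition exP (A : comPzRingType) : modclass A := ModClass (fg_projective0 A).
Definition res1_class (A : comPzRingType) (P : modclass A) : modclass A :=
  ModClass (res1_incl (mcls0 P)).

Section LaurentCategories.
Variable A : comPzRingType.

(* [H(A)] and [V(A)]; [P^1(A[[t]])] and [V^1(A)] are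
   [res1_class (exP (pseries A))] and [res1_class (exV A)]. *)
Definition exH_pred (M : lmodType (pseries A)) : Prop :=
  res1 (exP _) M /\ exists N : nat, forall x : M, psX A ^+ N *: x = 0.
Fact exH_pred0 : exH_pred 'rV[pseries A]_0.
Proof. by split; [exact: (mcls0 (res1_class (exP _))) | exists 0%N => x; exact: rV0_eq]. Qed.
Definition exH : modclass (pseries A) := ModClass exH_pred0.

Definition exV_pred (N : lmodType (laurent A)) : Prop :=
  fg_projective N /\
  exists (P : lmodType (pseries A)) (u : P -> N),
    fg_projective P /\ base_change [the {rmorphism _ -> _} of @ps_to_ls A] u.
Fact exV_pred0 : exV_pred 'rV[laurent A]_0.
Proof.
split; first exact: fg_projective0.
exists 'rV[pseries A]_0, (fun _ => 0); split; first exact: fg_projective0.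
split=> [a x y|L v hv]; first by rewrite scaler0 addr0.
have v0 : v 0 = 0.
  by have := hv (-1) 0 0; rewrite scaler0 addr0 rmorphN1 scaleN1r addNr.
exists [the {linear 'rV[laurent A]_0 -> L} of \0] => [x|w' _ x].
  by rewrite [x](rV0_eq _ 0) v0.
by rewrite [x](rV0_eq _ 0) !linear0.
Qed.
Definition exV : modclass (laurent A) := ModClass exV_pred0.

Fact exH_sub_P1 M : exH M -> res1_class (exP (pseries A)) M. Proof. by case. Qed.
Fact exV_sub_exP N : exV N -> exP (laurent A) N. Proof. by case. Qed.
Fact exV_sub_V1 N : exV N -> res1_class exV N. Proof. exact: res1_incl. Qed.
End LaurentCategories.

(* [K_m(P) = pi_(m+1)(BQ(P), 0)]. *)
Definition KQ (S : comPzRingType) (P : modclass S) (m : nat) : Type :=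
  hgroup (base P) m.+1.
Definition K (m : nat) (A : comPzRingType) : Type := KQ (exP A) m.
Definition K_add (m : nat) (A : comPzRingType) (x y z : K m A) : Prop :=
  hgroup_add x y z.

Definition KQ_incl (S : comPzRingType) (P P' : modclass S)
    (PP' : forall M, P M -> P' M) m (x : KQ P m) (y : KQ P' m) : Prop :=
  hgroup_map (nerve_map (Qincl PP')) x y.

Definition KQ_trans (A B : comPzRingType) (P : modclass A) (P' : modclass B)
    (E : forall (M : lmodType A) (N : lmodType B), (M -> N) -> Prop) m
    (x : KQ P m) (y : KQ P' m) : Prop :=
  hgroup_zigzag (nerve_map (Qtrans_src P P' E)) (nerve_map (Qtrans_tgt P P' E)) x y.

Definition K_base_change (A B : comPzRingType) (f : {rmorphism A -> B}) m
    (x : K m A) (y : K m B) : Prop :=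
  KQ_trans (@base_change A B f) x y.

Section AutomorphismProduct.
Variable A : comPzRingType.
Let Q := nerve (Qcat (exP A)).
Let Qaut := nerve (Qautcat (exP A)).
Let forget : sset_map Qaut Q := nerve_map (forget_aut (exP A)).

(* Let [f] be a map from the [(m+1)]-cube to the nerve of the category of objects
   with an automorphism. The tautological natural automorphism of the forgetful
   functor gives a loop, with parameter the last coordinate, of maps from the
   cube to [BQ], based at the image [f'] of [f]; [y] is the class such that this
   loop is freely homotopic to the translate by the constant loop [f'] of a loop
   of maps representing [y] (so that [y] is its class in
   [pi_1(Omega^(m+1) BQ, f') = pi_1(Omega^(m+1) BQ, 0) = K_(m+1)]). The translate
   is formed by concatenation along the first coordinate. *)
Definition aut_product m (f : 'rV[RR]_m.+1 -> geom Qaut) (y : K m.+1 A) : Prop :=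
  exists (F : 'rV[RR]_m.+2 -> geom (nerve (cylinder (Qautcat (exP A)))))
         (g : 'rV[RR]_m.+2 -> geom Q) (H : 'rV[RR]_m.+3 -> geom Q),
  [/\ cube_continuous F /\
      (forall z s, cube z -> in01 s ->
         geom_map (nerve_map (cylinder_fst _)) (F (snoc z s)) = f z /\
         geom_map (nerve_map (cylinder_snd _)) (F (snoc z s)) = interval_point s),
      represents g y, cube_continuous H,
      (forall w, cube w ->
         H (snoc w 0) = geom_map (nerve_map (twist (exP A))) (F w) /\
         H (snoc w 1) = concat (fun v => geom_map forget (f (belast_row v))) g w)
    & (forall z r, cube z -> in01 r ->
         H (snoc (snoc z 0) r) = H (snoc (snoc z 1) r)) /\
      (forall z s r, cube_bdry z -> in01 s -> in01 r ->
         H (snoc (snoc z s) r) = vertex (base (exP A)))].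

(* The product of [x] in [K_m(A)] with the class of the unit [a] in [K_1(A)], that
   is, with the automorphism [a] of the free module of rank 1: the product of
   Loday is induced by the tensor product, and tensoring a module with
   [(A, a)] is the same as equipping it with the multiplication by [a]. *)
Definition unit_product m (x : K m A) (a : Gm A) (y : K m.+1 A) : Prop :=
  forall f, represents f x ->
    aut_product (fun z => geom_map (nerve_map (unit_aut (exP A) a)) (f z)) y.

Definition first_vertex : simplex_map 0 1 :=
  @SimplexMap 0 1 (fun _ => ord0) (fun _ _ _ => leqnn _).
Definition last_vertex : simplex_map 0 1 :=
  @SimplexMap 0 1 (fun _ => ord_max) (fun _ _ _ => leqnn _).

(* The loop [0 >-> A^r ->> 0] in [BQ], which represents the class of [A^r] in
   [K_0(A)], lifted by means of the automorphism [g] of [A^r] (acting on row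
   vectors). The edge [e1] is the monomorphism [0 >-> A^r], the edge [e2] the
   epimorphism [A^r ->> 0], both being morphisms from [0] to [A^r] in [Q]. *)
Definition free_loop r (g : 'M[A]_r) (f : 'rV[RR]_1 -> geom Qaut) : Prop :=
  exists (e1 e2 : Qaut 1%N) (theta : {linear chob e1 ord_max -> 'rV[A]_r}),
  [/\ bijective theta /\
        (forall x, theta (aut (chob e1 ord_max) x) = theta x *m g),
      sact last_vertex e1 = sact last_vertex e2,
      sact first_vertex e1 = sact first_vertex e2 /\
        forget 0%N (sact first_vertex e1) = base (exP A),
      (forall h x y, sval (@chhom _ _ e1 ord0 ord_max h) x y <-> y = 0) /\
        (forall h x y, sval (@chhom _ _ e2 ord0 ord_max h) x y)
    & forall z, f z = if 2 * z 0 ord0 <= 1 then point (mkcell e1 (seg (2 * z 0 ord0)))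
                      else point (mkcell e2 (seg (2 - 2 * z 0 ord0)))].
End AutomorphismProduct.

Definition K0_one (A : comPzRingType) (x : K 0 A) : Prop :=
  exists2 f, free_loop (1%:M : 'M[A]_1) f &
    represents (fun z => geom_map (nerve_map (forget_aut (exP A))) (f z)) x.

(* The connecting map of the homotopy fibration
   [BQ(H(A)) -> BQ(P^1(A[[t]])) -> BQ(V^1(A))], where the functor
   [P^1(A[[t]]) -> V^1(A)] is the localization. The element [x] is lifted to a
   cube [G] in the total space, one face of which lies in the fibre and
   represents [y]. The choice [b] of this face only affects the sign. *)
Definition connecting (b : bool) (A : comPzRingType) m
    (x : KQ (res1_class (exV A)) m.+1) (y : KQ (exH A) m) : Prop :=
  exists (G : 'rV[RR]_m.+2 -> geom (nerve (Qtrans (res1_class (exP (pseries A)))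
              (res1_class (exV A)) (@base_change _ _ [the {rmorphism _ -> _} of @ps_to_ls A]))))
         (g : 'rV[RR]_m.+1 -> geom (nerve (Qcat (exH A)))),
  [/\ cube_continuous G, represents g y,
      represents (fun w => geom_map (nerve_map (Qtrans_tgt _ _ _)) (G w)) x
    & forall w, cube_bdry w ->
        geom_map (nerve_map (Qtrans_src _ _ _)) (G w) =
        if w 0 ord_max == b%:R then geom_map (nerve_map (Qincl (@exH_sub_P1 A))) (g (belast_row w))
        else vertex (base (res1_class (exP (pseries A))))].

(* The composite of [K_(m+1)(A((t))) = K_(m+1)(V(A)) = K_(m+1)(V^1(A))], of the
   connecting map and of the map induced by the forgetful functor from [H(A)]
   to projective [A]-modules. *)
Definition boundary_rel (b : bool) (A : comPzRingType) m
    (x : K m.+1 (laurent A)) (y : K m A) : Prop :=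
  exists (xV : KQ (exV A) m.+1) (x1 : KQ (res1_class (exV A)) m.+1) (h : KQ (exH A) m),
  [/\ KQ_incl (@exV_sub_exP A) xV x, KQ_incl (@exV_sub_V1 A) xV x1, connecting b x1 h
    & KQ_trans (@restriction A (pseries A) [the {rmorphism _ -> _} of @ps_const A]) h y].

Definition laurent_T (A : comPzRingType) : Gm (laurent A) :=
  mkGm (ls_T_unit A).

(* The morphism of functors [K^M_m -> K_m], [{a_1, ..., a_m} |-> a_1 . ... . a_m]. *)
Record loday_symbol : Type := LodaySymbol {
  loday_sym :> forall m (A : comPzRingType), KM m A -> K m A ;
  loday_symD : forall m (A : comPzRingType) (x y : KM m A),
    K_add (loday_sym x) (loday_sym y) (loday_sym (x + y)) ;
  loday_sym0 : forall A, K0_one (loday_sym (KM_symbol ([tuple] : 0.-tuple (Gm A)))) ;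
  loday_symS : forall m (A : comPzRingType) (s : m.-tuple (Gm A)) (a : Gm A),
    unit_product (loday_sym (KM_symbol s)) a (loday_sym (KM_symbol [tuple of rcons s a])) ;
  loday_sym_natural : forall m (A B : comPzRingType) (f : {rmorphism A -> B}) (x : KM m A),
    K_base_change f (loday_sym x) (loday_sym (KM_map f x)) }.

(* The boundary maps, with [bdry m : K_(m+1)(A((t))) -> K_m(A)]. They are
   determined by [bdry_rel] up to a sign depending only on [m], which is fixed
   by [bdry_normalized]. *)
Record boundary_map : Type := BoundaryMap {
  bdry :> forall m (A : comPzRingType), K m.+1 (laurent A) -> K m A ;
  bdry_rel : forall m, exists b, forall (A : comPzRingType) (x : K m.+1 (laurent A)),
    boundary_rel b x (bdry x) ;
  bdryD : forall m (A : comPzRingType) (x y z : K m.+1 (laurent A)),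
    K_add x y z -> K_add (bdry x) (bdry y) (bdry z) ;
  bdry_natural : forall m (A B : comPzRingType) (f : {rmorphism A -> B})
      (x : K m.+1 (laurent A)) (y : K m.+1 (laurent B)),
    K_base_change [the {rmorphism _ -> _} of laurent_map f] x y ->
    K_base_change f (bdry x) (bdry y) ;
  bdry_normalized : forall m (A : comPzRingType) (x : K m (pseries A)) (x' : K m (laurent A))
      (x0 : K m A) (y : K m.+1 (laurent A)),
    K_base_change [the {rmorphism _ -> _} of @ps_to_ls A] x x' ->
    K_base_change [the {rmorphism _ -> _} of @ps_ev0 A] x x0 ->
    unit_product x' (laurent_T A) y -> bdry y = x0 }.

(* The determinant [K_1(A) -> A^*]; every class in [K_1(A)] is that of an
   automorphism of some [A^r], so that it is determined by [k1det_aut]. *)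
Record K1_det : Type := K1Det {
  k1det :> forall A : comPzRingType, K 1 A -> Gm A ;
  k1detD : forall (A : comPzRingType) (x y z : K 1 A), K_add x y z ->
    Gm_val (k1det z) = Gm_val (k1det x) * Gm_val (k1det y) ;
  k1det_aut : forall (A : comPzRingType) r (g : 'M[A]_r) f (x : K 1 A),
    free_loop g f -> aut_product f x -> Gm_val (k1det x) = \det g ;
  k1det_natural : forall (A B : comPzRingType) (f : {rmorphism A -> B}) (x : K 1 A) (y : K 1 B),
    K_base_change f x y -> k1det y = Gm_map f (k1det x) }.

(* In [iter_laurent n A = A((t_1))...((t_n))] the variable [t_n] is the outermost
   one, hence the first one to be removed. *)
Fixpoint bdry_iter (bd : boundary_map) (n : nat) (A : comPzRingType) :
    K n.+1 (iter_laurent n A) -> K 1 A :=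
  match n return K n.+1 (iter_laurent n A) -> K 1 A with
  | 0 => id
  | n'.+1 => fun x => bdry_iter bd (bd n'.+1 (iter_laurent n' A) x)
  end.

Definition CC (sym : loday_symbol) (bd : boundary_map) (dt : K1_det)
    (n : nat) (A : comPzRingType) (x : KM n.+1 (iter_laurent n A)) : Gm A :=
  dt A (bdry_iter bd (sym n.+1 (iter_laurent n A) x)).

Record prime_ideal (A : comPzRingType) : Type := PrimeIdeal {
  pideal :> A -> Prop ;
  pideal0 : pideal 0 ;
  pidealD : forall x y, pideal x -> pideal y -> pideal (x + y) ;
  pidealM : forall a x, pideal x -> pideal (a * x) ;
  pideal1 : ~ pideal 1 ;
  pideal_prime : forall x y, pideal (x * y) -> pideal x \/ pideal y }.

Section PullbackIdeal.
Variables (A B : comPzRingType) (f : {rmorphism A -> B}) (p : prime_ideal B).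
Fact pullback_ideal0 : p (f 0). Proof. by rewrite rmorph0; exact: pideal0. Qed.
Fact pullback_idealD x y : p (f x) -> p (f y) -> p (f (x + y)).
Proof. by rewrite rmorphD; exact: pidealD. Qed.
Fact pullback_idealM a x : p (f x) -> p (f (a * x)).
Proof. by rewrite rmorphM; exact: pidealM. Qed.
Fact pullback_ideal1 : ~ p (f 1). Proof. by rewrite rmorph1; exact: pideal1. Qed.
Fact pullback_ideal_prime x y : p (f (x * y)) -> p (f x) \/ p (f y).
Proof. by rewrite rmorphM; exact: pideal_prime. Qed.
Definition pullback_ideal : prime_ideal A :=
  PrimeIdeal pullback_ideal0 pullback_idealD pullback_idealM pullback_ideal1
    pullback_ideal_prime.
End PullbackIdeal.

Record loc_const (A : comPzRingType) : Type := LocConst {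
  lcval :> prime_ideal A -> int ;
  lcvalP : forall p : prime_ideal A, exists s : A,
    ~ p s /\ forall q : prime_ideal A, ~ q s -> lcval q = lcval p }.

Fact loc_const_map_subproof (A B : comPzRingType) (f : {rmorphism A -> B})
    (i : loc_const A) (p : prime_ideal B) :
  exists s : B, ~ p s /\ forall q : prime_ideal B, ~ q s ->
    i (pullback_ideal f q) = i (pullback_ideal f p).
Proof.
have [s [ps hs]] := lcvalP i (pullback_ideal f p).
by exists (f s); split=> // q qs; exact: hs.
Qed.
Definition loc_const_map (A B : comPzRingType) (f : {rmorphism A -> B})
    (i : loc_const A) : loc_const B :=
  LocConst (loc_const_map_subproof f i).

(* [b = a^i], through a decomposition of [A] as the product of the rings
   [A e_j], for orthogonal idempotents [e_j] of sum 1, such that [i] is constant,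
   of value [k_j], on [Spec (A e_j)]. *)
Definition is_lcpow (A : comPzRingType) (i : loc_const A) (a b : Gm A) : Prop :=
  exists (r : nat) (e : 'I_r -> A) (k : 'I_r -> int),
  [/\ forall j l, e j * e l = if j == l then e j else 0,
      \sum_j e j = 1,
      forall (p : prime_ideal A) j, ~ p (e j) -> i p = k j
    & Gm_val b = \sum_j e j * Gm_expz a (k j)].

Definition torsion_free (R : comPzRingType) : Prop :=
  forall (m : nat) (x : R), (0 < m)%N -> x *+ m = 0 -> x = 0.

(* Morphisms [(L^n K^M_(n+1))_R -> (G_m)_R] of functors from [R]-algebras to
   abelian groups. *)
Record LKM_to_Gm (n : nat) (R : comPzRingType) : Type := LKMToGm {
  lkm_fun :> forall (A : comPzRingType) (f : {rmorphism R -> A}),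
    KM n.+1 (iter_laurent n A) -> Gm A ;
  lkm_mul : forall (A : comPzRingType) (f : {rmorphism R -> A}) x y,
    Gm_val (lkm_fun f (x + y)) = Gm_val (lkm_fun f x) * Gm_val (lkm_fun f y) ;
  lkm_natural : forall (A B : comPzRingType) (f : {rmorphism R -> A})
      (g : {rmorphism R -> B}) (h : {rmorphism A -> B}),
    (forall r, h (f r) = g r) ->
    forall x, lkm_fun g (KM_map (iter_laurent_map n h) x) = Gm_map h (lkm_fun f x) }.

(* Main.v *)
(* Write [L^n A] for [A((t_1))...((t_n))]. Only three properties of the
   Contou-Carrere symbol matter: it is multiplicative, it is natural, and it maps
   [{a, t_1, ..., t_n}] to [a]. The last one is the normalization of the boundary
   maps, applied [n] times. A morphism [Phi] restricts on [{a, t_1, ..., t_n}] to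
   an endomorphism of [G_m], hence to [a |-> sum_j e_j a^(k_j)] for orthogonal
   idempotents [e_j] of sum 1; these define the locally constant integer, and
   after division by the corresponding power of the symbol it remains to prove
   that a morphism [F] which is trivial on all [{a, t_1, ..., t_n}] is trivial.

   (1) A character of [L^n G_m], over any ring, is trivial as soon as it is so on
   monomials and on [1 + s t^l] with [s] nilpotent. A unit of [L^n A] is locally
   the product of a monomial, of a constant and of units [1 + g] such that
   [1 + s g] is a unit over [A[s]]; the value at the latter is a polynomial in [s],
   so that it can be computed modulo [s^k] for all [k], and then [g] may be
   replaced by finite sums by the same argument with an auxiliary variable [y]
   which weights the coefficients of [g].
   (2) Applying (1) to each argument, it is enough to evaluate [F] at variables
   [t_j] and elements [1 + s_i t^(l_i)], with [s_i^k = 0]. These are defined over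
   [R[s_0, ..., s_r]/(s_i^k)], which is torsion free; there
   [F (1 + s t^l)^2 = F (1 + 2 s t^l)] up to terms in [s^2] allows one to reduce to
   square-zero [s_i].
   (3) For square-zero elements write [F (1 + eps g, u) = 1 + eps D(g, u)]. The
   Steinberg relation makes [u |-> D(u g, u)] additive, and then
   [F (1 + eps g, 1 + eps' t^l) = 1 + eps eps' D(g t^l, t^l)]. This removes the
   square-zero arguments one by one; it also gives, by antisymmetry,
   [D(t^l, t^l) = 0], which leaves the case [l = 0], that is, the assumption on [F]. *)
Require Import Defs.
From HB Require Import structures.
From mathcomp.multinomials Require Import freeg.
From mathcomp Require Import all_boot all_order all_algebra.
From mathcomp Require Import boolp zify ring.

Set Implicit Arguments.
Unset Strict Implicit.
Unset Printing Implicit Defensive.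
Import Order.TTheory GRing.Theory Num.Theory.
Local Open Scope ring_scope.
Local Open Scope quotient_scope.

(** * Units, nilpotents and idempotents *)

Section UnitsNilpotents.
Variable A : comPzRingType.
Implicit Types x y : A.

Definition isU x := exists y, x * y = 1.
Definition nilp x := exists k, x ^+ k = 0.

Lemma isU1 : isU 1. Proof. by exists 1; rewrite mulr1. Qed.
Lemma isUM x y : isU x -> isU y -> isU (x * y).
Proof. by case=> x' hx [y' hy]; exists (x' * y'); rewrite mulrACA hx hy mulr1. Qed.
Lemma isUl x y : x * y = 1 -> isU x. Proof. by exists y. Qed.
Lemma isUr x y : x * y = 1 -> isU y. Proof. by rewrite mulrC; exists x. Qed.
Lemma isUMl x y : isU (x * y) -> isU x.
Proof. by case=> z hz; exists (y * z); rewrite mulrA. Qed.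
Lemma isUN x : isU x -> isU (- x).
Proof. by case=> y h; exists (- y); rewrite mulrNN. Qed.
Lemma isUX x k : isU x -> isU (x ^+ k).
Proof. by move=> h; elim: k => [|k ih]; rewrite ?exprS; [exact: isU1 | exact: isUM]. Qed.
Lemma isU_cancel x y z : isU x -> x * y = x * z -> y = z.
Proof. by case=> x' h e; rewrite -[y]mul1r -[z]mul1r -h mulrAC e mulrAC. Qed.

Lemma nilp0 : nilp 0. Proof. by exists 1%N; rewrite expr1. Qed.
Lemma nilpX x k n : x ^+ k = 0 -> (k <= n)%N -> x ^+ n = 0.
Proof. by move=> h /subnK <-; rewrite exprD h mulr0. Qed.
Lemma nilpMl x y : nilp x -> nilp (y * x).
Proof. by case=> k h; exists k; rewrite exprMn h mulr0. Qed.
Lemma nilpMr x y : nilp x -> nilp (x * y).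
Proof. by rewrite mulrC; exact: nilpMl. Qed.
Lemma nilpN x : nilp x -> nilp (- x).
Proof. by rewrite -mulN1r; exact: nilpMl. Qed.
Lemma nilpD x y : nilp x -> nilp y -> nilp (x + y).
Proof.
case=> k hk [n hn]; exists (k + n)%N; rewrite exprDn big1 // => i _.
case: (leqP n i) => hi; first by rewrite (nilpX hn hi) mulr0 mul0rn.
by rewrite (@nilpX x k) ?mul0r ?mul0rn //; lia.
Qed.
Lemma nilpB x y : nilp x -> nilp y -> nilp (x - y).
Proof. by move=> hx /nilpN; exact: nilpD. Qed.
Lemma nilp_sum (I : Type) (r : seq I) (P : pred I) (F : I -> A) :
  (forall i, P i -> nilp (F i)) -> nilp (\sum_(i <- r | P i) F i).
Proof. by move=> h; elim/big_ind: _ => //; [exact: nilp0 | exact: nilpD]. Qed.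
Lemma nilp_sqr x : nilp (x ^+ 2) -> nilp x.
Proof. by case=> k; rewrite -exprM => h; exists (2 * k)%N. Qed.

Lemma geometric x k : (1 - x) * (\sum_(i < k) x ^+ i) = 1 - x ^+ k.
Proof. by rewrite -opprB mulNr -subrX1 opprB. Qed.

Lemma isU_1nilp x : nilp x -> isU (1 + x).
Proof.
case=> k h; exists (\sum_(i < k) (- x) ^+ i).
by rewrite -{1}[x]opprK geometric exprNn h mulr0 subr0.
Qed.
Lemma isU_nilpD u x : isU u -> nilp x -> isU (u + x).
Proof.
case=> v uv hx; have -> : u + x = u * (1 + v * x) by rewrite mulrDr mulr1 mulrA uv mul1r.
by apply: isUM; [exists v | apply/isU_1nilp/nilpMl].
Qed.
End UnitsNilpotents.

Lemma isU_map (A B : comPzRingType) (h : {rmorphism A -> B}) x : isU x -> isU (h x).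
Proof. by case=> y e; exists (h y); rewrite -rmorphM e rmorph1. Qed.
Lemma nilp_map (A B : comPzRingType) (h : {rmorphism A -> B}) x : nilp x -> nilp (h x).
Proof. by case=> k e; exists k; rewrite -rmorphXn e rmorph0. Qed.

Section IdempotentLifting.
Variable A : comPzRingType.

Lemma idem_nilp0 (e : A) : e * e = e -> nilp e -> e = 0.
Proof.
move=> ee [k hk]; have eX n : e ^+ n.+1 = e by elim: n => [|n ih] //; rewrite exprS ih ee.
by rewrite -(eX k) exprS hk mulr0.
Qed.

Lemma idem_isU_eq (e f : A) : e * e = e -> f * f = f -> isU (1 - (e - f) ^+ 2) -> e = f.
Proof.
move=> ee ff; set d := e - f => u.
have d3 : d * (1 - d ^+ 2) = 0.
  rewrite /d; have -> : (e - f) * (1 - (e - f) ^+ 2) =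
   e - e * e * e - f + f * f * f + 3%:R * (e * e * f) - 3%:R * (e * (f * f)) by ring.
  by rewrite !ee !ff; ring.
by apply/eqP; rewrite -subr_eq0 -/d; apply/eqP; apply: (isU_cancel u); rewrite mulrC d3 mulr0.
Qed.

Lemma idem_lift (x : A) : nilp (x * (1 - x)) ->
  exists e, e * e = e /\ nilp (e - x).
Proof.
case=> N hN; set y := 1 - x in hN *; rewrite exprMn in hN.
have s1 : (x + y) ^+ (N + N) = 1 by rewrite /y addrC subrK expr1n.
have [a [b hab]] : exists a b, x ^+ N * a + y ^+ N * b = 1.
  rewrite exprDn (bigID (fun i : 'I_(N + N).+1 => (i <= N)%N)) /= in s1.
  exists (\sum_(i < (N + N).+1 | (i <= N)%N) x ^+ (N - i) * y ^+ i *+ 'C(N + N, i)).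
  exists (\sum_(i < (N + N).+1 | ~~ (i <= N)%N) x ^+ (N + N - i) * y ^+ (i - N) *+ 'C(N + N, i)).
  rewrite -[RHS]s1 !mulr_sumr; congr (_ + _); apply: eq_bigr => i hi; rewrite !mulrnAr; congr (_ *+ _).
    by rewrite mulrA -exprD; congr (_ ^+ _ * _); lia.
  by rewrite mulrCA -exprD; congr (_ * _ ^+ _); lia.
set e := x ^+ N * a; set f := y ^+ N * b in hab *.
have ef : e * f = 0 by rewrite /e /f mulrACA hN mul0r.
have ee : e * e = e by rewrite -[RHS]mulr1 -[in RHS]hab mulrDr ef addr0.
have ff : f * f = f by rewrite -[RHS]mulr1 -[in RHS]hab mulrDr [f * e]mulrC ef add0r.
exists e; split=> //.
have -> : e - x = e * y - f * x by rewrite /y -[f](addKr e) hab; ring.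
have eX n (g : A) : g * g = g -> (n > 0)%N -> g ^+ n = g.
  by move=> gg; elim: n => [|[|n] ih] // _; rewrite exprS ih.
apply: nilpB; exists N.+1.
  rewrite exprMn eX // exprS /e.
  have -> : x ^+ N * a * (y * y ^+ N) = x ^+ N * y ^+ N * (a * y) by ring.
  by rewrite hN mul0r.
rewrite exprMn eX // exprS /f.
have -> : y ^+ N * b * (x * x ^+ N) = x ^+ N * y ^+ N * (b * x) by ring.
by rewrite hN mul0r.
Qed.
End IdempotentLifting.

Section RetractRing.
Variable S : comPzRingType.

(* The quotient of [S] by the kernel of [rt], modelled on the image of [rt]. *)
Record retraction := Retraction {
  rt :> S -> S ;
  rtB : forall x y, rt (x - y) = rt x - rt y ;
  rtK : forall x, rt (rt x) = rt x ;
  rtM : forall x y, rt (rt x * y) = rt (x * y) }.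

Variable t : retraction.
Lemma rt0 : t 0 = 0. Proof. by have := rtB t 0 0; rewrite !subrr. Qed.
Lemma rtN x : t (- x) = - t x. Proof. by rewrite -sub0r rtB rt0 sub0r. Qed.
Lemma rtD x y : t (x + y) = t x + t y.
Proof. by rewrite -[y]opprK rtB rtN !opprK. Qed.

Definition retr := {x : S | t x == x}.
HB.instance Definition _ := Choice.on retr.
Implicit Types x y : retr.
Lemma retrP x : t (val x) = val x. Proof. exact/eqP/(valP x). Qed.
Definition rproj (a : S) : retr := exist _ (t a) (introT eqP (rtK t a)).

Definition retr_add x y := rproj (val x + val y).
Definition retr_opp x := rproj (- val x).
Definition retr_mul x y := rproj (val x * val y).
Fact retr_addA : associative retr_add.
Proof. by move=> x y z; apply: val_inj; rewrite /= !rtD !rtK !retrP addrA. Qed.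
Fact retr_addC : commutative retr_add.
Proof. by move=> x y; apply: val_inj; rewrite /= addrC. Qed.
Fact retr_add0 : left_id (rproj 0) retr_add.
Proof. by move=> x; apply: val_inj; rewrite /= rt0 add0r retrP. Qed.
Fact retr_addN : left_inverse (rproj 0) retr_opp retr_add.
Proof. by move=> x; apply: val_inj; rewrite /= rtN retrP addNr. Qed.
HB.instance Definition _ :=
  GRing.isZmodule.Build retr retr_addA retr_addC retr_add0 retr_addN.
Fact retr_mulC : commutative retr_mul.
Proof. by move=> x y; apply: val_inj; rewrite /= mulrC. Qed.
Fact retr_mulA : associative retr_mul.
Proof.
by move=> x y z; apply: val_inj; rewrite /= rtM [val x * _]mulrC rtM mulrC mulrA.
Qed.
Fact retr_mul1 : left_id (rproj 1) retr_mul.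
Proof. by move=> x; apply: val_inj; rewrite /= rtM mul1r retrP. Qed.
Fact retr_mulDl : left_distributive retr_mul +%R.
Proof.
by move=> x y z; apply: val_inj; rewrite /= rtM mulrDl !rtD !rtK.
Qed.
HB.instance Definition _ := GRing.Zmodule_isComPzRing.Build retr
  retr_mulA retr_mulC retr_mul1 retr_mulDl.

Fact rproj_is_zmod_morphism : zmod_morphism rproj.
Proof.
move=> a b; apply: val_inj; rewrite [LHS]/= -[RHS]/(t (t a + t (- t b))).
by rewrite rtD !rtN !rtK rtB.
Qed.
Fact rproj_is_monoid_morphism : monoid_morphism rproj.
Proof.
split=> // a b; apply: val_inj; rewrite [LHS]/= -[RHS]/(t (t a * t b)).
by rewrite rtM [a * t b]mulrC rtM mulrC.
Qed.
HB.instance Definition _ :=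
  GRing.isZmodMorphism.Build S retr rproj rproj_is_zmod_morphism.
HB.instance Definition _ :=
  GRing.isMonoidMorphism.Build S retr rproj rproj_is_monoid_morphism.
Lemma val_retrB x y : val (x - y) = val x - val y.
Proof. by rewrite -[x - y]/(retr_add x (retr_opp y)) /= rtN retrP rtD rtN !retrP. Qed.
End RetractRing.

Lemma corner (B : comPzRingType) (e : B) : e * e = e ->
  exists (C : comPzRingType) (p : {rmorphism B -> C}),
    p e = 1 /\ forall x y, p x = p y -> e * x = e * y.
Proof.
move=> ee.
have rB x y : e * (x - y) = e * x - e * y by rewrite mulrBr.
have rK x : e * (e * x) = e * x by rewrite mulrA ee.
have rM x y : e * (e * x * y) = e * (x * y) by rewrite !mulrA ee.
pose t := Retraction rB rK rM.
exists (retr t), [the {rmorphism B -> retr t} of @rproj B t]; split.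
  by apply: val_inj; rewrite /= mulr1.
by move=> x y /(congr1 val).
Qed.

(** * Truncated polynomials and polynomials *)

Lemma cauchy_sum (C : nmodType) (N : nat) (u : nat -> nat -> C) :
  (forall i j, (N <= i + j)%N -> u i j = 0) ->
  \sum_(i < N) \sum_(j < N) u i j = \sum_(m < N) \sum_(i < m.+1) u i (m - i)%N.
Proof.
move=> u0; transitivity (\sum_(m < N) \sum_(i < N | (i <= m)%N) u i (m - i)%N); last first.
  apply: eq_bigr => m _.
  rewrite (big_ord_widen_cond N predT (fun i => u i (m - i)%N)) //=.
rewrite [RHS](exchange_big_dep predT) //=; apply: eq_bigr => i _.
rewrite -(big_mkord (fun m => i <= m)%N (fun m => u i (m - i)%N)).
rewrite -(big_mkord predT (u i)) (@big_cat_nat _ _ _ (N - i) 0 N) //=; last exact: leq_subr.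
rewrite [X in _ + X]big_nat_cond [X in _ + X]big1 ?addr0 => [|j]; last by move=> hj; apply: u0; lia.
rewrite [RHS](@big_cat_nat _ _ _ i 0 N) //=; last exact: ltnW.
rewrite [X in _ = X + _]big_nat_cond [X in _ = X + _]big1 ?add0r => [|j hj]; last lia.
rewrite [in RHS](_ : index_iota i N = index_iota (0 + i) N) // big_addn !big_mkord; apply: eq_big => j; first by rewrite leq_addl.
by rewrite addnK.
Qed.

Section PseriesEval.
Variables (B D : comPzRingType) (g : {rmorphism B -> D}) (d : D).

Definition pev N (p : nat -> B) : D := \sum_(i < N) g (p i) * d ^+ i.

Lemma pevB N p q : pev N (fun i => p i - q i) = pev N p - pev N q.
Proof. by rewrite -sumrB; apply: eq_bigr => i _; rewrite rmorphB mulrBl. Qed.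

Lemma pevM N (p q : pseries B) :
  (forall i j, (N <= i + j)%N -> g (p i) * g (q j) * d ^+ (i + j) = 0) ->
  pev N (p * q) = pev N p * pev N q.
Proof.
move=> h; rewrite /pev mulr_suml.
transitivity (\sum_(i < N) \sum_(j < N) g (p i) * g (q j) * d ^+ (i + j)); last first.
  apply: eq_bigr => i _; rewrite mulr_sumr; apply: eq_bigr => j _.
  by rewrite exprD mulrACA.
rewrite (@cauchy_sum _ N (fun i j => g (p i) * g (q j) * d ^+ (i + j))) //.
apply: eq_bigr => m _; rewrite /= rmorph_sum mulr_suml; apply: eq_bigr => i _.
by rewrite rmorphM; congr (_ * _ ^+ _); have := ltn_ord i; lia.
Qed.

Lemma pev_widen N M p : (N <= M)%N -> (forall i, (N <= i)%N -> g (p i) * d ^+ i = 0) ->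
  pev M p = pev N p.
Proof.
move=> NM h; rewrite /pev -!(big_mkord predT (fun i => g (p i) * d ^+ i)).
rewrite (@big_cat_nat _ _ _ N 0 M) //= [X in _ + X]big_nat_cond [X in _ + X]big1 ?addr0 // => i hi.
by apply: h; lia.
Qed.

Lemma pev_psX N : pev N (psX B) = if (1 < N)%N then d else 0.
Proof.
have gX i : g (psX B i) = (i == 1%N)%:R by rewrite rmorph_nat.
rewrite /pev; under eq_bigr do rewrite gX.
case: N => [|[|n]]; rewrite ?big_ord0 ?big_ord1 ?mul0r //.
rewrite 2!big_ord_recl mul0r add0r mul1r expr1 big1 ?addr0 // => i _.
by rewrite mul0r.
Qed.
End PseriesEval.

Lemma psXn_coef (B : comPzRingType) n (f : pseries B) k :
  (psX B ^+ n * f) k = if (n <= k)%N then f (k - n)%N else 0.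
Proof.
elim: n k => [|n ih] k; first by rewrite expr0 mul1r subn0.
by rewrite exprS -mulrA ps_mulXE; case: k => [|k] //; rewrite ih.
Qed.
Lemma ps_constM (B : comPzRingType) (a : B) (f : pseries B) k : (ps_const a * f) k = a * f k.
Proof.
rewrite /= big_ord_recl /= subn0 big1 ?addr0 // => i _; by rewrite mul0r.
Qed.
Lemma ps_sum_coef (B : comPzRingType) (I : Type) (r : seq I) (P : pred I) (F : I -> pseries B) k :
  (\sum_(i <- r | P i) F i) k = \sum_(i <- r | P i) F i k.
Proof. by elim/big_rec2: _ => // i y1 y2 _ <-. Qed.
Lemma ps_polyE (B : comPzRingType) (p : nat -> B) M j :
  (\sum_(i < M) ps_const (p i) * psX B ^+ i) j = if (j < M)%N then p j else 0.
Proof.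
rewrite ps_sum_coef -(big_mkord predT (fun i => (ps_const (p i) * psX B ^+ i) j)).
have E i : (ps_const (p i) * psX B ^+ i) j = if i == j then p j else 0.
  rewrite ps_constM -[_ ^+ i]mulr1 psXn_coef; case: ltngtP => h.
  - have -> : (1 : pseries B) (j - i)%N = 0 by case: (j - i)%N (subn_gt0 i j) => //; rewrite h.
    by rewrite mulr0.
  - by rewrite mulr0.
  by rewrite h subnn mulr1.
under eq_bigr do rewrite E.
case: ltnP => h; last first.
  by rewrite big_nat_cond big1 // => i hi; case: eqP => //; lia.
rewrite big_mkord (bigD1 (Ordinal h)) //= eqxx big1 ?addr0 // => i hi.
by case: eqP => // e; case/eqP: hi; apply: val_inj.
Qed.

(* [B[s]/(s^k)] *)
Record trunc_alg (k : nat) (B : comPzRingType) := TruncAlg {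
  tr_ring :> comPzRingType ;
  tr_in : {rmorphism B -> tr_ring} ;
  tr_s : tr_ring ;
  tr_coef : tr_ring -> nat -> B ;
  tr_sk : tr_s ^+ k = 0 ;
  tr_eq : forall x, x = \sum_(j < k) tr_in (tr_coef x j) * tr_s ^+ j ;
  tr_coefE : forall (p : nat -> B) j, (j < k)%N ->
    tr_coef (\sum_(i < k) tr_in (p i) * tr_s ^+ i) j = p j ;
  tr_lift : forall (D : comPzRingType) (g : {rmorphism B -> D}) (d : D), d ^+ k = 0 ->
    exists h : {rmorphism tr_ring -> D}, (forall b, h (tr_in b) = g b) /\ h tr_s = d }.

Section Trunc.
Variables (k : nat) (B : comPzRingType).
Definition trc (p : pseries B) : pseries B := PSeries (fun i => if (i < k)%N then p i else 0).
Fact trcB x y : trc (x - y) = trc x - trc y.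
Proof. by apply: pseriesP => i; rewrite -[RHS]/(trc x i - trc y i) /=; case: (i < k)%N; rewrite ?subr0. Qed.
Fact trcK x : trc (trc x) = trc x.
Proof. by apply: pseriesP => i /=; case: (i < k)%N. Qed.
Fact trcM x y : trc (trc x * y) = trc (x * y).
Proof.
apply: pseriesP => i /=; case: ifP => // ik; apply: eq_bigr => j _.
by case: ifP => //; have := ltn_ord j; lia.
Qed.
Definition trr := Retraction trcB trcK trcM.
Definition trn := retr trr.

Fact trn_inj (x y : trn) : (forall j, (j < k)%N -> val x j = val y j) -> x = y.
Proof.
move=> h; apply: val_inj; rewrite -[LHS](@retrP _ trr) -[RHS](@retrP _ trr).
by apply: pseriesP => i /=; case: ifP => // /h.
Qed.

Definition trn_proj : {rmorphism pseries B -> trn} := [the {rmorphism _ -> _} of @rproj _ trr].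
Definition trn_in : {rmorphism B -> trn} := trn_proj \o @ps_const B.

Fact trn_sum (p : nat -> B) j : (j < k)%N ->
  val (\sum_(i < k) trn_in (p i) * trn_proj (psX B) ^+ i) j = p j.
Proof.
move=> jk; pose q := \sum_(i < k) ps_const (p i) * psX B ^+ i.
have -> : \sum_(i < k) trn_in (p i) * trn_proj (psX B) ^+ i = trn_proj q.
  by rewrite /q rmorph_sum; apply: eq_bigr => i _; rewrite rmorphM rmorphXn.
by rewrite /= jk ps_polyE jk.
Qed.

Section Lift.
Variables (D : comPzRingType) (g : {rmorphism B -> D}) (d : D) (dk : d ^+ k = 0).
Definition trn_lift (x : trn) : D := pev g d k (val x).
Fact trn_lift_B : zmod_morphism trn_lift.
Proof. by move=> x y; rewrite /trn_lift val_retrB pevB. Qed.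
Fact trn_lift_proj p : trn_lift (trn_proj p) = pev g d k p.
Proof. by apply: eq_bigr => i _; rewrite /= ltn_ord. Qed.
Fact trn_lift_M : monoid_morphism trn_lift.
Proof.
have M (p q : pseries B) : pev g d k (p * q) = pev g d k p * pev g d k q.
  by apply: pevM => i j h; rewrite (nilpX dk h) mulr0.
split=> [|x y].
  rewrite -[1]/(trn_proj 1) trn_lift_proj; case: k dk => [|n] d0.
    by rewrite /pev big_ord0 -d0.
  rewrite /pev big_ord_recl /= rmorph1 mulr1 big1 ?addr0 // => i _.
  by rewrite /= rmorph0 mul0r.
by rewrite -[x * y]/(trn_proj (val x * val y)) trn_lift_proj M.
Qed.
HB.instance Definition _ := GRing.isZmodMorphism.Build trn D trn_lift trn_lift_B.
HB.instance Definition _ := GRing.isMonoidMorphism.Build trn D trn_lift trn_lift_M.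
Fact trn_liftP : exists h : {rmorphism trn -> D},
  (forall b, h (trn_in b) = g b) /\ h (trn_proj (psX B)) = d.
Proof.
exists [the {rmorphism trn -> D} of trn_lift]; split=> [b|].
  rewrite /trn_in /= trn_lift_proj /pev; case: k dk => [|n] d0.
    by rewrite big_ord0 -[g b]mul1r -(expr0 d) d0 mul0r.
  by rewrite big_ord_recl mulr1 big1 ?addr0 // => i _; rewrite /= rmorph0 mul0r.
rewrite /= trn_lift_proj pev_psX; case: ltnP => // k1.
by symmetry; rewrite -[d]expr1; apply: nilpX dk k1.
Qed.
End Lift.

Lemma trunc : trunc_alg k B.
Proof.
apply: (@TruncAlg k B trn trn_in (trn_proj (psX B)) (fun x => val x)).
- rewrite -rmorphXn; apply: trn_inj => j jk /=.
  by rewrite jk -[_ ^+ k]mulr1 psXn_coef leqNgt jk.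
- by move=> x; apply: trn_inj => j jk; rewrite trn_sum.
- exact: trn_sum.
exact: trn_liftP.
Qed.
End Trunc.

(* [B[y]] *)
Record poly_alg (B : comPzRingType) := PolyAlg {
  pl_ring :> comPzRingType ;
  pl_in : {rmorphism B -> pl_ring} ;
  pl_y : pl_ring ;
  pl_coef : pl_ring -> nat -> B ;
  pl_eq : forall x, exists N, forall M, (N <= M)%N ->
    x = \sum_(j < M) pl_in (pl_coef x j) * pl_y ^+ j ;
  pl_lift : forall (D : comPzRingType) (g : {rmorphism B -> D}) (d : D),
    exists h : {rmorphism pl_ring -> D}, (forall b, h (pl_in b) = g b) /\ h pl_y = d }.

Section Poly.
Variable B : comPzRingType.
Definition fsupp : {pred pseries B} := fun p => `[< exists N, forall i, (N <= i)%N -> p i = 0 >].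
Fact fsupp_subring : subring_closed fsupp.
Proof.
split.
- by apply/asboolP; exists 1%N => -[|i].
- move=> p q /asboolP[N hN] /asboolP[M hM]; apply/asboolP; exists (maxn N M) => i hi /=.
  by rewrite hN ?hM ?subr0 //; lia.
move=> p q /asboolP[N hN] /asboolP[M hM]; apply/asboolP; exists (N + M)%N => i hi /=.
rewrite big1 // => j _; case: (leqP N j) => h; first by rewrite hN // mul0r.
by rewrite hM ?mulr0 //; lia.
Qed.
HB.instance Definition _ := GRing.isSubringClosed.Build _ fsupp fsupp_subring.
Record polys := Polys { polys_val :> pseries B ; _ : polys_val \in fsupp }.
HB.instance Definition _ := [isSub for polys_val].
HB.instance Definition _ := [Choice of polys by <:].
HB.instance Definition _ :=
  GRing.SubChoice_isSubComPzRing.Build (pseries B) fsupp polys fsupp_subring.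

Fact polysP (x : polys) : exists N, forall i, (N <= i)%N -> x i = 0.
Proof. exact: asboolW (valP x). Qed.
Fact fsupp_const b : ps_const b \in fsupp.
Proof. by apply/asboolP; exists 1%N => -[|i]. Qed.
Definition polys_in b := Polys (fsupp_const b).
Fact polys_in_B : zmod_morphism polys_in.
Proof. by move=> a b; apply: val_inj; rewrite /= rmorphB. Qed.
Fact polys_in_M : monoid_morphism polys_in.
Proof. by split=> [|a b]; apply: val_inj; rewrite ?rmorph1 ?rmorphM //= rmorphM. Qed.
HB.instance Definition _ := GRing.isZmodMorphism.Build B polys polys_in polys_in_B.
HB.instance Definition _ := GRing.isMonoidMorphism.Build B polys polys_in polys_in_M.
Fact fsupp_X : psX B \in fsupp.
Proof. by apply/asboolP; exists 2%N => -[|[|i]]. Qed.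
Definition polys_X := Polys fsupp_X.

Section Lift.
Variables (D : comPzRingType) (g : {rmorphism B -> D}) (d : D).
Definition fs_bound (x : polys) := projT1 (cid (polysP x)).
Fact fs_boundP (x : polys) i : (fs_bound x <= i)%N -> x i = 0.
Proof. by rewrite /fs_bound; case: cid => N /= h; exact: h. Qed.
Definition polys_lift (x : polys) := pev g d (fs_bound x) x.
Fact polys_liftE N (x : polys) : (forall i, (N <= i)%N -> x i = 0) -> polys_lift x = pev g d N x.
Proof.
move=> h; pose M := maxn N (fs_bound x).
transitivity (pev g d M x).
  by symmetry; apply: pev_widen => [|i hi]; rewrite ?leq_maxr // fs_boundP // rmorph0 mul0r.
by apply: pev_widen => [|i hi]; rewrite ?leq_maxl // h // rmorph0 mul0r.
Qed.
Fact polys_lift_B : zmod_morphism polys_lift.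
Proof.
move=> x y; pose N := maxn (fs_bound x) (fs_bound y).
rewrite !(polys_liftE (N := N)) => [|i hi|i hi|i hi].
- exact: pevB.
- by apply: fs_boundP; lia.
- by apply: fs_boundP; lia.
by rewrite -[_ i]/(x i - y i) !fs_boundP ?subr0 //; lia.
Qed.
Fact polys_lift_M : monoid_morphism polys_lift.
Proof.
split=> [|x y].
  rewrite (polys_liftE (N := 1)) => [|[|i]] //.
  by rewrite /pev big_ord1 /= rmorph1 mulr1.
pose N := (fs_bound x + fs_bound y)%N.
have h i j : (N <= i + j)%N -> g (x i) * g (y j) = 0.
  move=> ij; case: (leqP (fs_bound x) i) => hi; first by rewrite fs_boundP // rmorph0 mul0r.
  by rewrite [y j]fs_boundP ?rmorph0 ?mulr0 //; lia.
rewrite !(polys_liftE (N := N)) => [|i hi|i hi|i hi].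
- by rewrite -pevM // => i j ij; rewrite h ?mul0r.
- by apply: fs_boundP; lia.
- by apply: fs_boundP; lia.
rewrite -[_ i]/((val x * val y) i) /= big1 // => j _.
case: (leqP (fs_bound x) j) => hj; first by rewrite fs_boundP // mul0r.
by rewrite [X in _ * X]fs_boundP ?mulr0 //; lia.
Qed.
HB.instance Definition _ := GRing.isZmodMorphism.Build polys D polys_lift polys_lift_B.
HB.instance Definition _ := GRing.isMonoidMorphism.Build polys D polys_lift polys_lift_M.
Fact polys_liftP : exists h : {rmorphism polys -> D},
  (forall b, h (polys_in b) = g b) /\ h polys_X = d.
Proof.
exists [the {rmorphism polys -> D} of polys_lift]; split=> [b|] /=.
  rewrite (polys_liftE (N := 1)) => [|[|i]] //.
  by rewrite /pev big_ord1 mulr1.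
by rewrite (polys_liftE (N := 2)) => [|[|[|i]]] //; rewrite pev_psX.
Qed.
End Lift.

Fact polys_val_sum M (p : nat -> B) :
  val (\sum_(j < M) polys_in (p j) * polys_X ^+ j) = \sum_(j < M) ps_const (p j) * psX B ^+ j.
Proof. by rewrite rmorph_sum; apply: eq_bigr => j _; rewrite rmorphM rmorphXn. Qed.
Fact polys_eq (x : polys) M : (forall i, (M <= i)%N -> x i = 0) ->
  x = \sum_(j < M) polys_in (x j) * polys_X ^+ j.
Proof.
move=> h; apply: val_inj; rewrite polys_val_sum.
by apply: pseriesP => j; rewrite ps_polyE; case: ltnP => // /h.
Qed.

Lemma polyalg : poly_alg B.
Proof.
apply: (@PolyAlg B polys [the {rmorphism _ -> _} of polys_in] polys_X (fun x => x)).
- move=> x; exists (fs_bound x) => M hM; apply: polys_eq => i hi.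
  by apply: fs_boundP; apply: leq_trans hi.
exact: polys_liftP.
Qed.
End Poly.

(** * Laurent polynomials *)

(* [B[x, x^-1]] *)
Record laurpoly_alg (B : comPzRingType) := LaurpolyAlg {
  lp_ring :> comPzRingType ;
  lp_in : {rmorphism B -> lp_ring} ;
  lp_x : lp_ring ;
  lp_xV : lp_ring ;
  lp_xK : lp_x * lp_xV = 1 ;
  lp_eq : forall u, exists N M (p : nat -> B),
    u = lp_xV ^+ N * \sum_(j < M) lp_in (p j) * lp_x ^+ j ;
  lp_inj : forall M (p q : nat -> B),
    \sum_(j < M) lp_in (p j) * lp_x ^+ j = \sum_(j < M) lp_in (q j) * lp_x ^+ j ->
    forall j, (j < M)%N -> p j = q j ;
  lp_lift : forall (D : comPzRingType) (g : {rmorphism B -> D}) (d d' : D), d * d' = 1 ->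
    exists h : {rmorphism lp_ring -> D}, (forall b, h (lp_in b) = g b) /\ h lp_x = d }.

Section Laurpoly.
Variable B : comPzRingType.
Definition flaur : {pred laurent B} :=
  fun f => `[< exists N (p : polys B), f = ls_of_ps N p >].
Fact ls_of_psN N (p : pseries B) : ls_of_ps N (- p) = - ls_of_ps N p.
Proof.
by apply/eqP; rewrite -addr_eq0 -ls_of_psD addNr; apply/eqP; apply: laurentP => i /=;
  rewrite /ls_coef_of_ps; case: (i + _).
Qed.
Fact plvB (p q : polys B) : polys_val (p - q) = polys_val p - polys_val q.
Proof. exact: (rmorphB (\val : polys B -> pseries B)). Qed.
Fact plvM (p q : polys B) : polys_val (p * q) = polys_val p * polys_val q.
Proof. exact: (rmorphM (\val : polys B -> pseries B)). Qed.
Fact plvX (p : polys B) n : polys_val (p ^+ n) = polys_val p ^+ n.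
Proof. exact: (rmorphXn (\val : polys B -> pseries B)). Qed.
Fact flaur_subring : subring_closed flaur.
Proof.
split.
- by apply/asboolP; exists 0%N, 1.
- move=> f g /asboolP[N [p ->]] /asboolP[M [q ->]]; apply/asboolP.
  exists (M + N)%N, (polys_X B ^+ M * p - polys_X B ^+ N * q).
  rewrite plvB !plvM !plvX ls_of_psD ls_of_psN ls_of_psS.
  by rewrite addnC ls_of_psS.
move=> f g /asboolP[N [p ->]] /asboolP[M [q ->]]; apply/asboolP.
by exists (N + M)%N, (p * q); rewrite ls_mulrE.
Qed.
HB.instance Definition _ := GRing.isSubringClosed.Build _ flaur flaur_subring.
Record lpolys := Lpolys { lpolys_val :> laurent B ; _ : lpolys_val \in flaur }.
HB.instance Definition _ := [isSub for lpolys_val].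
HB.instance Definition _ := [Choice of lpolys by <:].
HB.instance Definition _ :=
  GRing.SubChoice_isSubComPzRing.Build (laurent B) flaur lpolys flaur_subring.

Fact flaur_of N (p : polys B) : ls_of_ps N p \in flaur.
Proof. by apply/asboolP; exists N, p. Qed.
Definition lp_of N (p : polys B) := Lpolys (flaur_of N p).
Fact lp_ofP (f : lpolys) : exists Np, f = lp_of Np.1 Np.2.
Proof. by have /asboolP[N [p e]] := valP f; exists (N, p); apply: val_inj. Qed.
Fact lp_ofM N M p q : lp_of N p * lp_of M q = lp_of (N + M) (p * q).
Proof. by apply: val_inj; rewrite rmorphM -[RHS]/(ls_of_ps (N + M) (polys_val (p * q))) plvM -ls_mulrE. Qed.
Fact lp_ofS N M p : lp_of (M + N) (polys_X B ^+ M * p) = lp_of N p.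
Proof. by apply: val_inj; rewrite -[LHS]/(ls_of_ps _ (polys_val _)) plvM plvX ls_of_psS. Qed.
Fact lp_ofB N p q : lp_of N (p - q) = lp_of N p - lp_of N q.
Proof. by apply: val_inj; rewrite rmorphB -[LHS]/(ls_of_ps _ (polys_val _)) plvB ls_of_psD ls_of_psN. Qed.
Fact lp_of_eq N M p q : lp_of N p = lp_of M q -> polys_X B ^+ M * p = polys_X B ^+ N * q.
Proof.
move=> e; apply: val_inj; apply: (can_inj (@ls_ofK B (N + M))).
have := congr1 val e; rewrite -(lp_ofS N M) -(lp_ofS M N) [(N + M)%N]addnC /=.
by rewrite addnC.
Qed.

Fact lp_of0_B : zmod_morphism (lp_of 0). Proof. exact: lp_ofB. Qed.
Fact lp_of0_M : monoid_morphism (lp_of 0).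
Proof. by split=> [|p q]; rewrite ?lp_ofM //; apply: val_inj. Qed.
HB.instance Definition _ := GRing.isZmodMorphism.Build _ lpolys (lp_of 0) lp_of0_B.
HB.instance Definition _ := GRing.isMonoidMorphism.Build _ lpolys (lp_of 0) lp_of0_M.
Definition lpin : {rmorphism B -> lpolys} := lp_of 0 \o @polys_in B.

Section Lift.
Variables (D : comPzRingType) (g : {rmorphism B -> D}) (d d' : D) (dd' : d * d' = 1).
Let ev : {rmorphism polys B -> D} := [the {rmorphism _ -> _} of polys_lift g d].
Let evX : ev (polys_X B) = d.
Proof. by rewrite /= (polys_liftE _ _ (N := 2)) => [|[|[|i]]] //; rewrite pev_psX. Qed.
Let evin b : ev (polys_in b) = g b.
Proof. by rewrite /= (polys_liftE _ _ (N := 1)) => [|[|i]] //; rewrite /pev big_ord1 mulr1. Qed.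
Let dX n : d ^+ n * d' ^+ n = 1. Proof. by rewrite -exprMn dd' expr1n. Qed.

Definition lpolys_lift (f : lpolys) : D :=
  let Np := projT1 (cid (lp_ofP f)) in d' ^+ Np.1 * ev Np.2.
Fact lpolys_liftE N p : lpolys_lift (lp_of N p) = d' ^+ N * ev p.
Proof.
rewrite /lpolys_lift; case: cid => -[M q] /= /lp_of_eq /(congr1 ev).
rewrite !rmorphM !rmorphXn evX => e.
transitivity (d' ^+ M * d' ^+ N * (d ^+ N * ev q)).
  by rewrite -[LHS]mul1r -(dX N); ring.
by rewrite -e -[RHS]mul1r -(dX M); ring.
Qed.
Fact lpolys_lift_B : zmod_morphism lpolys_lift.
Proof.
move=> f f'; have [[N p] ->] := lp_ofP f; have [[M q] ->] := lp_ofP f'.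
rewrite -(lp_ofS N M p) -(lp_ofS M N q) [(N + M)%N]addnC /= -lp_ofB !lpolys_liftE.
by rewrite rmorphB mulrBr.
Qed.
Fact lpolys_lift_M : monoid_morphism lpolys_lift.
Proof.
split=> [|f f'].
  by rewrite -(rmorph1 (lp_of 0)) lpolys_liftE rmorph1 mulr1.
have [[N p] ->] := lp_ofP f; have [[M q] ->] := lp_ofP f'.
by rewrite lp_ofM !lpolys_liftE exprD rmorphM; ring.
Qed.
HB.instance Definition _ := GRing.isZmodMorphism.Build lpolys D lpolys_lift lpolys_lift_B.
HB.instance Definition _ := GRing.isMonoidMorphism.Build lpolys D lpolys_lift lpolys_lift_M.
Fact lpolys_liftP : exists h : {rmorphism lpolys -> D},
  (forall b, h (lpin b) = g b) /\ h (lp_of 0 (polys_X B)) = d.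
Proof.
exists [the {rmorphism lpolys -> D} of lpolys_lift]; split=> [b|].
  by rewrite -[LHS]/(lpolys_lift (lp_of 0 (polys_in b))) lpolys_liftE mul1r evin.
by rewrite -[LHS]/(lpolys_lift _) lpolys_liftE mul1r evX.
Qed.
End Lift.

Fact lp_sum M (p : nat -> B) :
  \sum_(j < M) lpin (p j) * lp_of 0 (polys_X B) ^+ j =
  lp_of 0 (\sum_(j < M) polys_in (p j) * polys_X B ^+ j).
Proof. by rewrite rmorph_sum; apply: eq_bigr => j _; rewrite rmorphM rmorphXn. Qed.
Fact polys_sumE M (p : nat -> B) j :
  (\sum_(j < M) polys_in (p j) * polys_X B ^+ j : polys B) j = if (j < M)%N then p j else 0.
Proof.
by rewrite -ps_polyE -polys_val_sum. Qed.

Lemma laurpoly : laurpoly_alg B.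
Proof.
apply: (@LaurpolyAlg B lpolys lpin (lp_of 0 (polys_X B)) (lp_of 1 1)).
- by rewrite lp_ofM -[polys_X B]expr1 (lp_ofS 0 1 1); apply: val_inj.
- move=> u; have [[N p] ->] := lp_ofP u; have [M hM] := polysP p.
  exists N, M, p; rewrite lp_sum -polys_eq //=.
  have -> : lp_of 1 1 ^+ N = lp_of N 1.
    elim: N => [|N ih]; first by rewrite expr0; apply: val_inj.
    by rewrite exprS ih lp_ofM mulr1.
  by rewrite lp_ofM mul1r addn0.
- move=> M p q; rewrite !lp_sum => /lp_of_eq; rewrite !expr0 !mul1r => e j jM.
  by have := polys_sumE M p j; rewrite e polys_sumE jM.
exact: lpolys_liftP.
Qed.
End Laurpoly.

(** * Iterated Laurent series *)

Arguments lcoef : simpl never.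

Section LaurentBasics.
Variable S : comPzRingType.
Implicit Types (f g : laurent S) (p q : pseries S).

Definition lsC : {rmorphism S -> laurent S} := @ps_to_ls S \o @ps_const S.
Arguments lsC : simpl never.

Lemma lsB f g i : (f - g) i = f i - g i. Proof. by []. Qed.
Lemma ls0 i : (0 : laurent S) i = 0. Proof. by []. Qed.
Lemma ls_sum (I : Type) (r : seq I) (P : pred I) (F : I -> laurent S) i :
  (\sum_(j <- r | P j) F j) i = \sum_(j <- r | P j) F j i.
Proof. by elim/big_rec2: _ => // j y1 y2 _ <-. Qed.

Lemma ls_of_psE N p i : ls_of_ps N p i = if i + N%:Z is Posz k then p k else 0.
Proof. by []. Qed.
Lemma ls_of_ps_nat N p (k : nat) : ls_of_ps N p (k%:Z - N%:Z) = p k.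
Proof. by rewrite ls_of_psE subrK. Qed.
Lemma ls_of_ps_inj N p q : ls_of_ps N p = ls_of_ps N q -> p = q.
Proof. exact: (can_inj (@ls_ofK S N)). Qed.
Lemma ls_int_cases N (i : int) : (exists k : nat, i = k%:Z - N%:Z) \/ i < - N%:Z.
Proof. by case: (ltP i (- N%:Z)) => h; [right | left; exists (absz (i + N%:Z)); lia]. Qed.
Lemma ls_of_ps_lt N p i : i < - N%:Z -> ls_of_ps N p i = 0.
Proof. by rewrite ls_of_psE; case E: (i + N%:Z) => [k|k] //; lia. Qed.
Lemma ls_rep f : exists N p, f = ls_of_ps N p /\ forall i, i < - N%:Z -> f i = 0.
Proof.
have [N [p ->]] := ls_of_ps_surj f; exists N, p; split=> // i; exact: ls_of_ps_lt.
Qed.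

Lemma lsCM a f i : (lsC a * f) i = a * f i.
Proof.
have [N [p ->]] := ls_of_ps_surj f; rewrite ls_mulrE add0n !ls_of_psE.
by case: (i + _) => k; rewrite ?ps_constM ?mulr0.
Qed.
Lemma ls_coef_nilp f g : (forall i, nilp (f i)) -> forall i, nilp ((f * g) i).
Proof.
have [N [p ->]] := ls_of_ps_surj f; have [M [q ->]] := ls_of_ps_surj g => h i.
rewrite ls_mulrE ls_of_psE; case: (i + _) => k; last exact: nilp0.
by apply: nilp_sum => j _; apply: nilpMr; rewrite -(ls_of_ps_nat N).
Qed.

Lemma lsTM f i : (ls_T S * f) i = f (i - 1).
Proof.
have [N [p ->]] := ls_of_ps_surj f; rewrite ls_mulrE add0n !ls_of_psE.
have -> : i - 1 + N%:Z = i + N%:Z - 1 by ring.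
case: (i + _) => [[|k]|k]; rewrite ?ps_mulXE //.
by have -> : k.+1%:Z - 1 = k by lia.
Qed.
Definition lsTV : laurent S := ls_of_ps 1 1.
Lemma lsTVM f i : (lsTV * f) i = f (i + 1).
Proof.
have e : f = ls_T S * (lsTV * f) by rewrite mulrA ls_T_unit mul1r.
by rewrite {2}e lsTM addrK.
Qed.
Definition tpow (k : int) : laurent S :=
  match k with Posz n => ls_T S ^+ n | Negz n => lsTV ^+ n.+1 end.
Lemma tpowM k f i : (tpow k * f) i = f (i - k).
Proof.
case: k => n; rewrite /tpow.
  elim: n i => [|n ih] i; first by rewrite expr0 mul1r subr0.
  by rewrite exprS -mulrA lsTM ih; congr (lcoef _ _); lia.
have h m j : (lsTV ^+ m * f) j = f (j + m%:Z).
  elim: m j => [|m ih] j; first by rewrite expr0 mul1r addr0.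
  by rewrite exprS -mulrA lsTVM ih; congr (lcoef _ _); lia.
by rewrite h; congr (lcoef _ _); lia.
Qed.
Lemma ls1E i : (1 : laurent S) i = (i == 0)%:R.
Proof. by rewrite -[1]/(ls_of_ps 0 1) ls_of_psE addr0; case: i => [[|k]|k]. Qed.
Lemma tpowE k i : tpow k i = (i == k)%:R.
Proof. by rewrite -[tpow k]mulr1 tpowM ls1E subr_eq0. Qed.
Lemma tpowD k l : tpow (k + l) = tpow k * tpow l.
Proof. by apply: laurentP => i; rewrite tpowM !tpowE; congr (_%:R); lia. Qed.
Lemma tpow0 : tpow 0 = 1. Proof. by []. Qed.
Lemma isU_tpow k : isU (tpow k).
Proof. by exists (tpow (- k)); rewrite -tpowD subrr. Qed.
Lemma lsCtpowE a k i : (lsC a * tpow k) i = if i == k then a else 0.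
Proof. by rewrite lsCM tpowE; case: eqP; rewrite ?mulr1 ?mulr0. Qed.
Lemma lsCE a i : lsC a i = if i == 0 then a else 0.
Proof. by rewrite -lsCtpowE mulr1. Qed.

Lemma ls_finE f N M : (forall i, i < - N%:Z -> f i = 0) -> (forall i, M%:Z - N%:Z <= i -> f i = 0) ->
  f = \sum_(j < M) lsC (f (j%:Z - N%:Z)) * tpow (j%:Z - N%:Z).
Proof.
move=> h1 h2; apply: laurentP => i; rewrite ls_sum; under eq_bigr do rewrite lsCtpowE.
have [[k ->]|hi] := ls_int_cases N i; last first.
  by rewrite h1 // big1 // => j _; case: eqP => //; lia.
case: (ltnP k M) => kM; last first.
  by rewrite h2 ?big1 //; [move=> [j jM] _ /=; case: eqP => //; lia | lia].
rewrite (bigD1 (Ordinal kM)) //= eqxx big1 ?addr0 // => j /eqP jk.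
by case: eqP => // e; case: jk; apply: val_inj => /=; lia.
Qed.

Lemma pseries_ord p : p 0%N = 0 -> forall i j, (j < i)%N -> (p ^+ i) j = 0.
Proof.
move=> p0; elim=> // i ih j ji; rewrite exprS /= big1 // => k _.
case: (posnP k) => [-> |k0]; first by rewrite p0 mul0r.
by rewrite ih ?mulr0 //; have := ltn_ord k; lia.
Qed.
Lemma isU_pseries p : p 0%N = 0 -> isU (1 + p).
Proof.
move=> p0; set r := - p; have r0 : r 0%N = 0 by rewrite /r -[LHS]/(- p 0%N) p0 oppr0.
pose G k : pseries S := \sum_(i < k) r ^+ i.
exists (PSeries (fun k => G k.+1 k)); apply: pseriesP => k.
have -> : 1 + p = 1 - r by rewrite /r opprK.
have Gst j : (j <= k)%N -> G j.+1 j = G k.+1 j.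
  move=> jk; rewrite /G !ps_sum_coef -!(big_mkord predT (fun i => (r ^+ i) j)).
  rewrite [RHS](@big_cat_nat _ _ _ j.+1 0 k.+1) //= [X in _ + X]big_nat_cond.
  by rewrite [X in _ + X]big1 ?addr0 // => i hi; rewrite pseries_ord //; lia.
transitivity (((1 - r) * G k.+1) k).
  by rewrite /=; apply: eq_bigr => i _; rewrite Gst // leq_subr.
rewrite geometric -[LHS]/((1 : pseries S) k - (r ^+ k.+1) k).
by rewrite pseries_ord // subr0.
Qed.

Lemma isU_laurent g : (forall i, i <= 0 -> nilp (g i)) -> isU (1 + g).
Proof.
move=> h; have [N [p [eg hN]]] := ls_rep g.
pose q := PSeries (fun k => if k is 0 then 0 else g k%:Z).
have -> : 1 + g = ps_to_ls (1 + q) + (g - ps_to_ls q) by rewrite rmorphD rmorph1 addrACA subrr addr0.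
apply: isU_nilpD; first by apply: isU_map; apply: isU_pseries.
have qE (i : int) : ps_to_ls q i = if 0 < i then g i else 0.
  by rewrite ls_of_psE addr0; case: i => [[|k]|k].
have -> : g - ps_to_ls q = \sum_(j < N.+1) lsC (g (j%:Z - N%:Z)) * tpow (j%:Z - N%:Z).
  rewrite [LHS](@ls_finE _ N N.+1) => [|i hi|i hi].
  - apply: eq_bigr => j _; congr (lsC _ * _); rewrite lsB qE ifF ?subr0 //.
    by have := ltn_ord j; lia.
  - by rewrite lsB qE hN // if_same subrr.
  by rewrite lsB qE ifT ?subrr //; lia.
apply: nilp_sum => j _; apply: nilpMr; apply: nilp_map; apply: h.
by have := ltn_ord j; lia.
Qed.

Lemma pseries_mul_nilp p q m : (forall k, (k < m)%N -> (p * q) k = 0) ->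
  forall a b, (a + b < m)%N -> nilp (p a * q b).
Proof.
move=> h; suff H s : (s < m)%N -> forall a b, (a + b)%N = s -> nilp (p a * q b).
  by move=> a b; move=> /H; apply.
elim/ltn_ind: s => s ih sm a b ab.
have as1 : (a < s.+1)%N by lia.
have := h _ sm; rewrite /= (bigD1 (Ordinal as1)) //= (_ : (s - a)%N = b); last by lia.
move/eqP; rewrite addr_eq0 => /eqP e.
apply: nilp_sqr; rewrite expr2 {2}e mulrN; apply: nilpN; rewrite mulr_sumr.
apply: nilp_sum => i hi.
have [ia|ia|ia] := ltngtP i a; last by case/eqP: hi; apply: val_inj.
  have -> : p a * q b * (p i * q (s - i)%N) = p i * q b * (p a * q (s - i)%N) by ring.
  by apply: nilpMr; apply: (ih (i + b)%N) => //; lia.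
have -> : p a * q b * (p i * q (s - i)%N) = p a * q (s - i)%N * (p i * q b) by ring.
have := ltn_ord i => iS.
by apply: nilpMr; apply: (ih (a + (s - i))%N) => //; lia.
Qed.

Lemma idem_const (e : laurent S) : e * e = e -> exists E, E * E = E /\ e = lsC E.
Proof.
move=> ee; have [N [p [ep hN]]] := ls_rep e.
set e' := 1 - e.
have hN' i : i < - N%:Z -> e' i = 0 by move=> hi; rewrite lsB ls1E hN // subr0; case: eqP => //; lia.
have e'p := ps_of_lsK hN'; set q := ps_of_ls N e' in e'p.
have pq : p * q = 0.
  apply: (@ls_of_ps_inj (N + N)); rewrite -ls_mulrE -ep e'p /e' mulrBr mulr1 ee subrr.
  by apply: laurentP => i; rewrite ls_of_psE; case: (i + _).
have nil i j : nilp (e i * e' j).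
  have [[a ->]|hi] := ls_int_cases N i; last by rewrite hN // mul0r; apply: nilp0.
  have [[b ->]|hj] := ls_int_cases N j; last by rewrite hN' // mulr0; apply: nilp0.
  rewrite ep -e'p !ls_of_ps_nat; apply: (@pseries_mul_nilp p q (a + b).+1) => // k _.
  by rewrite pq.
have [|E [EE nE]] := @idem_lift _ (e 0).
  by have := nil 0 0; rewrite /e' lsB ls1E eqxx.
exists E; split=> //; apply: idem_isU_eq => //; first by rewrite -rmorphM EE.
have nd i : nilp ((e - lsC E) i).
  rewrite lsB lsCE; case: eqP => [->|/eqP i0]; first by rewrite -opprB; apply: nilpN.
  have := nil i i; rewrite /e' lsB ls1E (negbTE i0) sub0r mulrN => /nilpN.
  by rewrite opprK subr0 => h; apply: nilp_sqr; rewrite expr2.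
apply: isU_laurent => i _.
by apply: nilpN; rewrite expr2; apply: ls_coef_nilp.
Qed.
End LaurentBasics.
Arguments lsC : simpl never.

Section LaurentMapBasics.
Variables (S S' : comPzRingType) (h : {rmorphism S -> S'}).
Lemma laurent_mapC a : laurent_map h (lsC S a) = lsC S' (h a).
Proof.
by apply: laurentP => i; rewrite -[LHS]/(h (lsC S a i)) !lsCE; case: eqP; rewrite ?rmorph0.
Qed.
Lemma laurent_map_tpow k : laurent_map h (tpow S k) = tpow S' k.
Proof. by apply: laurentP => i; rewrite -[LHS]/(h (tpow S k i)) !tpowE rmorph_nat. Qed.
End LaurentMapBasics.

Fixpoint constL n (B : comPzRingType) : {rmorphism B -> iter_laurent n B} :=
  if n is n'.+1 then lsC (iter_laurent n' B) \o constL n' B else idfun.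

Section IterLaurent.
Lemma iter_map_constL n (B C : comPzRingType) (h : {rmorphism B -> C}) b :
  iter_laurent_map n h (constL n B b) = constL n C (h b).
Proof. by elim: n => //= n ih; rewrite laurent_mapC ih. Qed.

Lemma iter_map_comp n (B C D : comPzRingType) (g : {rmorphism C -> D}) (h : {rmorphism B -> C})
    (k : {rmorphism B -> D}) : (forall b, g (h b) = k b) ->
  forall x, iter_laurent_map n g (iter_laurent_map n h x) = iter_laurent_map n k x.
Proof. by move=> e; elim: n => //= n ih x; apply: laurentP => i; apply: ih. Qed.


Lemma iter_map_id n (B : comPzRingType) (h : {rmorphism B -> B}) : h =1 id ->
  iter_laurent_map n h =1 id.
Proof. by move=> e; elim: n => //= n ih x; apply: laurentP => i; apply: ih. Qed.

Fixpoint mono n (B : comPzRingType) (e : nat -> int) : iter_laurent n B :=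
  if n is n'.+1 then lsC _ (mono n' B e) * tpow _ (e n') else 1.

Lemma monoS n (B : comPzRingType) e : mono n.+1 B e = lsC _ (mono n B e) * tpow _ (e n).
Proof. by []. Qed.
Lemma mono_map n (B C : comPzRingType) (h : {rmorphism B -> C}) e :
  iter_laurent_map n h (mono n B e) = mono n C e.
Proof.
elim: n => [|n ih]; first by rewrite rmorph1.
by rewrite !monoS -ih -laurent_mapC -(laurent_map_tpow (iter_laurent_map n h)) -rmorphM.
Qed.
Lemma mono_ext n (B : comPzRingType) e e' : (forall j, (j < n)%N -> e j = e' j) ->
  mono n B e = mono n B e'.
Proof.
elim: n => // n ih h; rewrite !monoS h // ih // => j jn; apply: h; exact: ltnW.
Qed.
Lemma monoD n (B : comPzRingType) e e' :
  mono n B (fun j => e j + e' j) = mono n B e * mono n B e'.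
Proof.
elim: n => [|n ih]; first by rewrite [RHS]mulr1.
by rewrite !monoS ih tpowD rmorphM mulrACA.
Qed.
Lemma mono0 n (B : comPzRingType) : mono n B (fun _ => 0) = 1.
Proof. by elim: n => // n ih; rewrite monoS ih tpow0 mulr1 rmorph1. Qed.
Lemma isU_mono n (B : comPzRingType) e : isU (mono n B e).
Proof.
exists (mono n B (fun j => - e j)); rewrite -monoD -[RHS]mono0; apply: mono_ext => j _.
exact: subrr.
Qed.
Lemma constL_lsC n (B : comPzRingType) b : constL n.+1 B b = lsC _ (constL n B b).
Proof. by []. Qed.
Lemma lsC_mono n (B : comPzRingType) e :
  lsC _ (mono n B e) = mono n.+1 B (fun j => if j == n then 0 else e j).
Proof.
rewrite monoS eqxx mulr1; congr (lsC _ _); apply: mono_ext => j jn.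
by case: eqP => //; lia.
Qed.
Lemma idem_constL n (B : comPzRingType) (e : iter_laurent n B) : e * e = e ->
  exists E, E * E = E /\ e = constL n B E.
Proof.
elim: n e => [|n ih] e ee; first by exists e.
have [E [EE ->]] := idem_const ee; have [F [FF ->]] := ih _ EE.
by exists F.
Qed.
End IterLaurent.

(** * Characters of the multiplicative group *)

Definition rid (A : comPzRingType) : {rmorphism A -> A} := idfun.
Definition rcomp (A B C : comPzRingType) (g : {rmorphism B -> C}) (f : {rmorphism A -> B}) :
  {rmorphism A -> C} := g \o f.
Lemma rcompE (A B C : comPzRingType) (g : {rmorphism B -> C}) (f : {rmorphism A -> B}) a :
  rcomp g f a = g (f a). Proof. by []. Qed.
Arguments rcomp : simpl never.

(* Homomorphisms [(L^n G_m)_A -> (G_m)_A] of group functors; only the values at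
   units matter. *)
Record char (n : nat) (A : comPzRingType) := Char {
  chf :> forall (B : comPzRingType) (f : {rmorphism A -> B}), iter_laurent n B -> B ;
  ch1 : forall (B : comPzRingType) (f : {rmorphism A -> B}), chf f 1 = 1 ;
  chM : forall (B : comPzRingType) (f : {rmorphism A -> B}) x y, isU x -> isU y ->
    chf f (x * y) = chf f x * chf f y ;
  chN : forall (B C : comPzRingType) (f : {rmorphism A -> B}) (g : {rmorphism A -> C}) (h : {rmorphism B -> C}),
    (forall a, h (f a) = g a) ->
    forall x, isU x -> chf g (iter_laurent_map n h x) = h (chf f x) }.

(* Over the ring of Laurent polynomials in [x] and [y], compare the coefficients of
   [chi (x y) = chi x * chi y]. *)
Lemma Gm_char (A : comPzRingType) (chi : char 0 A) :
  exists M N (p : nat -> A),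
  [/\ forall i j, (i < M)%N -> (j < M)%N -> p i * p j = if i == j then p i else 0,
      \sum_(j < M) p j = 1
    & forall (B : comPzRingType) (f : {rmorphism A -> B}) (a b : B), a * b = 1 ->
        chi B f a = b ^+ N * \sum_(j < M) f (p j) * a ^+ j].
Proof.
have L := laurpoly A; have L2 := laurpoly L.
set x := lp_x L; set y := lp_x L2; set i2 := rcomp (lp_in L2) (lp_in L).
set u := chi L (lp_in L) x.
have [N [M [p eu]]] := lp_eq u.
pose P : L := \sum_(j < M) lp_in L (p j) * x ^+ j.
have uP : u * x ^+ N = P.
  by rewrite eu mulrAC -exprMn [_ * x]mulrC lp_xK expr1n mul1r.
have ev (B : comPzRingType) (f : {rmorphism A -> B}) (h : {rmorphism L -> B}) a : isU a ->
    (forall c, h (lp_in L c) = f c) -> h x = a -> chi B f a = h u.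
  by move=> ua hf <-; rewrite -(chN chi hf) //; exists (lp_xV L); rewrite lp_xK.
have evP (B : comPzRingType) (f : {rmorphism A -> B}) (h : {rmorphism L -> B}) a :
    (forall c, h (lp_in L c) = f c) -> h x = a -> h P = \sum_(j < M) f (p j) * a ^+ j.
  move=> hf hx; rewrite /P rmorph_sum; apply: eq_bigr => j _.
  by rewrite rmorphM rmorphXn hf hx.
have evB (B : comPzRingType) (f : {rmorphism A -> B}) a b : a * b = 1 ->
    chi B f a = b ^+ N * \sum_(j < M) f (p j) * a ^+ j.
  move=> ab; have [h [hf hx]] := lp_lift L f ab.
  rewrite (ev _ f h a) //; last by exists b.
  rewrite -(evP _ f h a) // -uP rmorphM rmorphXn hx mulrCA -exprMn [b * a]mulrC ab.
  by rewrite expr1n mulr1.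
have ux : isU x by exists (lp_xV L); rewrite lp_xK.
have uy : isU y by exists (lp_xV L2); rewrite lp_xK.
have xyV : lp_in L2 x * y * (lp_in L2 (lp_xV L) * lp_xV L2) = 1.
  by rewrite mulrACA lp_xK mulr1 -rmorphM lp_xK rmorph1.
have [h2 [h2f h2x]] := lp_lift L i2 (lp_xK L2).
have [h3 [h3f h3x]] := lp_lift L i2 xyV.
have E : h3 u = lp_in L2 u * h2 u.
  rewrite -(ev _ i2 h3 (lp_in L2 x * y)) //; last exact: isUl xyV.
  rewrite (chM chi) //; last exact: isU_map.
  rewrite (ev _ i2 h2 y) //; congr (_ * _).
  by apply: ev => //; apply: isU_map.
have E2 : h3 P = lp_in L2 P * h2 P.
  by rewrite -uP !rmorphM E !rmorphXn h2x h3x -/x -/y exprMn; ring.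
have E3 j : (j < M)%N -> lp_in L (p j) * x ^+ j = P * lp_in L (p j).
  move: j; apply: (@lp_inj _ L2 M (fun j => lp_in L (p j) * x ^+ j) (fun j => P * lp_in L (p j))).
  transitivity (h3 P).
    rewrite (evP _ i2 h3 (lp_in L2 x * y)) //; apply: eq_bigr => j _.
    by rewrite rcompE rmorphM rmorphXn exprMn mulrA.
  rewrite E2 (evP _ i2 h2 y) // mulr_sumr; apply: eq_bigr => j _.
  by rewrite rcompE rmorphM mulrA.
exists M, N, p; split=> // [i j iM jM|].
  suff H : (if i == j then p j else 0) = p i * p j by rewrite -H; case: eqP => // ->.
  move: i iM; apply: (@lp_inj _ L M (fun i => if i == j then p j else 0) (fun i => p i * p j)).
  transitivity (lp_in L (p j) * x ^+ j).
    rewrite (bigD1 (Ordinal jM)) //= eqxx big1 ?addr0 // => i ij.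
    case: eqP => e; last by rewrite rmorph0 mul0r.
    by case/eqP: ij; apply: val_inj.
  rewrite E3 // /P mulr_suml; apply: eq_bigr => i _.
  by rewrite rmorphM mulrAC.
have := evB A (rid A) 1 1 (mulr1 1); rewrite ch1 expr1n mul1r => ->.
by apply: eq_bigr => j _; rewrite expr1n mulr1.
Qed.

Section GmCharExponents.
Variables (A : comPzRingType) (chi : char 0 A) (M N : nat) (p : nat -> A).
Hypothesis orth : forall i j, (i < M)%N -> (j < M)%N -> p i * p j = if i == j then p i else 0.
Hypothesis p1 : \sum_(j < M) p j = 1.
Hypothesis ev : forall (B : comPzRingType) (f : {rmorphism A -> B}) (a b : B), a * b = 1 ->
  chi B f a = b ^+ N * \sum_(j < M) f (p j) * a ^+ j.

Lemma Gm_char_exponents (C : comPzRingType) (f : {rmorphism A -> C}) :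
  (forall k, chi _ (rcomp (tr_in (trunc k C)) f) (1 + tr_s (trunc k C)) = 1) ->
  forall j, (j < M)%N -> j != N -> f (p j) = 0.
Proof.
move=> h1 j jM jN.
have red k : let T := trunc k C in
   tr_in T (f (p j)) * (1 + tr_s T) ^+ N = tr_in T (f (p j)) * (1 + tr_s T) ^+ j.
  move=> T; have [b ab] : isU (1 + tr_s T) by apply: isU_1nilp; exists k; apply: tr_sk.
  have := h1 k; rewrite -/T (ev _ ab) // => e.
  have {e} e : (1 + tr_s T) ^+ N = \sum_(i < M) tr_in T (f (p i)) * (1 + tr_s T) ^+ i.
    by apply: (isU_cancel (isUX N (isUr ab))); rewrite e -exprMn mulrC ab expr1n.
  rewrite e mulr_sumr (bigD1 (Ordinal jM)) //= big1 ?addr0 => [|i ij].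
    by rewrite mulrA -!rmorphM orth // eqxx.
  rewrite mulrA -!rmorphM orth //; case: eqP => // [e2|_].
    by case/eqP: ij; apply: val_inj.
  by rewrite !rmorph0 mul0r.
pose d := ((j - N) + (N - j))%N; pose T := trunc d.+1 C; have := red d.+1; rewrite -/T.
have d0 : (0 < d)%N by rewrite /d; case: ltngtP jN => //; lia.
have u n : isU ((1 + tr_s T) ^+ n).
  by apply: isUX; apply: isU_1nilp; exists d.+1; apply: tr_sk.
set q := f (p j) => e.
have {}e : tr_in T q * (1 + tr_s T) ^+ d = tr_in T q.
  case: (ltngtP j N) jN => // jN _.
    have wN : (1 + tr_s T) ^+ N = (1 + tr_s T) ^+ j * (1 + tr_s T) ^+ d.
      by rewrite -exprD; congr (_ ^+ _); rewrite /d; lia.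
    by apply: (isU_cancel (u j)); rewrite mulrCA -wN e mulrC.
  have wj : (1 + tr_s T) ^+ j = (1 + tr_s T) ^+ N * (1 + tr_s T) ^+ d.
    by rewrite -exprD; congr (_ ^+ _); rewrite /d; lia.
  by apply: (isU_cancel (u N)); rewrite mulrCA -wj -e mulrC.
have := congr1 (fun z => @tr_coef _ _ T z d) e.
have -> : tr_in T q * (1 + tr_s T) ^+ d = \sum_(i < d.+1) tr_in T (q *+ 'C(d, i)) * tr_s T ^+ i.
  rewrite exprDn mulr_sumr; apply: eq_bigr => i _.
  by rewrite expr1n mul1r rmorphMn mulrnAl mulrnAr.
have -> : tr_in T q = \sum_(i < d.+1) tr_in T (if (i : nat) == 0 then q else 0) * tr_s T ^+ i.
  rewrite big_ord_recl mulr1 big1 ?addr0 // => i _.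
  by rewrite rmorph0 mul0r.
rewrite (tr_coefE T (fun i => q *+ 'C(d, i))) // (tr_coefE T (fun i => if i == 0 then q else 0)) //.
by rewrite binn mulr1n => ->; case: eqP => // d00; rewrite d00 in d0.
Qed.

Lemma Gm_char_trivial : (forall j, (j < M)%N -> j != N -> p j = 0) ->
  forall (B : comPzRingType) (f : {rmorphism A -> B}) a, isU a -> chi B f a = 1.
Proof.
move=> p0 B f a [b ab]; rewrite (ev _ ab) //.
have -> : \sum_(j < M) f (p j) * a ^+ j = a ^+ N.
  rewrite -[RHS]mul1r -(rmorph1 f) -p1 rmorph_sum mulr_suml; apply: eq_bigr => j _.
  by have [->|jN] := eqVneq (j : nat) N; rewrite // p0 // rmorph0 !mul0r.
by rewrite -exprMn mulrC ab expr1n.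
Qed.
End GmCharExponents.

Lemma char_ext n (A : comPzRingType) (chi : char n A) (B : comPzRingType) (f g : {rmorphism A -> B}) x :
  isU x -> f =1 g -> chi B f x = chi B g x.
Proof.
move=> ux fg; rewrite -[RHS](chN chi (h := rid B) (g := g) (f := g)) //.
by rewrite (chN chi (h := rid B) (f := f)).
Qed.

Lemma Gm_char_unipotent (A : comPzRingType) (chi : char 0 A) :
  (forall k, chi _ (tr_in (trunc k A)) (1 + tr_s (trunc k A)) = 1) ->
  forall (B : comPzRingType) (f : {rmorphism A -> B}) a, isU a -> chi B f a = 1.
Proof.
move=> h1; have [M [N [p [orth p1 ev]]]] := Gm_char chi.
apply: (Gm_char_trivial p1 ev) => j jM jN.
apply: (Gm_char_exponents orth ev (f := rid A)) jM jN => k.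
rewrite (@char_ext _ _ chi _ _ (tr_in (trunc k A))) //.
by apply: isU_1nilp; exists k; apply: tr_sk.
Qed.

Lemma Gm_char_reduced (A A' : comPzRingType) (pi : {rmorphism A -> A'}) (chi : char 0 A) :
  (forall a, pi a = 0 -> nilp a) ->
  (forall (B : comPzRingType) (f : {rmorphism A' -> B}) a, isU a -> chi B (rcomp f pi) a = 1) ->
  forall (B : comPzRingType) (f : {rmorphism A -> B}) a, isU a -> chi B f a = 1.
Proof.
move=> ker h1; have [M [N [p [orth p1 ev]]]] := Gm_char chi.
apply: (Gm_char_trivial p1 ev) => j jM jN; apply: idem_nilp0; first by rewrite orth // eqxx.
apply: ker; apply: (Gm_char_exponents orth ev) jM jN => k.
by apply: h1; apply: isU_1nilp; exists k; apply: tr_sk.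
Qed.

Section RestrictConstants.
Variables (n : nat) (A : comPzRingType) (chi : char n.+1 A).
Let chc (B : comPzRingType) (f : {rmorphism A -> B}) (x : iter_laurent n B) := chi B f (lsC _ x).
Fact chc1 (B : comPzRingType) (f : {rmorphism A -> B}) : chc f 1 = 1.
Proof. by rewrite /chc rmorph1 ch1. Qed.
Fact chcM (B : comPzRingType) (f : {rmorphism A -> B}) x y : isU x -> isU y -> chc f (x * y) = chc f x * chc f y.
Proof. by move=> ux uy; rewrite /chc rmorphM (chM chi) //; apply: isU_map. Qed.
Fact chcN (B C : comPzRingType) (f : {rmorphism A -> B}) (g : {rmorphism A -> C}) (h : {rmorphism B -> C}) :
  (forall a, h (f a) = g a) ->
  forall x, isU x -> chc g (iter_laurent_map n h x) = h (chc f x).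
Proof.
move=> e x ux; rewrite /chc -(laurent_mapC (iter_laurent_map n h)).
by apply: (chN chi e); apply: isU_map.
Qed.
Definition char_const : char n A := Char chc1 chcM chcN.
End RestrictConstants.

Section FiniteSums.
Variables (n : nat) (B : comPzRingType).
Inductive lpoly : iter_laurent n B -> Prop :=
| lpoly0 : lpoly 0
| lpolyS h c e : lpoly h -> lpoly (h + constL n B c * mono n B e).

Lemma lpoly_term c e : lpoly (constL n B c * mono n B e).
Proof. by rewrite -[_ * _]add0r; apply/lpolyS/lpoly0. Qed.
Lemma lpolyD x y : lpoly x -> lpoly y -> lpoly (x + y).
Proof.
move=> hx; elim=> [|h c e _ ih]; first by rewrite addr0.
by rewrite addrA; apply: lpolyS.
Qed.
Lemma lpoly_sum (I : Type) (r : seq I) (P : pred I) F :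
  (forall i, P i -> lpoly (F i)) -> lpoly (\sum_(i <- r | P i) F i).
Proof. by move=> h; elim/big_ind: _ => //; [exact: lpoly0 | exact: lpolyD]. Qed.
Lemma lpolyM x y : lpoly x -> lpoly y -> lpoly (x * y).
Proof.
move=> hx hy; elim: hx => [|h c e _ ih]; first by rewrite mul0r; apply: lpoly0.
rewrite mulrDl; apply: lpolyD => {h ih} //.
elim: hy => [|h c' e' _ ih]; first by rewrite mulr0; apply: lpoly0.
by rewrite mulrDr; apply: lpolyD => //; rewrite mulrACA -rmorphM -monoD; apply: lpoly_term.
Qed.
Lemma lpoly_constL c : lpoly (constL n B c).
Proof. by rewrite -[constL n B c]mulr1 -(mono0 n B); apply: lpoly_term. Qed.
Lemma lpoly_mono e : lpoly (mono n B e).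
Proof. by rewrite -[mono n B e]mul1r -(rmorph1 (constL n B)); apply: lpoly_term. Qed.
Lemma lpoly1 : lpoly 1. Proof. by rewrite -(mono0 n B); apply: lpoly_mono. Qed.
Lemma lpolyN x : lpoly x -> lpoly (- x).
Proof.
rewrite -mulN1r; apply: lpolyM; rewrite -(rmorph1 (constL n B)) -rmorphN; exact: lpoly_constL.
Qed.
Lemma lpolyX x k : lpoly x -> lpoly (x ^+ k).
Proof. by move=> hx; elim: k => [|k ih]; rewrite ?exprS; [apply: lpoly1 | apply: lpolyM]. Qed.

Lemma lpoly_char (A : comPzRingType) (chi : char n A) (f : {rmorphism A -> B}) (c : B) :
  nilp c -> (forall b e, chi B f (1 + constL n B (c * b) * mono n B e) = 1) ->
  forall z, lpoly z -> chi B f (1 + constL n B c * z) = 1.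
Proof.
case=> k ck h.
suff H m j : (0 < j)%N -> (k <= m + j)%N ->
    forall z, lpoly z -> chi B f (1 + constL n B (c ^+ j) * z) = 1.
  by move=> z hz; rewrite -[c in constL _ _ c]expr1; apply: (H k) => //; lia.
elim: m j => [|m ihm] j j0 kj z hz.
  by rewrite (nilpX ck kj) rmorph0 mul0r addr0 ch1.
have nt w : nilp (constL n B (c ^+ j) * w).
  apply: nilpMr; apply: nilp_map; exists k; rewrite -exprM; apply: nilpX ck _.
  by rewrite leq_pmull.
elim: hz => [|{}z d e hz ih]; first by rewrite mulr0 addr0 ch1.
set t := constL n B (c ^+ j) in nt ih *; set w := _ * mono n B e.
have hw : lpoly w by apply: lpoly_term.
have [r hr] := nt (z + w).
pose v := \sum_(i < r) (- (t * (z + w))) ^+ i.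
have hv : (1 + t * (z + w)) * v = 1.
  by rewrite -{1}[t * _]opprK geometric exprNn hr mulr0 subr0.
have lv : lpoly v.
  apply: lpoly_sum => i _; apply/lpolyX/lpolyN/lpolyM; first exact: lpoly_constL.
  exact: lpolyD.
have prod : (1 + t * z) * (1 + t * w) = (1 + t * (z + w)) * (1 + t * (t * z * w * v)).
  have -> : (1 + t * (z + w)) * (1 + t * (t * z * w * v)) =
    1 + t * (z + w) + t * t * z * w * ((1 + t * (z + w)) * v) by ring.
  by rewrite hv; ring.
have e1 : chi B f (1 + t * (t * z * w * v)) = 1.
  pose t' := constL n B (c ^+ j.-1).
  have -> : t * (t * z * w * v) = constL n B (c ^+ j.+1) * (t' * z * w * v).
    have tt : t * t = constL n B (c ^+ j.+1) * t'.
      by rewrite -!rmorphM -!exprD; congr (constL n B (c ^+ _)); lia.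
    by transitivity (t * t * (z * w * v)); [ring | rewrite tt; ring].
  apply: ihm => //; first by rewrite addnS.
  by do 3 apply: lpolyM => //; apply: lpoly_constL.
have e2 : chi B f (1 + t * w) = 1.
  rewrite /t /w mulrA -rmorphM; have -> : c ^+ j * d = c * (c ^+ j.-1 * d).
    by rewrite mulrA -exprS prednK.
  exact: h.
have un x : isU (1 + t * x) by apply/isU_1nilp/nt.
have := congr1 (chi B f) prod.
by rewrite (chM chi) // (chM chi) ?e1 ?e2 ?ih ?mulr1 // -mulrA; apply: un.
Qed.
End FiniteSums.

Lemma lpoly_lsC n (B : comPzRingType) x : lpoly x -> lpoly (lsC (iter_laurent n B) x : iter_laurent n.+1 B).
Proof.
elim=> [|h c e _ ih]; first by rewrite rmorph0; apply: lpoly0.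
by rewrite rmorphD rmorphM lsC_mono -constL_lsC; apply: lpolyS.
Qed.
Lemma tpow_mono n (B : comPzRingType) k :
  tpow (iter_laurent n B) k = mono n.+1 B (fun j => if j == n then k else 0).
Proof.
rewrite monoS eqxx -[LHS]mul1r -(rmorph1 (lsC _)) -(mono0 n B); congr (lsC _ _ * _).
by apply: mono_ext => j jn; case: eqP => //; lia.
Qed.

(** * Rigidity of characters *)

Section CoefficientwiseMap.
Variables (S S' : comPzRingType) (phi : int -> S -> S') (phi0 : forall j, phi j 0 = 0).
Fact lmap_subproof (x : laurent S) :
  exists N : nat, forall i : int, i < - N%:Z -> phi i (x i) = 0.
Proof. by case: x => x [N hN] /=; exists N => i /hN; rewrite /lcoef => ->. Qed.
Definition lmap (x : laurent S) : laurent S' := Laurent (lmap_subproof x).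
Lemma lmapE x i : lmap x i = phi i (x i). Proof. by []. Qed.
Lemma lmap0 : lmap 0 = 0. Proof. by apply: laurentP => i; rewrite lmapE ls0 phi0. Qed.
End CoefficientwiseMap.
Arguments lmap : simpl never.

Lemma laurent_mapE (S S' : comPzRingType) (h : {rmorphism S -> S'}) x i :
  laurent_map h x i = h (x i).
Proof. by []. Qed.

(* [weight] multiplies the coefficient of [t_1^(l_1)...t_n^(l_n)] by
   [y^(|l_1|+...+|l_n|)], so that only finitely many terms survive modulo [y^m]. *)
Section Weighting.
Variables (B C : comPzRingType) (i : {rmorphism B -> C}) (y : C).

Fact weight_subproof n (w : {w : iter_laurent n B -> iter_laurent n C | w 0 = 0}) (j : int) :
  constL n C (y ^+ absz j) * sval w 0 = 0.
Proof. by rewrite (svalP w) mulr0. Qed.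
Fixpoint weight_sig n : {w : iter_laurent n B -> iter_laurent n C | w 0 = 0} :=
  if n is n'.+1 then
    exist (fun w : laurent _ -> laurent _ => w 0 = 0) _
      (@lmap0 _ _ (fun j a => constL n' C (y ^+ absz j) * sval (weight_sig n') a)
        (weight_subproof (weight_sig n')))
  else exist (fun w : B -> C => w 0 = 0) i (rmorph0 i).
Definition weight n := sval (weight_sig n).

Lemma weightS n (x : iter_laurent n.+1 B) (j : int) :
  (weight x : laurent _) j = constL n C (y ^+ absz j) * weight ((x : laurent _) j).
Proof. by []. Qed.

Lemma weight_ev n (h : {rmorphism C -> B}) : (forall b, h (i b) = b) -> h y = 1 ->
  forall x : iter_laurent n B, iter_laurent_map n h (weight x) = x.
Proof.
move=> hi hy; elim: n => [|n ih] x; first exact: hi.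
apply: laurentP => j; rewrite laurent_mapE weightS rmorphM iter_map_constL rmorphXn hy expr1n.
by rewrite rmorph1 mul1r ih.
Qed.

Lemma weight_lpoly n (D : comPzRingType) (g : {rmorphism C -> D}) : nilp (g y) ->
  forall x : iter_laurent n B, lpoly (iter_laurent_map n g (weight x)).
Proof.
case=> m hm; elim: n => [|n ih] x; first by rewrite -[_ (weight x)]/(constL 0 D _); apply: lpoly_constL.
have E j : (iter_laurent_map n.+1 g (weight x) : laurent _) j =
    constL n D (g y ^+ absz j) * iter_laurent_map n g (weight ((x : laurent _) j)).
  by rewrite [LHS]laurent_mapE weightS rmorphM iter_map_constL rmorphXn.
have E0 j : (m <= absz j)%N -> (iter_laurent_map n.+1 g (weight x) : laurent _) j = 0.
  by move=> jm; rewrite E (nilpX hm jm) rmorph0 mul0r.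
rewrite (@ls_finE _ (iter_laurent_map n.+1 g (weight x)) m (m + m)) => [|j hj|j hj].
- apply: lpoly_sum => j _; apply: lpolyM; last by rewrite tpow_mono; apply: lpoly_mono.
  by apply: lpoly_lsC; rewrite E; apply: lpolyM => //; apply: lpoly_constL.
- by apply: E0; lia.
by apply: E0; lia.
Qed.
End Weighting.

Lemma poly_sep (B : comPzRingType) (u v : polyalg B) :
  (forall m (h : {rmorphism polyalg B -> trunc m B}), (forall b, h (pl_in _ b) = tr_in _ b) ->
     h (pl_y _) = tr_s _ -> h u = h v) -> u = v.
Proof.
move=> H; have [N hN] := pl_eq u; have [M hM] := pl_eq v.
pose m := maxn N M.
have {hN} eu := hN m (leq_maxl _ _); have {hM} ev := hM m (leq_maxr _ _).
have [h [hi hy]] := pl_lift (polyalg B) (tr_in (trunc m B)) (tr_s _).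
have hE (p : nat -> B) : h (\sum_(j < m) pl_in _ (p j) * pl_y _ ^+ j) =
    \sum_(j < m) tr_in (trunc m B) (p j) * tr_s _ ^+ j.
  by rewrite rmorph_sum; apply: eq_bigr => j _; rewrite rmorphM rmorphXn hi hy.
have := H m h hi hy; rewrite {1}eu ev !hE => e.
rewrite [LHS]eu; apply: eq_bigr => j _; congr (pl_in _ _ * _).
rewrite -(tr_coefE (trunc m B) (pl_coef u) (ltn_ord j)) e.
by rewrite (tr_coefE (trunc m B) (pl_coef v) (ltn_ord j)).
Qed.

Section Rigidity.
Variables (n : nat) (A : comPzRingType) (chi : char n A).
Hypothesis chi1 : forall (B : comPzRingType) (f : {rmorphism A -> B}) s e, nilp s ->
  chi B f (1 + constL n B s * mono n B e) = 1.

Lemma isU_1constL (B : comPzRingType) (s : B) g : nilp s -> isU (1 + constL n B s * g).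
Proof. by move=> ns; apply/isU_1nilp/nilpMr/nilp_map. Qed.

Lemma char_infinitesimal (B : comPzRingType) (f : {rmorphism A -> B}) s g : nilp s ->
  chi B f (1 + constL n B s * g) = 1.
Proof.
move=> ns; set C := polyalg B; pose fC := rcomp (pl_in C) f.
pose W := weight (pl_in C) (pl_y C) g.
have uW : isU (1 + constL n C (pl_in C s) * W) by apply/isU_1constL/nilp_map.
have v1 : chi C fC (1 + constL n C (pl_in C s) * W) = 1.
  apply: poly_sep => m h hi hy; rewrite rmorph1 -(chN chi (f := fC) (h := h) (g := rcomp h fC)) //.
  rewrite rmorphD rmorph1 rmorphM iter_map_constL hi.
  apply: (lpoly_char (chi := chi) (f := rcomp h fC)).
  - exact: nilp_map.
  - by move=> b e; apply: chi1; apply/nilpMr/nilp_map.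
  by apply: weight_lpoly; rewrite hy; exists m; apply: tr_sk.
have [h [hi hy]] := pl_lift C (rid B) (1 : B).
have := congr1 h v1; rewrite -(chN chi (f := fC) (h := h) (g := f)) // => [|a]; last first.
  by rewrite /fC rcompE hi.
by rewrite rmorphD !rmorph1 rmorphM iter_map_constL hi weight_ev.
Qed.

Lemma char_contractible (B : comPzRingType) (f : {rmorphism A -> B}) g :
  isU (1 + constL n _ (pl_y (polyalg B)) * iter_laurent_map n (pl_in (polyalg B)) g) ->
  chi B f (1 + g) = 1.
Proof.
set C := polyalg B; pose fC := rcomp (pl_in C) f => u.
have v1 : chi C fC (1 + constL n _ (pl_y C) * iter_laurent_map n (pl_in C) g) = 1.
  apply: poly_sep => m h hi hy; rewrite rmorph1 -(chN chi (f := fC) (h := h) (g := rcomp h fC)) //.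
  rewrite rmorphD rmorph1 rmorphM iter_map_constL hy.
  by apply: char_infinitesimal; exists m; apply: tr_sk.
have [h [hi hy]] := pl_lift C (rid B) (1 : B).
have := congr1 h v1; rewrite -(chN chi (f := fC) (h := h) (g := f)) // => [|a]; last first.
  by rewrite /fC rcompE hi.
rewrite rmorphD !rmorph1 rmorphM iter_map_constL hy rmorph1 mul1r.
by rewrite (iter_map_comp (k := rid B)) // iter_map_id.
Qed.
End Rigidity.

Lemma constL_inj n (B : comPzRingType) (a b : B) : constL n B a = constL n B b -> a = b.
Proof.
elim: n => //= n ih /(congr1 (fun f : laurent _ => f 0)).
by rewrite !lsCE eqxx; apply: ih.
Qed.

(* Here [t^(-N) p] is a unit, with inverse a shift of [q]; locally on the spectrum
   some product [p_k q_(m-k)] is invertible, since their sum is 1 and they are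
   orthogonal modulo nilpotents. *)
Lemma unit_normal_form (S : comPzRingType) (p q : pseries S) N m k :
  (forall j, (p * q) j = (j == m)%:R) -> (k <= m)%N -> isU (p k * q (m - k)%N) ->
  exists a g, [/\ isU a, ls_of_ps N p = tpow S (k%:Z - N%:Z) * lsC S a * (1 + g)
    & forall i : int, i <= 0 -> nilp (g i)].
Proof.
move=> pq km u; have [a' aa'] : isU (p k) := isUMl u.
exists (p k), (lsC S a' * (tpow S (N%:Z - k%:Z) * ls_of_ps N p) - 1); split.
- by exists a'.
- rewrite [1 + _]addrC subrK.
  transitivity (lsC S (p k * a') * (tpow S (k%:Z - N%:Z) * tpow S (N%:Z - k%:Z)) * ls_of_ps N p).
    by rewrite aa' -tpowD (_ : _ + _ = 0) ?rmorph1 ?mul1r //; ring.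
  by rewrite rmorphM; ring.
move=> i i0; rewrite lsB ls1E lsCM tpowM.
have [[j ej]|hj] := ls_int_cases N (i - (N%:Z - k%:Z)); last first.
  rewrite ls_of_ps_lt // mulr0; case: eqP => [e|_]; last by rewrite subrr; apply: nilp0.
  by move: hj; rewrite e; lia.
rewrite ej ls_of_ps_nat; case: eqP => [e|ne].
  by rewrite (_ : j = k) 1?mulrC ?aa' ?subrr; [apply: nilp0 | lia].
rewrite subr0; apply: nilpMl.
have [c hc] : isU (q (m - k)%N) by apply: (@isUMl _ _ (p k)); rewrite mulrC.
rewrite -[p j]mulr1 -hc mulrA; apply: nilpMr.
apply: (@pseries_mul_nilp _ p q m); last by lia.
by move=> l lm; rewrite pq; case: eqP => //; lia.
Qed.

Theorem char_rigid n (A : comPzRingType) (chi : char n A) :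
  (forall (B : comPzRingType) (f : {rmorphism A -> B}) s e, nilp s ->
    chi B f (1 + constL n B s * mono n B e) = 1) ->
  (forall (B : comPzRingType) (f : {rmorphism A -> B}) e, chi B f (mono n B e) = 1) ->
  forall (B : comPzRingType) (f : {rmorphism A -> B}) x, isU x -> chi B f x = 1.
Proof.
elim: n A chi => [|n ih] A chi chi1 chiT B f x ux.
  apply: Gm_char_unipotent => // k.
  rewrite -[tr_s _]mulr1; apply: (chi1 _ _ _ (fun _ => 0)).
  by exists k; apply: tr_sk.
have chiC (C : comPzRingType) (g : {rmorphism A -> C}) b : isU b -> chi C g (lsC _ b) = 1.
  apply: (ih A (char_const chi)) => D h => [s e ns|e].
    by rewrite -[LHS]/(chi D h (lsC _ _)) rmorphD rmorph1 rmorphM lsC_mono; apply: chi1.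
  by rewrite -[LHS]/(chi D h (lsC _ (mono n D e))) lsC_mono; apply: chiT.
case: ux => x' xx'.
have [N [p ep]] := ls_of_ps_surj x; have [M [q eq]] := ls_of_ps_surj x'.
pose m := (N + M)%N.
have pq j : (p * q) j = (j == m)%:R.
  by rewrite -(ls_of_ps_nat m) -ls_mulrE -ep -eq xx' ls1E; congr (_%:R); lia.
pose e k := p k * q (m - k)%N.
have se : \sum_(k < m.+1) e k = 1 by have := pq m; rewrite eqxx.
have pqn a b : (a + b < m)%N -> nilp (p a * q b).
  by apply: pseries_mul_nilp => j jm; rewrite pq; case: eqP => //; lia.
have orth k j : (k < m.+1)%N -> (j < m.+1)%N -> k != j -> nilp (e k * e j).
  move=> km jm; rewrite /e; case: ltngtP => // kj _.
    have -> : p k * q (m - k)%N * (p j * q (m - j)%N) = p k * q (m - j)%N * (p j * q (m - k)%N) by ring.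
    by apply: nilpMr; apply: pqn; lia.
  have -> : p k * q (m - k)%N * (p j * q (m - j)%N) = p j * q (m - k)%N * (p k * q (m - j)%N) by ring.
  by apply: nilpMr; apply: pqn; lia.
have lift (k : 'I_m.+1) : exists E : B, E * E = E /\ nilp (constL n B E - e k).
  have [|F [FF nF]] := @idem_lift _ (e k).
    have -> : 1 - e k = \sum_(j < m.+1 | j != k) e j by rewrite -se [X in X - _](bigD1 k) //= [X in X - _]addrC addrK.
    by rewrite mulr_sumr; apply: nilp_sum => j jk; apply: orth; rewrite // eq_sym.
  by have [E [EE eF]] := idem_constL FF; exists E; rewrite -eF.
have {lift} [E hE] := choice lift.
have fix_E k : E k * chi B f x = E k * 1.
  have [EE nE] := hE k; have [C [pi [piE sep]]] := corner EE.
  apply: sep; rewrite rmorph1 -(chN chi (f := f) (g := rcomp pi f)) //; last by exists x'.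
  rewrite ep [iter_laurent_map n.+1 pi _]laurent_map_of_ps; set p' := PSeries _.
  pose q' := PSeries (fun k => iter_laurent_map n pi (q k)).
  have pq' j : (p' * q') j = (j == m)%:R.
    rewrite -(rmorph_nat (iter_laurent_map n pi)) -pq /= rmorph_sum.
    by apply: eq_bigr => i _; rewrite rmorphM.
  have km : (k <= m)%N by rewrite -ltnS.
  have [|a [g [ua -> hg]]] := unit_normal_form N pq' km.
    rewrite /= -rmorphM -/(e k) -[e k](subKr (constL n B (E k))) rmorphB iter_map_constL piE rmorph1.
    by apply: isU_1nilp; apply/nilpN/nilp_map.
  have ug : isU (1 + g) by apply: isU_laurent.
  rewrite !(chM chi) //; last 3 first.
  - exact: isU_tpow.
  - exact: isU_map.
  - by apply: isUM; [apply: isU_tpow | apply: isU_map].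
  rewrite chiC // [tpow _ _]tpow_mono chiT !mul1r.
  apply: char_contractible => //; apply: isU_laurent => i i0.
  by rewrite constL_lsC lsCM; apply: nilpMl; apply: nilp_map; apply: hg.
have sE : isU (constL n B (\sum_(k < m.+1) E k)).
  have -> : constL n B (\sum_(k < m.+1) E k) = 1 + \sum_(k < m.+1) (constL n B (E k) - e k).
    by rewrite sumrB se addrC subrK rmorph_sum.
  by apply: isU_1nilp; apply: nilp_sum => k _; have [] := hE k.
apply: (@constL_inj n); apply: (isU_cancel sE); rewrite -!rmorphM; congr (constL n B _).
by rewrite !mulr_suml; apply: eq_bigr => k _; apply: fix_E.
Qed.

(** * Steinberg symbols *)

(* Multiplicative, natural Steinberg symbols on [L^n], written on sequences of
   ring elements; only the sequences of units of the right length matter. *)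
Record symbol (n : nat) (R : comPzRingType) := Symbol {
  syf :> forall (A : comPzRingType) (f : {rmorphism R -> A}), seq (iter_laurent n A) -> A ;
  syU : forall (A : comPzRingType) (f : {rmorphism R -> A}) s, isU (syf f s) ;
  syM : forall (A : comPzRingType) (f : {rmorphism R -> A}) s x y s', isU x -> isU y ->
    syf f (s ++ x * y :: s') = syf f (s ++ x :: s') * syf f (s ++ y :: s') ;
  sySt : forall (A : comPzRingType) (f : {rmorphism R -> A}) s x y s', isU x -> isU y ->
    x + y = 1 -> syf f (s ++ x :: y :: s') = 1 ;
  syN : forall (A B : comPzRingType) (f : {rmorphism R -> A}) (g : {rmorphism R -> B})
      (h : {rmorphism A -> B}), (forall r, h (f r) = g r) ->
    forall s, {in s, forall x, isU x} -> syf g (map (iter_laurent_map n h) s) = h (syf f s) }.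

Section SymbolRules.
Variables (n : nat) (R : comPzRingType) (F : symbol n R).
Variables (A : comPzRingType) (f : {rmorphism R -> A}).
Local Notation L := (iter_laurent n A).
Implicit Types (s : seq L) (x y z : L).
Local Notation F_ s := (F A f s).

Lemma sym1 s s' : F_ (s ++ 1 :: s') = 1.
Proof.
apply: (isU_cancel (syU F f (s ++ 1 :: s'))).
by rewrite -(syM F) ?mulr1 //; apply: isU1.
Qed.
Lemma symV s s' x y : x * y = 1 -> F_ (s ++ x :: s') * F_ (s ++ y :: s') = 1.
Proof. by move=> xy; rewrite -(syM F) ?xy ?sym1 //; [exact: isUl xy | exact: isUr xy]. Qed.
Lemma symM2 s s' z x y : isU x -> isU y ->
  F_ (s ++ z :: (x * y) :: s') = F_ (s ++ z :: x :: s') * F_ (s ++ z :: y :: s').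
Proof. by move=> ux uy; rewrite -!(cat_rcons z) (syM F). Qed.
End SymbolRules.

Section Alternation.
Variables (m : nat) (R : comPzRingType) (F : symbol m.+1 R).
Variables (A : comPzRingType) (f : {rmorphism R -> A}).
Local Notation L := (iter_laurent m.+1 A).
Implicit Types (s : seq L) (x y z : L).
Local Notation F_ s := (F A f s).

Lemma sym_opp_aux s s' x : isU x -> isU (1 - x) -> F_ (s ++ x :: - x :: s') = 1.
Proof.
move=> ux u1; have [x' xx'] := ux.
have e1 : 1 - x = (- x) * (1 - x') by rewrite mulrBr !mulNr xx' mulr1 opprK addrC.
have u' : isU (1 - x') by apply: (@isUMl _ _ (- x)); rewrite mulrC -e1.
have ux' : isU x' by exact: isUr xx'.
have s1 : F_ (s ++ x :: (1 - x) :: s') = 1 by apply: sySt => //; rewrite addrC subrK.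
have s2 : F_ (s ++ x' :: (1 - x') :: s') = 1 by apply: sySt => //; rewrite addrC subrK.
have s3 : F_ (s ++ x :: (1 - x') :: s') = 1.
  by rewrite -(symV F f s ((1 - x') :: s') xx') s2 mulr1.
move: s1; rewrite e1 -cat_rcons (syM F) ?cat_rcons ?s3 ?mulr1 //.
exact: isUN.
Qed.

(* For [k] large [1 - t^k x] is a unit, so that [sym_opp_aux] applies to [t^k x] and
   to [t^k]; the error term is a homomorphism in [k], and [k] can be doubled. *)
Lemma sym_opp s s' x : isU x -> F_ (s ++ x :: - x :: s') = 1.
Proof.
move=> ux; have [N [p [ex hN]]] := ls_rep (x : laurent _).
pose T k : L := tpow _ k%:Z.
have TD k l : T (k + l)%N = T k * T l by rewrite /T PoszD tpowD.
have uT k : isU (T k) by apply: isU_tpow.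
have u1 k y : (forall i : int, i < - N%:Z -> (y : laurent _) i = 0) -> (N < k)%N -> isU (1 - T k * y).
  move=> hy Nk; apply: isU_laurent => i i0.
  rewrite -[(- _ : laurent _) i]/(- ((T k * y : laurent _) i)) tpowM hy ?oppr0; first exact: nilp0.
  by lia.
have u1T k : (0 < k)%N -> isU (1 - T k).
  move=> k0; apply: isU_laurent => i i0.
  rewrite -[(- _ : laurent _) i]/(- ((T k : laurent _) i)) tpowE.
  by case: eqP => [|_]; [lia | rewrite oppr0; apply: nilp0].
pose b k := F_ (s ++ x :: T k :: s') * F_ (s ++ T k :: x :: s').
have E k : (N < k)%N -> F_ (s ++ x :: - x :: s') * b k = 1.
  move=> Nk; have k0 : (0 < k)%N by lia.
  have ukx : isU (T k * x) by apply: isUM.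
  have := sym_opp_aux s s' ukx (u1 k x hN Nk).
  have e1 : - (T k * x) = - T k * x by rewrite mulNr.
  have e2 : - (T k * x) = T k * - x by rewrite mulrN.
  rewrite (syM F) // {1}e1 e2 !symM2 //; try exact: isUN.
  rewrite (sym_opp_aux s s' (uT k) (u1T k k0)).
  by move=> <-; rewrite /b; ring.
have b2 k : b (k + k)%N = b k * b k.
  by rewrite /b TD symM2 // (syM F) //; ring.
have := E (N.+1 + N.+1)%N; rewrite b2 mulrA E ?mul1r => [b1|]; last by lia.
by have := E N.+1; rewrite b1 ?mulr1; [apply | lia].
Qed.

Lemma sym_swap s s' x y : isU x -> isU y ->
  F_ (s ++ x :: y :: s') * F_ (s ++ y :: x :: s') = 1.
Proof.
move=> ux uy; have := sym_opp s s' (isUM ux uy).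
have e1 : - (x * y) = - x * y by rewrite mulNr.
have e2 : - (x * y) = x * - y by rewrite mulrN.
rewrite (syM F) // {1}e1 e2 !symM2 //; try exact: isUN.
by rewrite !sym_opp // mul1r mulr1.
Qed.

Lemma sym_perm s1 s s' : {in s1 ++ s, forall x, isU x} -> perm_eq s s' ->
  F_ (s1 ++ s) = 1 -> F_ (s1 ++ s') = 1.
Proof.
elim: s s1 s' => [|x s ih] s1 s' us ss'; first by case: s' ss' => // y s' /perm_size.
have xs' : x \in s' by rewrite -(perm_mem ss') mem_head.
move: ss' us; case/splitPr: xs' => p1 p2; rewrite perm_sym perm_catC /= perm_cons perm_catC => ss' us e.
have ux : isU x by apply: us; rewrite mem_cat mem_head orbT.
have up1 : {in p1, forall y, isU y}.
  move=> y yp; apply: us; rewrite mem_cat inE -(perm_mem ss') mem_cat yp.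
  by rewrite !orbT.
have := ih (rcons s1 x) (p1 ++ p2); rewrite !cat_rcons perm_sym => /(_ us ss' e).
elim: p1 s1 up1 {us ss' e} => //= y p1 ihp s1 up1 e.
rewrite -cat_rcons; apply: ihp; first by move=> z zp; apply: up1; rewrite inE zp orbT.
by rewrite cat_rcons -(sym_swap s1 (p1 ++ p2) ux (up1 y (mem_head _ _))) e mul1r.
Qed.
End Alternation.

Section SymbolNatural.
Variables (n : nat) (R : comPzRingType) (F : symbol n R).

Lemma iter_map_units (A B : comPzRingType) (h : {rmorphism A -> B}) (s : seq (iter_laurent n A)) :
  {in s, forall x, isU x} -> {in map (iter_laurent_map n h) s, forall x, isU x}.
Proof. by move=> us _ /mapP[x /us ux ->]; apply: isU_map. Qed.

Lemma iter_map_seq_comp (A B C : comPzRingType) (h : {rmorphism A -> B}) (g : {rmorphism B -> C})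
    (k : {rmorphism A -> C}) (s : seq (iter_laurent n A)) : (forall a, g (h a) = k a) ->
  map (iter_laurent_map n g) (map (iter_laurent_map n h) s) = map (iter_laurent_map n k) s.
Proof. by move=> e; rewrite -map_comp; apply: eq_map => x /=; apply: iter_map_comp. Qed.

Lemma iter_map_seq_id (A : comPzRingType) (s : seq (iter_laurent n A)) :
  map (iter_laurent_map n (rid A)) s = s.
Proof. by apply: map_id_in => x _; apply: iter_map_id. Qed.

Lemma sym_ext (A : comPzRingType) (f g : {rmorphism R -> A}) s : f =1 g ->
  {in s, forall x, isU x} -> F A f s = F A g s.
Proof.
move=> fg us; rewrite -[LHS]/(rid A (F A f s)) -(syN F (f := f) (g := g)) //.
by rewrite iter_map_seq_id.
Qed.

Lemma in_cons_units (A : comPzRingType) (x : iter_laurent n A) s :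
  isU x -> {in s, forall x, isU x} -> {in x :: s, forall x, isU x}.
Proof. by move=> ux us y; rewrite inE => /orP[/eqP-> //|/us]. Qed.
Lemma in_cat_units (A : comPzRingType) (s s' : seq (iter_laurent n A)) :
  {in s, forall x, isU x} -> {in s', forall x, isU x} -> {in s ++ s', forall x, isU x}.
Proof. by move=> us us' y; rewrite mem_cat => /orP[/us|/us']. Qed.

Variables (A : comPzRingType) (f : {rmorphism R -> A}) (rho : seq (iter_laurent n A)).
Hypothesis urho : {in rho, forall x, isU x}.
Let F1 (B : comPzRingType) (g : {rmorphism A -> B}) (x : iter_laurent n B) :=
  F B (rcomp g f) (x :: map (iter_laurent_map n g) rho).
Fact sym_char1 (B : comPzRingType) (g : {rmorphism A -> B}) : F1 g 1 = 1.
Proof. exact: (sym1 F _ [::]). Qed.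
Fact sym_charM (B : comPzRingType) (g : {rmorphism A -> B}) x y : isU x -> isU y ->
  F1 g (x * y) = F1 g x * F1 g y.
Proof. by move=> ux uy; apply: (syM F (rcomp g f) [::] _ ux uy). Qed.
Fact sym_charN (B C : comPzRingType) (g : {rmorphism A -> B}) (g' : {rmorphism A -> C})
    (h : {rmorphism B -> C}) : (forall a, h (g a) = g' a) ->
  forall x, isU x -> F1 g' (iter_laurent_map n h x) = h (F1 g x).
Proof.
move=> e x ux; rewrite /F1 -(syN F (g := rcomp g' f) (h := h)) => [|r|].
- by rewrite map_cons (iter_map_seq_comp _ e).
- by rewrite !rcompE e.
by apply: in_cons_units => //; apply: iter_map_units.
Qed.
Definition sym_char : char n A := Char sym_char1 sym_charM sym_charN.
Lemma sym_charE (B : comPzRingType) (g : {rmorphism A -> B}) x :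
  sym_char B g x = F B (rcomp g f) (x :: map (iter_laurent_map n g) rho).
Proof. by []. Qed.

Let F0 (B : comPzRingType) (g : {rmorphism A -> B}) (x : iter_laurent 0 B) :=
  sym_char B g (constL n B x).
Fact sym_char01 (B : comPzRingType) (g : {rmorphism A -> B}) : F0 g 1 = 1.
Proof. by rewrite /F0 rmorph1 ch1. Qed.
Fact sym_char0M (B : comPzRingType) (g : {rmorphism A -> B}) x y : isU x -> isU y ->
  F0 g (x * y) = F0 g x * F0 g y.
Proof. by move=> ux uy; rewrite /F0 rmorphM (chM sym_char) //; apply: isU_map. Qed.
Fact sym_char0N (B C : comPzRingType) (g : {rmorphism A -> B}) (g' : {rmorphism A -> C})
    (h : {rmorphism B -> C}) : (forall a, h (g a) = g' a) ->
  forall x, isU x -> F0 g' (iter_laurent_map 0 h x) = h (F0 g x).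
Proof.
move=> e x ux; rewrite /F0 -(chN sym_char e); last exact: isU_map.
by rewrite iter_map_constL.
Qed.
Definition sym_char0 : char 0 A := Char sym_char01 sym_char0M sym_char0N.
Lemma sym_char0E (B : comPzRingType) (g : {rmorphism A -> B}) x :
  sym_char0 B g x = F B (rcomp g f) (constL n B x :: map (iter_laurent_map n g) rho).
Proof. by []. Qed.
End SymbolNatural.

(** * The tangent map of a symbol *)

Lemma torsion_free_trunc k (P : comPzRingType) : torsion_free P -> torsion_free (trunc k P).
Proof.
move=> tf m x m0 xm; set T := trunc k P in x xm *.
rewrite (tr_eq x) big1 // => j _; rewrite (tf m (tr_coef x j) m0) ?rmorph0 ?mul0r //.
rewrite -(tr_coefE T (fun j => tr_coef x j *+ m) (ltn_ord j)).
have -> : \sum_(i < k) tr_in T (tr_coef x i *+ m) * tr_s T ^+ i = 0.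
  rewrite -[RHS]xm [in RHS](tr_eq x) -sumrMnl; apply: eq_bigr => i _.
  by rewrite rmorphMn mulrnAl.
rewrite -[RHS](tr_coefE T (fun=> 0) (ltn_ord j)); congr (tr_coef _ _).
by rewrite big1 // => i _; rewrite rmorph0 mul0r.
Qed.

Lemma dual_mul (A : comPzRingType) (a b e : A) : e * e = 0 ->
  (1 + a * e) * (1 + b * e) = 1 + (a + b) * e.
Proof.
move=> ee; have -> : (1 + a * e) * (1 + b * e) = 1 + (a + b) * e + a * b * (e * e) by ring.
by rewrite ee mulr0 addr0.
Qed.

Section DualNumbers.
Variable P : comPzRingType.
Local Notation E := (trunc 2 P).
Lemma dual_sq : tr_s E * tr_s E = 0. Proof. exact: tr_sk E. Qed.
Lemma dualE (x : E) : x = tr_in E (tr_coef x 0) + tr_in E (tr_coef x 1) * tr_s E.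
Proof. by rewrite {1}(tr_eq x) big_ord_recl big_ord1 mulr1 expr1. Qed.
Lemma dual_coef (a b : P) : tr_coef (tr_in E a + tr_in E b * tr_s E) 1 = b.
Proof.
rewrite -[RHS](tr_coefE E (fun j => if j is 0 then a else b) (ltnSn 1)); congr (tr_coef _ _).
by rewrite big_ord_recl big_ord1 mulr1 expr1.
Qed.
Lemma dual_inj (a b : P) : 1 + tr_in E a * tr_s E = 1 + tr_in E b * tr_s E -> a = b.
Proof.
by move/(congr1 (fun z => @tr_coef _ _ E z 1)); rewrite -(rmorph1 (tr_in E)) !dual_coef.
Qed.
Lemma dual_lift (C : comPzRingType) (h : {rmorphism P -> C}) (e : C) : e * e = 0 ->
  exists k : {rmorphism E -> C}, (forall b, k (tr_in E b) = h b) /\ k (tr_s E) = e.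
Proof. by move=> ee; apply: tr_lift. Qed.
End DualNumbers.

Section Tangent.
Variables (m : nat) (R : comPzRingType) (F : symbol m.+1 R).
Local Notation n := m.+1.
Local Notation L := (iter_laurent n).
Local Notation Lmap := (iter_laurent_map n).
Local Notation units s := {in s, forall x, isU x}.

Lemma isU_infinitesimal (C : comPzRingType) (e : C) (x : L C) : e * e = 0 -> isU (1 + constL n C e * x).
Proof. by move=> ee; apply/isU_1nilp/nilpMr/nilp_map; exists 2%N. Qed.
Hint Resolve isU_infinitesimal : core.

(* [F (1 + eps g, s) = 1 + tangent g s * eps]. *)
Definition tangent (P : comPzRingType) (f : {rmorphism R -> P}) (g : L P) (s : seq (L P)) : P :=
  let E := trunc 2 P in
  tr_coef (F E (rcomp (tr_in E) f)
    (1 + constL n E (tr_s E) * Lmap (tr_in E) g :: map (Lmap (tr_in E)) s)) 1.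

Section TangentRules.
Variables (P : comPzRingType) (f : {rmorphism R -> P}).
Local Notation E := (trunc 2 P).
Local Notation i := (tr_in E).
Local Notation eps := (tr_s E).
Local Notation Ff := (F E (rcomp i f)).
Local Notation D g s := (tangent f g s).
Implicit Types (g x y : L P) (s : seq (L P)).

Lemma tan_dual g s : units s ->
  Ff (1 + constL n E eps * Lmap i g :: map (Lmap i) s) = 1 + i (D g s) * eps.
Proof.
move=> us; rewrite /tangent; set x := Ff _; rewrite [LHS]dualE; congr (_ + _).
have [pi [pii pie]] : exists k : {rmorphism E -> P}, (forall b, k (i b) = rid P b) /\ k eps = 0.
  by apply: dual_lift; rewrite mulr0.
have ux : units (1 + constL n E eps * Lmap i g :: map (Lmap i) s).
  by apply: in_cons_units; [apply/isU_infinitesimal/dual_sq | apply: iter_map_units].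
have : pi x = 1.
  rewrite /x -(syN F (g := f)) // => [|r]; last by rewrite rcompE pii.
  rewrite map_cons rmorphD rmorph1 rmorphM iter_map_constL pie rmorph0 mul0r addr0.
  exact: (sym1 F _ [::]).
by rewrite {1}[x]dualE rmorphD rmorphM !pii pie mulr0 addr0 => e; rewrite -[tr_coef x 0]/(rid P _) e rmorph1.
Qed.

Lemma tan_gen (C : comPzRingType) (h : {rmorphism P -> C}) (k : {rmorphism R -> C}) (e : C) g s :
  units s -> e * e = 0 -> (forall r, h (f r) = k r) ->
  F C k (1 + constL n C e * Lmap h g :: map (Lmap h) s) = 1 + h (D g s) * e.
Proof.
move=> us ee hk; have [pi [pii pie]] := dual_lift h ee.
have ux : units (1 + constL n E eps * Lmap i g :: map (Lmap i) s).
  by apply: in_cons_units; [apply/isU_infinitesimal/dual_sq | apply: iter_map_units].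
have := congr1 pi (tan_dual g us); rewrite rmorphD rmorph1 rmorphM pii pie => <-.
rewrite -(syN F (g := k)) // => [|r]; last by rewrite rcompE pii.
rewrite map_cons rmorphD rmorph1 rmorphM iter_map_constL pie (iter_map_comp pii).
by rewrite (iter_map_seq_comp _ pii).
Qed.

Lemma tan_eq g s d : units s ->
  Ff (1 + constL n E eps * Lmap i g :: map (Lmap i) s) = 1 + i d * eps -> D g s = d.
Proof. by move=> us; rewrite tan_dual // => /dual_inj. Qed.

Lemma tan_eq0 g s : units s ->
  Ff (1 + constL n E eps * Lmap i g :: map (Lmap i) s) = 1 -> D g s = 0.
Proof. by move=> us e; apply: tan_eq; rewrite // rmorph0 mul0r addr0. Qed.

Lemma constL_sq (C : comPzRingType) (e : C) : e * e = 0 -> constL n C e * constL n C e = 0.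
Proof. by move=> ee; rewrite -rmorphM ee rmorph0. Qed.

Lemma tanD g g' s : units s -> D (g + g') s = D g s + D g' s.
Proof.
move=> us; apply: tan_eq => //.
have -> : 1 + constL n E eps * Lmap i (g + g') =
    (1 + constL n E eps * Lmap i g) * (1 + constL n E eps * Lmap i g').
  rewrite ![constL n E eps * _]mulrC dual_mul ?rmorphD //; apply/constL_sq/dual_sq.
rewrite (syM F _ [::]) /=; try exact/isU_infinitesimal/dual_sq.
by rewrite !tan_dual // dual_mul ?rmorphD //; apply: dual_sq.
Qed.

Lemma tanZ a g s : units s -> D (constL n P a * g) s = a * D g s.
Proof.
move=> us; apply: tan_eq => //.
have -> : constL n E eps * Lmap i (constL n P a * g) = constL n E (i a * eps) * Lmap i g.
  by rewrite !rmorphM iter_map_constL; ring.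
rewrite (tan_gen (h := i)) //; first by rewrite rmorphM; congr (1 + _); ring.
by rewrite mulrACA dual_sq mulr0.
Qed.

Lemma tanN g s : units s -> D (- g) s = - D g s.
Proof. by move=> us; rewrite -mulN1r -(rmorph1 (constL n P)) -rmorphN tanZ // mulN1r. Qed.

Lemma tanM g s x y s' : units s -> units s' -> isU x -> isU y ->
  D g (s ++ x * y :: s') = D g (s ++ x :: s') + D g (s ++ y :: s').
Proof.
move=> us us' ux uy.
have U z : isU z -> units (s ++ z :: s').
  by move=> uz; apply: in_cat_units => //; apply: in_cons_units.
apply: tan_eq; first by apply: U; apply: isUM.
rewrite map_cat map_cons rmorphM -cat_cons (syM F); try exact: isU_map.
by rewrite !cat_cons -!map_cons -!map_cat !tan_dual ?dual_mul ?rmorphD //;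
  [apply: dual_sq | apply: U | apply: U].
Qed.

Lemma tan_1 g s s' : units s -> units s' -> D g (s ++ 1 :: s') = 0.
Proof.
move=> us us'; apply: (addrI (D g (s ++ 1 :: s'))).
by rewrite -tanM ?mulr1 ?addr0 //; exact: isU1.
Qed.
Lemma tanV g s x y s' : units s -> units s' -> x * y = 1 ->
  D g (s ++ y :: s') = - D g (s ++ x :: s').
Proof.
move=> us us' xy; apply/eqP; rewrite -addr_eq0 addrC -tanM ?xy ?tan_1 //.
  exact: isUl xy.
exact: isUr xy.
Qed.

Lemma tan_perm g s s' : units s -> perm_eq s s' -> D g s = 0 -> D g s' = 0.
Proof.
move=> us ss' d0; have us' : units s' by move=> x; rewrite -(perm_mem ss'); apply: us.
apply: tan_eq0 => //; have := tan_dual g us; rewrite d0 rmorph0 mul0r addr0.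
apply: (sym_perm (s1 := [:: _])); last by apply: perm_map.
by apply: in_cons_units; [apply/isU_infinitesimal/dual_sq | apply: iter_map_units].
Qed.

Lemma tan_opp g s x s' : units s -> units s' -> isU x -> D g (s ++ x :: - x :: s') = 0.
Proof.
move=> us us' ux; apply: tan_eq0.
  by apply: in_cat_units => //; do 2 apply: in_cons_units => //; apply: isUN.
by rewrite map_cat !map_cons rmorphN -cat_cons sym_opp //; apply: isU_map.
Qed.

(* Modulo [eps] the character [a |-> F (a, 1 + eps g, s)] is trivial, hence so are
   its idempotents, being determined modulo nilpotents. *)
Lemma tan_const g s a : units s -> isU a -> D g (constL n P a :: s) = 0.
Proof.
move=> us ua; have uia := isU_map (constL n P) ua.
apply: tan_eq0; first exact: in_cons_units.
set x := 1 + _; have ux : isU x by apply/isU_infinitesimal/dual_sq.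
have urho : units (x :: map (Lmap i) s) by apply: in_cons_units => //; apply: iter_map_units.
have [pi [pii pie]] : exists k : {rmorphism E -> P}, (forall b, k (i b) = rid P b) /\ k eps = 0.
  by apply: dual_lift; rewrite mulr0.
have H : sym_char0 F (rcomp i f) urho E (rid E) (i a) = 1.
  apply: (Gm_char_reduced (pi := pi)); last exact: isU_map.
    move=> b; rewrite [b]dualE rmorphD rmorphM !pii pie mulr0 addr0 => e.
    rewrite -[tr_coef b 0]/(rid P _) e rmorph0 add0r; apply: nilpMl; exists 2%N; apply: tr_sk.
  move=> B k b ub; rewrite sym_char0E map_cons rmorphD rmorph1 rmorphM iter_map_constL.
  by rewrite rcompE pie !rmorph0 mul0r addr0 (sym1 F _ [:: _]).
have H2 : Ff (constL n E (i a) :: x :: map (Lmap i) s) = 1.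
  rewrite -[RHS]H sym_char0E iter_map_seq_id; apply: sym_ext => //.
  by apply: in_cons_units => //; do 2 apply: isU_map.
rewrite map_cons iter_map_constL.
have := sym_swap F (rcomp i f) [::] (map (Lmap i) s) (isU_map (constL n E) (isU_map i ua)) ux.
by rewrite /= H2 mul1r.
Qed.
End TangentRules.

Lemma tan_nat (P Q : comPzRingType) (f : {rmorphism R -> P}) (f' : {rmorphism R -> Q})
    (h : {rmorphism P -> Q}) g s : (forall r, h (f r) = f' r) -> units s ->
  tangent f' (Lmap h g) (map (Lmap h) s) = h (tangent f g s).
Proof.
move=> e us; apply: tan_eq; first exact: iter_map_units.
set E := trunc 2 Q; rewrite (iter_map_comp (k := rcomp (tr_in E) h)) //.
rewrite (iter_map_seq_comp (k := rcomp (tr_in E) h)) //.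
by rewrite (tan_gen (f := f) (h := rcomp (tr_in E) h)) // => [|r]; [apply: dual_sq | rewrite !rcompE e].
Qed.
End Tangent.

(** * The mixed second derivative of a symbol *)

Definition delta (j k : nat) : int := (k == j)%:R.

Lemma exponent_ind n (Q : (nat -> int) -> Prop) :
  (forall e e', (forall j, (j < n)%N -> e j = e' j) -> Q e -> Q e') -> Q (fun=> 0) ->
  (forall e j, (j < n)%N -> Q e -> Q (fun k => e k + delta j k)) ->
  (forall e j, (j < n)%N -> Q e -> Q (fun k => e k - delta j k)) ->
  forall e, Q e.
Proof.
move=> Qext Q0 Qp Qm e.
have Qk e' j (k : nat) : (j < n)%N -> Q e' ->
    Q (fun l => e' l + delta j l *+ k) /\ Q (fun l => e' l - delta j l *+ k).
  move=> jn qe; elim: k => [|k [ih1 ih2]].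
    by split; apply: Qext qe => l _; rewrite mulr0n ?subr0 ?addr0.
  split; first by apply: Qext (Qp _ j jn ih1) => l _; rewrite mulrSr addrA.
  by apply: Qext (Qm _ j jn ih2) => l _; rewrite mulrSr opprD addrA.
suff H m : (m <= n)%N -> Q (fun k => if (k < m)%N then e k else 0).
  by apply: Qext (H n (leqnn n)) => j ->.
elim: m => [|m ih] mn; first exact: Qext Q0.
have {ih} ih := ih (ltnW mn).
case em : (e m) => [k|k].
  have [h _] := Qk _ m k mn ih; apply: Qext h => j _; rewrite /delta [in RHS]ltnS [in RHS]leq_eqVlt.
  case: eqP => [->|_] /=; first by rewrite ltnn add0r em mulr1n natz.
  by rewrite mul0rn addr0.
have [_ h] := Qk _ m k.+1 mn ih; apply: Qext h => j _; rewrite /delta [in RHS]ltnS [in RHS]leq_eqVlt.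
case: eqP => [->|_] /=; first by rewrite ltnn sub0r em mulr1n natz NegzE.
by rewrite mul0rn subr0.
Qed.

Lemma sum_delta (V : zmodType) n (X : nat -> V) j : (j < n)%N -> \sum_(k < n) X k *~ delta j k = X j.
Proof.
move=> jn; rewrite (bigD1 (Ordinal jn)) //= /delta eqxx big1 ?addr0 // => k kj.
case: eqP => [e|_]; last exact: mulr0z.
by case/eqP: kj; apply: val_inj.
Qed.

Lemma mono_delta n (B : comPzRingType) e j :
  mono n B (fun k => e k + delta j k) = mono n B e * mono n B (delta j).
Proof. exact: monoD. Qed.
Lemma mono_deltaN n (B : comPzRingType) e j :
  mono n B (fun k => e k - delta j k) = mono n B e * mono n B (fun k => - delta j k).
Proof. exact: monoD. Qed.
Lemma monoV n (B : comPzRingType) e : mono n B e * mono n B (fun k => - e k) = 1.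
Proof. by rewrite -monoD -[RHS]mono0; apply: mono_ext => j _; rewrite subrr. Qed.

Lemma isU_1T n (B : comPzRingType) j : (j < n)%N -> isU (1 + mono n B (delta j)).
Proof.
elim: n => // n ih; rewrite ltnS leq_eqVlt monoS => /orP[/eqP-> | jn].
  rewrite (@mono_ext n B _ (fun=> 0)) => [|k kn]; last first.
    by rewrite /delta; case: eqP => //; lia.
  rewrite mono0 rmorph1 mul1r; apply: isU_laurent => i i0.
  by rewrite /delta eqxx tpowE; case: eqP => [|_]; [lia | apply: nilp0].
have -> : delta j n = 0 by rewrite /delta; case: eqP => //; lia.
by rewrite tpow0 mulr1 -(rmorph1 (lsC _)) -rmorphD; apply/isU_map/ih.
Qed.

Section Cross.
Variables (m : nat) (R : comPzRingType) (F : symbol m.+1 R).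
Local Notation n := m.+1.
Local Notation L := (iter_laurent n).
Local Notation Lmap := (iter_laurent_map n).
Local Notation units s := {in s, forall x, isU x}.

(* [F (1 + eps0 a, 1 + eps1 b, rho) = 1 + cross a b * eps0 * eps1]. *)
Definition cross (P : comPzRingType) (f : {rmorphism R -> P}) (a b : L P) (rho : seq (L P)) : P :=
  let E := trunc 2 P in
  tr_coef (tangent F (rcomp (tr_in E) f) (Lmap (tr_in E) a)
    (1 + constL n E (tr_s E) * Lmap (tr_in E) b :: map (Lmap (tr_in E)) rho)) 1.

Variables (P : comPzRingType) (f : {rmorphism R -> P}) (rho : seq (L P)).
Hypothesis urho : units rho.
Local Notation E := (trunc 2 P).
Local Notation i := (tr_in E).
Local Notation eps := (tr_s E).
Local Notation D g x := (tangent F f g (x :: rho)).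
Local Notation DE g x := (tangent F (rcomp i f) g (x :: map (Lmap i) rho)).
Local Notation c a b := (cross f a b rho).
Implicit Types (g a b x u v : L P).

Lemma units_inf (C : comPzRingType) (e : C) (x : L C) (s : seq (L C)) : e * e = 0 -> units s ->
  units (1 + constL n C e * x :: s).
Proof. by move=> ee us; apply: in_cons_units => //; apply: isU_infinitesimal. Qed.
Lemma units_dual (x : L E) : units (1 + constL n E eps * x :: map (Lmap i) rho).
Proof. by apply: units_inf; [apply: dual_sq | apply: iter_map_units]. Qed.

Lemma cross_dual a b : DE (Lmap i a) (1 + constL n E eps * Lmap i b) = i (c a b) * eps.
Proof.
set x := DE _ _; rewrite [LHS]dualE -/(c a b).
have [pi [pii pie]] : exists k : {rmorphism E -> P}, (forall z : P, k (i z) = rid P z) /\ k eps = 0.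
  by apply: dual_lift; rewrite mulr0.
have : pi x = 0.
  rewrite /x -(tan_nat F (f' := f)) => [|r|]; last exact: units_dual.
    rewrite map_cons rmorphD rmorph1 rmorphM !iter_map_constL pie rmorph0 mul0r addr0.
    apply: (tan_1 _ _ _ (s := [::])) => //; apply: iter_map_units; exact: iter_map_units.
  by rewrite rcompE pii.
rewrite {1}[x]dualE rmorphD rmorphM !pii pie mulr0 addr0 => e.
by rewrite -[tr_coef x 0]/(rid P _) e rmorph0 add0r.
Qed.

Lemma cross_gen (C : comPzRingType) (h : {rmorphism P -> C}) (k : {rmorphism R -> C}) (e0 e1 : C) a b :
  e0 * e0 = 0 -> e1 * e1 = 0 -> (forall r, h (f r) = k r) ->
  F C k [:: 1 + constL n C e0 * Lmap h a, 1 + constL n C e1 * Lmap h b & map (Lmap h) rho] =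
  1 + h (c a b) * (e0 * e1).
Proof.
move=> h0 h1 hk; have [pi [pii pie]] := dual_lift h h1.
have := tan_gen F (f := rcomp i f) (h := pi) (k := k) (Lmap i a) (@units_dual (Lmap i b)) h0.
rewrite cross_dual rmorphM pii pie map_cons rmorphD rmorph1 rmorphM iter_map_constL pie.
rewrite !(iter_map_comp pii) (iter_map_seq_comp _ pii) -mulrA [e1 * e0]mulrC.
by apply=> r; rewrite rcompE pii.
Qed.

Lemma cross_anti a b : c a b = - c b a.
Proof.
set E2 := trunc 2 E; pose h := rcomp (tr_in E2) i.
have e0 := dual_sq E; have e1 : tr_in E2 eps * tr_in E2 eps = 0 by rewrite -rmorphM dual_sq rmorph0.
have H x y s t := @cross_gen E2 h (rcomp h f) s t x y.
have [u1 u2] : isU (1 + constL n E2 (tr_s E2) * Lmap h a) /\ isU (1 + constL n E2 (tr_in E2 eps) * Lmap h b).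
  by split; apply: isU_infinitesimal.
have := sym_swap F (rcomp h f) [::] (map (Lmap h) rho) u1 u2.
rewrite /= !H // [tr_in E2 eps * _]mulrC dual_mul; last by rewrite mulrACA e0 mul0r.
rewrite -rmorphD /h rcompE mulrCA -rmorphM [tr_s E2 * _]mulrC => e.
have : 1 + tr_in E2 (i (c a b + c b a) * eps) * tr_s E2 = 1 + tr_in E2 0 * tr_s E2.
  by rewrite rmorph0 mul0r addr0 -[RHS]e.
move/dual_inj => {}e.
have /dual_inj : 1 + i (c a b + c b a) * eps = 1 + i 0 * eps by rewrite e rmorph0 mul0r.
by move/eqP; rewrite addr_eq0 => /eqP.
Qed.

Lemma cross_1 a : c a 1 = 0.
Proof.
apply: (@dual_inj P); rewrite -cross_dual rmorph0 mul0r rmorph1 mulr1 -(rmorph1 (constL n E)) -rmorphD.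
rewrite tan_const ?rmorph1 //; first exact: iter_map_units.
by apply: isU_1nilp; exists 2%N; apply: tr_sk.
Qed.

Lemma tan_steinberg g x : isU x -> isU (1 - x) -> D (x * g) x + D ((1 - x) * g) (1 - x) = 0.
Proof.
move=> ux u1x; have e2 := dual_sq P.
have ur := iter_map_units (h := i) urho.
pose X := Lmap i x; pose Y := Lmap i (1 - x).
have uX : isU X by apply: isU_map. have uY : isU Y by apply: isU_map.
pose X' := 1 + constL n E eps * Lmap i ((1 - x) * g).
pose Y' := 1 + constL n E eps * Lmap i (- (x * g)).
have [uX' uY'] : isU X' /\ isU Y' by split; apply: isU_infinitesimal.
have XY : X + Y = 1 by rewrite -rmorphD addrC subrK rmorph1.
have XY' : X * X' + Y * Y' = 1.
  rewrite -XY /X' /Y' rmorphN !rmorphM -/X -/Y; ring.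
have := sySt F (rcomp i f) [::] (map (Lmap i) rho) (isUM uX uX') (isUM uY uY') XY'.
have s1 : F E (rcomp i f) [:: X, Y & map (Lmap i) rho] = 1 by apply: (sySt F _ [::]).
have s2 : F E (rcomp i f) [:: X', Y' & map (Lmap i) rho] = 1.
  by rewrite (cross_gen (h := i)) // e2 mulr0 addr0.
have sw := sym_swap F (rcomp i f) [::] (map (Lmap i) rho) uX uY'.
rewrite (syM F _ [::]) // !(symM2 F _ [::]) // /= s1 s2 mul1r mulr1.
have -> : F E (rcomp i f) [:: X', Y & map (Lmap i) rho] = 1 + i (D ((1 - x) * g) (1 - x)) * eps.
  by rewrite -tan_dual //; apply: in_cons_units.
have e : F E (rcomp i f) [:: Y', X & map (Lmap i) rho] = 1 + i (- D (x * g) x) * eps.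
  by rewrite -tanN -?tan_dual //; apply: in_cons_units.
rewrite /= e in sw => g1.
have /dual_inj -> := isU_cancel (syU F (rcomp i f) _) (etrans g1 (esym sw)).
exact: subrr.
Qed.

Lemma tan_add g u v : isU u -> isU v -> isU (u + v) ->
  D (u * g) u + D (v * g) v = D ((u + v) * g) (u + v).
Proof.
move=> uu uv uuv; have [w hw] := uuv.
have uw : isU w by exact: isUr hw.
have e1 : 1 - u * w = v * w by rewrite -hw; ring.
have U x : isU x -> units (x :: rho) by move=> ux; apply: in_cons_units.
have := @tan_steinberg ((u + v) * g) (u * w) (isUM uu uw).
have e2 : u * w * ((u + v) * g) = u * g by rewrite -[RHS]mul1r -hw; ring.
have e3 : v * w * ((u + v) * g) = v * g by rewrite -[RHS]mul1r -hw; ring.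
rewrite e1 e2 e3 => /(_ (isUM uv uw)).
rewrite !(tanM F _ _ (s := [::])) // addrACA -[D (u * g) w + _]tanD; last exact: U.
rewrite -mulrDl /= (tanV F f _ (s := [::]) _ _ hw) // => /eqP.
by rewrite subr_eq0 => /eqP.
Qed.
End Cross.

Section CrossMul.
Variables (m : nat) (R : comPzRingType) (F : symbol m.+1 R).
Local Notation n := m.+1.
Local Notation L := (iter_laurent n).
Local Notation Lmap := (iter_laurent_map n).
Local Notation units s := {in s, forall x, isU x}.
Variables (P : comPzRingType) (f : {rmorphism R -> P}) (rho : seq (L P)).
Hypothesis urho : units rho.
Local Notation E := (trunc 2 P).
Local Notation i := (tr_in E).
Local Notation eps := (tr_s E).
Local Notation D g x := (tangent F f g (x :: rho)).
Local Notation DE g x := (tangent F (rcomp i f) g (x :: map (Lmap i) rho)).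
Local Notation c a b := (cross F f a b rho).

(* Both sides come from [tan_add], applied in two ways to the sum of [u], [1] and
   [eps u b]. *)
Lemma cross_mul (g u b : L P) : isU u -> isU (1 + u) ->
  c g (u * b) = D (u * b * g) u + c (u * g) b.
Proof.
move=> uu u1u; have e2 := dual_sq P.
have ur := iter_map_units (h := i) urho.
have U x : isU x -> units (x :: map (Lmap i) rho) by move=> ux; apply: in_cons_units.
pose U' := Lmap i u; pose B := Lmap i b; pose G := Lmap i g; pose e := constL n E eps.
have ee : e * e = 0 by apply: constL_sq.
have uU : isU U' by apply: isU_map.
have ue (x : L E) : isU (1 + e * x) by apply: isU_infinitesimal.
have u1U : isU (1 + U') by rewrite -(rmorph1 (Lmap i)) -rmorphD; apply: isU_map.
have nt (x : L E) : nilp (e * x) by apply/nilpMr/nilp_map; exists 2%N; apply: tr_sk.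
have a1 := @tan_add m R F E (rcomp i f) _ ur G U' (1 + e * (U' * B)) uU (ue _).
have a2 := @tan_add m R F E (rcomp i f) _ ur G (U' * (1 + e * B)) 1 (isUM uU (ue _)) (isU1 _).
have E12 : U' * (1 + e * B) + 1 = U' + (1 + e * (U' * B)) by ring.
have utot : isU (U' + (1 + e * (U' * B))).
  have -> : U' + (1 + e * (U' * B)) = (1 + U') + e * (U' * B) by ring.
  exact: isU_nilpD.
move/(_ utot): a1 => a1; rewrite -E12 in utot; move/(_ utot): a2 => a2.
rewrite E12 in a2.
have t1 x : DE x 1 = 0 by apply: (tan_1 _ _ _ (s := [::])).
rewrite t1 addr0 -a1 in a2.
have De (x y z : L E) : isU z -> DE (x + e * y) z = DE x z + eps * DE y z.
  by move=> uz; rewrite tanD ?tanZ //; apply: U.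
move: a2; rewrite (tanM F _ _ (s := [::])) //=.
have -> : U' * (1 + e * B) * G = U' * G + e * (U' * B * G) by ring.
have -> : (1 + e * (U' * B)) * G = G + e * (U' * B * G) by ring.
have ue1 : DE (U' * B * G) (1 + e * B) = i (c (u * b * g) b) * eps.
  by rewrite /U' /B /G -!rmorphM cross_dual.
have ue2 : DE (U' * B * G) (1 + e * (U' * B)) = i (c (u * b * g) (u * b)) * eps.
  by rewrite /U' /B /G -!rmorphM cross_dual.
rewrite !De // ue1 ue2 ![eps * (_ * eps)]mulrCA e2 !mulr0 !addr0.
rewrite [X in _ = _ + X](_ : _ = i (c g (u * b)) * eps); last by rewrite /G /U' /B -rmorphM cross_dual.
have -> : DE (U' * G) (1 + e * B) = i (c (u * g) b) * eps by rewrite /U' /G -rmorphM cross_dual.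
have -> : DE (U' * B * G) U' = i (D (u * b * g) u).
  by rewrite /U' /B /G -!rmorphM -(tan_nat F (f := f) (f' := rcomp i f) (h := i)) //; apply: in_cons_units.
rewrite -addrA => /addrI h; symmetry; apply: (@dual_inj P); rewrite -h rmorphD; ring.
Qed.

Lemma cross_mono (g : L P) e : c g (mono n P e) = D (mono n P e * g) (mono n P e).
Proof.
move: e g; apply: (@exponent_ind n) => [e e' ee' h g|g|e j jn h g|e j jn h g].
- by rewrite -(mono_ext P ee').
- by rewrite mono0 mul1r cross_1 // (tan_1 _ _ _ (s := [::])).
- rewrite mono_delta mulrC cross_mul ?h; [|exact: isU_mono|exact: isU_1T].
  have -> : mono n P e * (mono n P (delta j) * g) = mono n P (delta j) * mono n P e * g by ring.
  by symmetry; apply: (tanM F _ _ (s := [::])) => //; apply: isU_mono.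
set b := mono n P (fun k => e k - delta j k); set u := mono n P (delta j).
have eb : mono n P e = u * b by rewrite -monoD; apply: mono_ext => k _; lia.
have [u' uu'] : isU u := isU_mono _ _ _.
have := cross_mul (u' * g) b (isU_mono _ _ _) (isU_1T _ jn); rewrite -/u -eb h [u * (u' * g)]mulrA uu' mul1r eb.
rewrite (tanM F _ _ (s := [::])) //; try exact: isU_mono.
have -> : u * b * (u' * g) = b * g by rewrite -[RHS]mul1r -uu'; ring.
by move/addrI.
Qed.

Lemma tan_mono_self e : D (mono n P e) (mono n P e) = 0.
Proof.
by have := cross_mono 1 e; rewrite mulr1 => <-; rewrite cross_anti // cross_1 // oppr0.
Qed.

Lemma tan_mono g e : D g (mono n P e) = \sum_(j < n) D g (mono n P (delta j)) *~ e j.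
Proof.
move: e; apply: (@exponent_ind n) => [e e' ee' h||e j jn h|e j jn h].
- rewrite -(mono_ext P ee') h; apply: eq_bigr => j _; by rewrite ee'.
- by rewrite mono0 (tan_1 _ _ _ (s := [::])) // big1 // => j _; rewrite mulr0z.
- rewrite monoD (tanM F _ _ (s := [::])) //; try exact: isU_mono.
  rewrite h [RHS](eq_bigr _ (fun k _ => mulrzDr _ _ _)) big_split /=; congr (_ + _).
  by rewrite (sum_delta (fun j => D g (mono n P (delta j))) jn).
rewrite mono_deltaN (tanM F _ _ (s := [::])) //; try exact: isU_mono.
rewrite h [RHS](eq_bigr _ (fun k _ => mulrzBr _ _ _)) sumrB; congr (_ + _).
rewrite (tanV F f _ (s := [::]) _ _ (monoV n P (delta j))) //; congr (- _).
by rewrite (sum_delta (fun j => D g (mono n P (delta j))) jn).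
Qed.
End CrossMul.

(** * Rigidity of symbols *)

(* If [chi (1 + s h) = 1 + c s^k] in [P[s]/(s^(k+1))], then squaring [1 + s h] and
   replacing [s] by [2 s] give [2 c = 2^k c]. *)
Lemma char_tangent n (P : comPzRingType) (chi : char n P) : torsion_free P ->
  (forall e, chi _ (tr_in (trunc 2 P)) (1 + constL n _ (tr_s (trunc 2 P)) * mono n _ e) = 1) ->
  forall (C : comPzRingType) (g : {rmorphism P -> C}) c e, nilp c ->
    chi C g (1 + constL n C c * mono n C e) = 1.
Proof.
move=> tfP h2.
have lift k : (forall e, chi _ (tr_in (trunc k P)) (1 + constL n _ (tr_s (trunc k P)) * mono n _ e) = 1) ->
    forall (C : comPzRingType) (g : {rmorphism P -> C}) c e, c ^+ k = 0 ->
      chi C g (1 + constL n C c * mono n C e) = 1.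
  move=> hk C g c e ck; have [pi [pii pis]] := tr_lift (trunc k P) g ck.
  have := congr1 pi (hk e); rewrite rmorph1 -(chN chi (g := g)) //; last first.
    by apply/isU_1nilp/nilpMr/nilp_map; exists k; apply: tr_sk.
  by rewrite rmorphD rmorph1 rmorphM iter_map_constL pis mono_map.
suff H k : forall e, chi _ (tr_in (trunc k P)) (1 + constL n _ (tr_s (trunc k P)) * mono n _ e) = 1.
  by move=> C g c e [k ck]; apply: (lift k).
elim: k => [|k ih] e.
  set T := trunc 0 P; have T0 (x : T) : x = 0 by rewrite -[x]mul1r -(expr0 (tr_s T)) tr_sk mul0r.
  by rewrite [LHS]T0 [RHS]T0.
case: k ih => [|[|k]] ih.
- have s0 := tr_sk (trunc 1 P); rewrite expr1 in s0.
  by rewrite s0 rmorph0 mul0r addr0 ch1.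
- exact: h2.
move: ih; set K' := k.+2 => ih; set T := trunc K'.+1 P; set s := tr_s T.
have sK : s ^+ K'.+1 = 0 by apply: tr_sk.
have low c e' : c ^+ K' = 0 -> chi T (tr_in T) (1 + constL n T c * mono n T e') = 1 by apply: lift.
have sq z : lpoly z -> chi T (tr_in T) (1 + constL n T (s ^+ 2) * z) = 1.
  apply: lpoly_char => [|b e']; first by exists K'; rewrite -exprM; apply: nilpX sK _; rewrite /K'; lia.
  by apply: low; rewrite exprMn -exprM (nilpX sK) ?mul0r // /K'; lia.
set h := mono n T e; set Psi := chi T (tr_in T) _.
have nt (x : iter_laurent n T) : nilp (constL n T s * x) by apply/nilpMr/nilp_map; exists K'.+1.
have ut (x : iter_laurent n T) : isU (1 + constL n T s * x) by apply/isU_1nilp/nt.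
have [c Pc] : exists c, Psi = 1 + tr_in T c * s ^+ K'.
  have [pi [pii pis]] := tr_lift T (tr_in (trunc K' P)) (nilpX (tr_sk (trunc K' P)) (leqnSn K')).
  have pP : pi Psi = 1.
    rewrite -(chN chi (g := tr_in (trunc K' P))) // rmorphD rmorph1 rmorphM iter_map_constL pis mono_map.
    exact: ih.
  exists (tr_coef Psi K'); rewrite {1}[Psi]tr_eq big_ord_recr /=; congr (_ + _).
  have c1 j : (j < K')%N -> tr_coef Psi j = if j is 0 then 1 else 0.
    move=> jK; rewrite -(tr_coefE (trunc K' P) (tr_coef Psi) jK).
    have -> : \sum_(i < K') tr_in (trunc K' P) (tr_coef Psi i) * tr_s (trunc K' P) ^+ i = pi Psi.
      rewrite [in RHS](tr_eq Psi) rmorph_sum [RHS]big_ord_recr /= rmorphM rmorphXn pis tr_sk mulr0 addr0.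
      by apply: eq_bigr => i _; rewrite rmorphM rmorphXn pii pis.
    rewrite pP -[RHS](tr_coefE (trunc K' P) (fun j => if j is 0 then 1 else 0) jK).
    congr (tr_coef _ _); rewrite big_ord_recl rmorph1 mulr1 big1 ?addr0 // => i _.
    by rewrite rmorph0 mul0r.
  rewrite big_ord_recl /= c1 // rmorph1 mulr1 big1 ?addr0 // => i _.
  by rewrite c1 ?rmorph0 ?mul0r // ltnS ltn_ord.
have [de [dei des]] : exists d : {rmorphism T -> T}, (forall b, d (tr_in T b) = tr_in T b) /\ d s = 2%:R * s.
  by apply: tr_lift; rewrite exprMn sK mulr0.
have e1 : chi T (tr_in T) (1 + constL n T s * (2%:R * h)) = 1 + tr_in T (c * 2%:R ^+ K') * s ^+ K'.
  have := congr1 de Pc; rewrite -(chN chi (g := tr_in T)) //.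
  have -> : iter_laurent_map n de (1 + constL n T s * h) = 1 + constL n T s * (2%:R * h).
    by rewrite rmorphD rmorph1 rmorphM iter_map_constL des mono_map -/h rmorphM rmorph_nat; ring.
  move=> ->; rewrite rmorphD rmorph1 rmorphM rmorphXn dei des exprMn [in RHS]rmorphM rmorphXn rmorph_nat.
  by ring.
have [r hr] := nt (2%:R * h).
pose v := \sum_(i < r) (- (constL n T s * (2%:R * h))) ^+ i.
have hv : (1 + constL n T s * (2%:R * h)) * v = 1.
  by rewrite -{1}[constL n T s * _]opprK geometric exprNn hr mulr0 subr0.
have lh : lpoly h by apply: lpoly_mono.
have lv : lpoly v.
  apply: lpoly_sum => i _; apply/lpolyX/lpolyN/lpolyM; first exact: lpoly_constL.
  by rewrite -(rmorph_nat (constL n T)); apply: lpolyM => //; apply: lpoly_constL.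
have prod : (1 + constL n T s * h) * (1 + constL n T s * h) =
    (1 + constL n T s * (2%:R * h)) * (1 + constL n T (s ^+ 2) * (h * h * v)).
  have -> : (1 + constL n T s * (2%:R * h)) * (1 + constL n T (s ^+ 2) * (h * h * v)) =
    1 + constL n T s * (2%:R * h) +
    constL n T (s ^+ 2) * h * h * ((1 + constL n T s * (2%:R * h)) * v) by ring.
  by rewrite hv rmorphXn; ring.
have u2 : isU (1 + constL n T (s ^+ 2) * (h * h * v)).
  by apply/isU_1nilp/nilpMr/nilp_map; exists K'.+1; rewrite -exprM; apply: nilpX sK _; lia.
have := congr1 (chi T (tr_in T)) prod.
rewrite (chM chi _ (ut h) (ut h)) (chM chi _ (ut _) u2) (sq _ (lpolyM (lpolyM lh lh) lv)) mulr1.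
rewrite -/Psi e1 Pc dual_mul; last first.
  by rewrite -exprD (nilpX sK) // /K'; lia.
rewrite -rmorphD => /addrI e2.
have coefK a : tr_coef (tr_in T a * s ^+ K') K' = a.
  transitivity (if K' == K' then a else 0); last by rewrite eqxx.
  rewrite -(tr_coefE T (fun j => if j == K' then a else 0) (ltnSn K')); congr (tr_coef _ _).
  rewrite big_ord_recr /= eqxx big1 ?add0r // => i _.
  by rewrite ltn_eqF ?ltn_ord // rmorph0 mul0r.
have := congr1 (fun x => @tr_coef _ _ T x K') e2; rewrite !coefK => e3.
suff -> : c = 0 by rewrite rmorph0 mul0r addr0.
apply: (tfP (2 ^ K' - 2)%N).
  by rewrite subn_gt0 /K' !expnS; have := expn_gt0 2 k; lia.
rewrite mulrnBr; last by rewrite /K' !expnS; have := expn_gt0 2 k; lia.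
by rewrite mulr2n e3 -natrX mulr_natr subrr.
Qed.

Section SymbolRigidity.
Variables (m : nat) (R : comPzRingType) (F : symbol m.+1 R).
Hypothesis tfR : torsion_free R.
Local Notation n := m.+1.
Local Notation L := (iter_laurent n).
Local Notation Lmap := (iter_laurent_map n).
Local Notation units s := {in s, forall x, isU x}.

Definition infs (A : comPzRingType) (xs : seq (A * (nat -> int))) : seq (L A) :=
  [seq 1 + constL n A p.1 * mono n A p.2 | p <- xs].
Definition vars (A : comPzRingType) (js : seq nat) : seq (L A) := [seq mono n A (delta j) | j <- js].
Local Notation nil1 xs := (all (fun p => `[< nilp p.1 >]) xs).
Local Notation sq0 xs := (all (fun p => p.1 * p.1 == 0) xs).
Local Notation push h xs := [seq (h p.1, p.2) | p <- xs].

Hypothesis norm : forall (A : comPzRingType) (f : {rmorphism R -> A}) a, isU a ->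
  F A f (constL n A a :: vars A (iota 0 n)) = 1.

Lemma infs_cons (A : comPzRingType) (p : A * (nat -> int)) xs :
  infs (p :: xs) = 1 + constL n A p.1 * mono n A p.2 :: infs xs.
Proof. by []. Qed.
Lemma vars_cons (A : comPzRingType) j js : vars A (j :: js) = mono n A (delta j) :: vars A js.
Proof. by []. Qed.
Lemma map_infs (A B : comPzRingType) (h : {rmorphism A -> B}) xs :
  map (Lmap h) (infs xs) = infs (push h xs).
Proof.
rewrite /infs -!map_comp; apply: eq_map => p.
by rewrite -[LHS]/(Lmap h (1 + constL n A p.1 * mono n A p.2)) rmorphD rmorph1 rmorphM iter_map_constL mono_map.
Qed.
Lemma map_vars (A B : comPzRingType) (h : {rmorphism A -> B}) js :
  map (Lmap h) (vars A js) = vars B js.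
Proof. by rewrite /vars -map_comp; apply: eq_map => j; apply: mono_map. Qed.
Lemma units_vars (A : comPzRingType) js : units (vars A js).
Proof. by move=> _ /mapP[j _ ->]; apply: isU_mono. Qed.
Lemma units_infs (A : comPzRingType) (xs : seq (A * (nat -> int))) : nil1 xs -> units (infs xs).
Proof.
elim: xs => // p xs ih /andP[/asboolP np /ih us]; rewrite infs_cons; apply: in_cons_units => //.
exact/isU_1nilp/nilpMr/nilp_map.
Qed.
Lemma sq0_nil1 (A : comPzRingType) (xs : seq (A * (nat -> int))) : sq0 xs -> nil1 xs.
Proof. by apply: sub_all => p /eqP e; apply/asboolP; exists 2%N; rewrite expr2. Qed.
Lemma push_nil1 (A B : comPzRingType) (h : {rmorphism A -> B}) (xs : seq (A * (nat -> int))) :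
  nil1 xs -> nil1 (push h xs).
Proof. by rewrite all_map; apply: sub_all => p /= /asboolP np; apply/asboolP/nilp_map. Qed.
Lemma push_sq0 (A B : comPzRingType) (h : {rmorphism A -> B}) (xs : seq (A * (nat -> int))) :
  sq0 xs -> sq0 (push h xs).
Proof. by rewrite all_map; apply: sub_all => p /= /eqP e; rewrite -rmorphM e rmorph0. Qed.

Lemma dup_perm (T : eqType) (s : seq T) : ~~ uniq s -> exists x s', perm_eq s [:: x, x & s'].
Proof.
elim: s => //= y s ih; rewrite negb_and negbK; case: (boolP (y \in s)) => [ys _|_ /ih[x [s' e]]].
  by exists y, (rem y s); rewrite perm_cons perm_to_rem.
exists x, (y :: s'); rewrite -(perm_cons y) in e; apply: perm_trans e _.
by rewrite -[y :: _]cat1s -[[:: x, x & s']]/([:: x; x] ++ s') perm_catCA.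
Qed.

Lemma torsion_free_int (A : comPzRingType) (x : A) (z : int) : torsion_free A ->
  z != 0 -> x *~ z = 0 -> x = 0.
Proof.
move=> tf; case: z => k k0 => [|/eqP].
  by rewrite -pmulrn; apply: tf; rewrite lt0n.
by rewrite NegzE mulrNz oppr_eq0 -pmulrn => /eqP; apply: tf.
Qed.

Section TorsionFreeBase.
Variables (P : comPzRingType) (f : {rmorphism R -> P}).
Hypothesis tfP : torsion_free P.
Local Notation D g s := (tangent F f g s).

Lemma tan_dup (g x : L P) (s : seq (L P)) : isU x -> units s -> D g [:: x, x & s] = 0.
Proof.
move=> ux us; have u0 : units ([::] : seq (L P)) by [].
have u1 : isU (-1 : L P) by apply/isUN/isU1.
have u11 : units [:: x] by apply: in_cons_units.
have tfx : D g [:: x, -1 & s] = 0.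
  apply: (tfP (m := 2)) => //; rewrite mulr2n.
  rewrite -(tanM F f g (s := [:: x]) (s' := s)) // mulrNN mulr1.
  exact: (tan_1 F f g (s := [:: x])).
have := tan_opp F f g (s := [::]) (s' := s) u0 us ux.
by rewrite /= -mulN1r (tanM F f g (s := [:: x]) (s' := s)) //= tfx add0r.
Qed.


Lemma tan_vars_dup g js : ~~ uniq js -> D g (vars P js) = 0.
Proof.
move=> /dup_perm[j [js' e]]. apply: (tan_perm (s := vars P [:: j, j & js'])).
- exact: units_vars.
- by apply: perm_map; rewrite perm_sym.
by apply: tan_dup; [apply: isU_mono | apply: units_vars].
Qed.

Lemma tan_vars e js : all (fun j => j < n)%N js -> size js = n -> D (mono n P e) (vars P js) = 0.
Proof.
move=> jsn sz; case: (boolP (uniq js)) => [us|]; last exact: tan_vars_dup.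
have pjs : perm_eq js (iota 0 n).
  apply: uniq_perm => //; first exact: iota_uniq.
  have sub : {subset js <= iota 0 n} by move=> j /(allP jsn); rewrite mem_iota.
  by apply: (uniq_min_size us sub _).2; rewrite size_iota sz.
case: (boolP [forall j : 'I_n, e j == 0]) => [/forallP e0|].
  apply: (tan_perm (s := vars P (iota 0 n))).
  - exact: units_vars.
  - by apply: perm_map; rewrite perm_sym.
  apply: tan_eq0; first exact: units_vars.
  rewrite map_vars mono_map (mono_ext (trunc 2 P) (e' := fun=> 0)) => [|j jn]; last first.
    exact/eqP/(e0 (Ordinal jn)).
  rewrite mono0 mulr1 -(rmorph1 (constL n (trunc 2 P))) -rmorphD; apply: norm.
  by apply: isU_1nilp; exists 2%N; apply: tr_sk.
rewrite negb_forall => /existsP[j ej]; have jjs : val j \in js by rewrite (perm_mem pjs) mem_iota add0n ltn_ord.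
set js' := rem (val j) js; have pj : perm_eq js (val j :: js') by apply: perm_to_rem.
apply: (tan_perm (s := vars P (val j :: js'))).
- exact: units_vars.
- by apply: perm_map; rewrite perm_sym.
apply: (torsion_free_int tfP ej).
have := tan_mono F f (rho := vars P js') (@units_vars _ _) (mono n P e) e.
rewrite tan_mono_self; last exact: units_vars.
rewrite (bigD1 j) //= big1 ?addr0 // => k kj.
rewrite -[mono n P (delta k) :: _]/(vars P (val k :: js')) tan_vars_dup ?mul0rz //.
rewrite /= negb_and negbK; apply/orP; left.
rewrite mem_rem_uniq // inE /= (perm_mem pjs) mem_iota add0n ltn_ord andbT.
by rewrite leq0n andbT.
Qed.
End TorsionFreeBase.

Lemma sym_square_zero (P : comPzRingType) (f : {rmorphism R -> P}) xs js : torsion_free P ->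
  sq0 xs -> all (fun j => j < n)%N js -> (0 < size xs)%N -> (size xs + size js)%N = n.+1 ->
  F P f (infs xs ++ vars P js) = 1.
Proof.
move: {2}(size xs) (erefl (size xs)) => r.
elim: r P f xs js => [|r ih] P f xs js; first by case: xs.
case: xs => [|[s0 e0] [|[s1 e1] xs]] //= [szr] tfP.
  rewrite andbT => /eqP ss0 jsn _ /eqP; rewrite add1n eqSS => /eqP sz.
  have := tan_gen F (f := f) (h := rid P) (k := f) (e := s0) (mono n P e0) (@units_vars P js) ss0.
  by rewrite mono_map map_vars tan_vars // mul0r addr0; apply.
move=> /and3P[/eqP ss0 /eqP ss1 sxs] jsn _ sz.
have unitsr : units (infs xs ++ vars P js).
  by apply: in_cat_units; [apply/units_infs/sq0_nil1 | apply: units_vars].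
have := cross_gen F (f := f) unitsr (h := rid P) (k := f) (mono n P e0) (mono n P e1) ss0 ss1.
rewrite !mono_map iter_map_seq_id => -> //; rewrite cross_mono // tan_mono // big1 ?mul0r ?addr0 ?rmorph0 ?mul0r ?addr0 //.
move=> j _; rewrite -monoD tan_eq0 ?mul0rz //; first by apply: in_cons_units => //; apply: isU_mono.
set E := trunc 2 P; rewrite map_cons map_cat map_infs map_vars !mono_map.
pose es := fun k => e1 k + e0 k.
have pe : perm_eq (infs ((tr_s E, es) :: push (tr_in E) xs) ++ vars E (val j :: js))
  ((1 + constL n E (tr_s E) * mono n E es) :: mono n E (delta j) ::
     infs (push (tr_in E) xs) ++ vars E js).
  by rewrite /= perm_cons -cat1s perm_catCA.
apply: (sym_perm (s1 := [::]) _ pe).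
  rewrite cat0s; apply: in_cat_units; last exact: units_vars.
  apply: units_infs; rewrite /= push_nil1 ?sq0_nil1 // andbT; apply/asboolP.
  by exists 2%N; apply: tr_sk.
apply: ih => //=.
- by rewrite size_map; case: szr => ->.
- exact: torsion_free_trunc.
- by rewrite dual_sq eqxx push_sq0.
- by rewrite jsn ltn_ord.
by rewrite size_map; move: sz => /= ; lia.
Qed.

Lemma sym_nilpotent_torsion_free (P : comPzRingType) (f : {rmorphism R -> P}) xs ys js :
  torsion_free P -> nil1 xs -> sq0 ys -> all (fun j => j < n)%N js ->
  (0 < size xs + size ys)%N -> (size xs + size ys + size js)%N = n.+1 ->
  F P f (infs xs ++ infs ys ++ vars P js) = 1.
Proof.
move: {2}(size xs) (erefl (size xs)) => r.
elim: r P f xs ys => [|r ih] P f [|[c e] xs] ys //=; first by move=> *; apply: sym_square_zero.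
move=> [szr] tfP /andP[/asboolP nc nxs] sys jsn _ sz; rewrite -[_ :: _ ++ _]/(infs ((c, e) :: xs) ++ _) infs_cons cat_cons.
set rho := infs xs ++ infs ys ++ vars P js.
have urho : units rho.
  apply: in_cat_units; first exact: units_infs.
  by apply: in_cat_units; [apply/units_infs/sq0_nil1 | apply: units_vars].
have := @char_tangent n P (sym_char F f urho) tfP _ P (rid P) c e nc.
rewrite sym_charE iter_map_seq_id => H.
rewrite (sym_ext F (g := rcomp (rid P) f)) //; last first.
  by apply: in_cons_units => //; apply/isU_1nilp/nilpMr/nilp_map.
apply: H => {}e; rewrite sym_charE; set E := trunc 2 P.
rewrite /rho !map_cat !map_infs map_vars.
apply: (sym_perm (s1 := [::]) (s := infs (push (tr_in E) xs) ++ infs ((tr_s E, e) :: push (tr_in E) ys) ++ vars E js)).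
- rewrite cat0s; apply: in_cat_units; first exact/units_infs/push_nil1.
  apply: in_cat_units; last exact: units_vars.
  by apply/units_infs/sq0_nil1; rewrite /= dual_sq eqxx push_sq0.
- by rewrite infs_cons cat_cons -cat1s perm_catCA.
apply: ih => //.
- by rewrite size_map.
- exact: torsion_free_trunc.
- exact: push_nil1.
- by rewrite /= dual_sq eqxx push_sq0.
- by rewrite /= addnS.
by rewrite /= !size_map; move: sz => /=; lia.
Qed.

Lemma lift_nilpotents (A : comPzRingType) (f : {rmorphism R -> A}) (xs : seq (A * (nat -> int))) :
  nil1 xs -> exists (P : comPzRingType) (fP : {rmorphism R -> P}) (h : {rmorphism P -> A}) ys,
    [/\ torsion_free P, forall r, h (fP r) = f r, nil1 ys & push h ys = xs].
Proof.
elim: xs => [_|[c e] xs ih /andP[/asboolP[k ck] /ih[P [fP [h [ys [tfP hf nys <-]]]]]]].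
  by exists R, (rid R), f, [::].
have [h' [hi hs]] := tr_lift (trunc k P) h ck.
exists (trunc k P), (rcomp (tr_in (trunc k P)) fP), h', ((tr_s _, e) :: push (tr_in _) ys); split.
- exact: torsion_free_trunc.
- by move=> r; rewrite rcompE hi.
- by rewrite /= push_nil1 // andbT; apply/asboolP; exists k; apply: tr_sk.
by rewrite /= hs -map_comp; congr (_ :: _); apply: eq_map => p /=; rewrite hi.
Qed.

Lemma sym_nilpotent (A : comPzRingType) (f : {rmorphism R -> A}) xs js :
  nil1 xs -> all (fun j => j < n)%N js -> (0 < size xs)%N -> (size xs + size js)%N = n.+1 ->
  F A f (infs xs ++ vars A js) = 1.
Proof.
move=> nxs jsn; have [P [fP [h [ys [tfP hf nys <-]]]]] := lift_nilpotents f nxs.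
rewrite size_map => s0 sz; rewrite -map_infs -(map_vars h) -map_cat (syN F (f := fP)) //.
  rewrite (@sym_nilpotent_torsion_free P fP ys [::] js) ?rmorph1 //=; first by rewrite addn0.
  by rewrite addn0.
by apply: in_cat_units; [apply: units_infs | apply: units_vars].
Qed.

Lemma sym_const_vars (A : comPzRingType) (f : {rmorphism R -> A}) a js :
  all (fun j => j < n)%N js -> size js = n -> isU a -> F A f (constL n A a :: vars A js) = 1.
Proof.
move=> jsn sz ua.
have := @Gm_char_unipotent A (sym_char0 F f (@units_vars A js)) _ A (rid A) a ua.
rewrite sym_char0E map_vars => H; rewrite (sym_ext F (g := rcomp (rid A) f)) //; last first.
  by apply: in_cons_units; [apply: isU_map | apply: units_vars].
apply: H => k; rewrite sym_char0E map_vars.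
have -> : constL n (trunc k A) (1 + tr_s (trunc k A)) =
    1 + constL n (trunc k A) (tr_s (trunc k A)) * mono n (trunc k A) (fun=> 0).
  by rewrite mono0 mulr1 rmorphD rmorph1.
apply: (@sym_nilpotent _ _ [:: (tr_s (trunc k A), fun=> 0)] js) => //; last by rewrite /= sz.
by rewrite /= andbT; apply/asboolP; exists k; apply: tr_sk.
Qed.

Lemma sym_vars (A : comPzRingType) (f : {rmorphism R -> A}) js :
  all (fun j => j < n)%N js -> size js = n.+1 -> F A f (vars A js) = 1.
Proof.
move=> jsn sz; have : ~~ uniq js.
  apply/negP => us; have sub : {subset js <= iota 0 n}.
    by move=> j /(allP jsn); rewrite mem_iota.
  by have := uniq_leq_size us sub; rewrite size_iota sz ltnn.
case/dup_perm => j [js' e]; have jsn' : all (fun j => j < n)%N [:: j, j & js'].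
  by rewrite -(perm_all _ e).
apply: (sym_perm (s1 := [::]) (s := vars A [:: j, j & js'])); first exact: units_vars.
  by apply: perm_map; rewrite perm_sym.
have uj := isU_mono n A (delta j); have u1 : isU (-1 : A) by apply/isUN/isU1.
have uc : isU (constL n A (-1)) by apply: isU_map.
have c1 : F A f [:: constL n A (-1), mono n A (delta j) & vars A js'] = 1.
  apply: (sym_const_vars f (js := j :: js')) => //; first by case/andP: jsn'.
  by have := perm_size e; rewrite sz => -[->].
have c2 : F A f [:: mono n A (delta j), constL n A (-1) & vars A js'] = 1.
  by have := sym_swap F f [::] (vars A js') uj uc; rewrite /= c1 mulr1.
have := sym_opp F f [::] (vars A js') uj.
by rewrite -mulN1r -(rmorph1 (constL n A)) -rmorphN (symM2 F f [::]) //= c2 mul1r.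
Qed.

Theorem symbol_trivial (A : comPzRingType) (f : {rmorphism R -> A}) us :
  units us -> size us = n.+1 -> F A f us = 1.
Proof.
suff H r (A' : comPzRingType) (f' : {rmorphism R -> A'}) us' xs js : size us' = r ->
    units us' -> nil1 xs -> all (fun j => j < n)%N js ->
    (size us' + size xs + size js)%N = n.+1 -> F A' f' (us' ++ infs xs ++ vars A' js) = 1.
  by move=> uus sz; have := H _ A f us [::] [::] erefl uus; rewrite cats0 /= !addn0; apply.
elim: r A' f' us' xs js {A f us} => [|r ih] A f [|u us] xs js //.
  move=> _ _ nxs jsn sz.
  case: xs nxs sz => [|x xs] nxs sz; first exact: sym_vars.
  exact: sym_nilpotent.
move=> [szr] uus nxs jsn sz.
have uu : isU u by apply: uus; rewrite mem_head.
have {}uus : units us by move=> x xus; apply: uus; rewrite inE xus orbT.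
set rho := us ++ infs xs ++ vars A js.
have urho : units rho.
  by apply: in_cat_units => //; apply: in_cat_units; [apply: units_infs | apply: units_vars].
have := @char_rigid n A (sym_char F f urho) _ _ A (rid A) u uu.
rewrite sym_charE iter_map_seq_id => H.
rewrite (sym_ext F (g := rcomp (rid A) f)) //; last exact: in_cons_units.
have mapE (B : comPzRingType) (g : {rmorphism A -> B}) :
    map (Lmap g) rho = map (Lmap g) us ++ infs (push g xs) ++ vars B js.
  by rewrite /rho !map_cat map_infs map_vars.
apply: H => B g.
  move=> c e nc; rewrite sym_charE mapE.
  have npx : nil1 ((c, e) :: push g xs) by rewrite /= push_nil1 // andbT; apply/asboolP.
  apply: (sym_perm (s1 := [::]) (s := map (Lmap g) us ++ infs ((c, e) :: push g xs) ++ vars B js)).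
  - rewrite cat0s; apply: in_cat_units; first exact: iter_map_units.
    by apply: in_cat_units; [apply: units_infs | apply: units_vars].
  - by rewrite infs_cons cat_cons -cat1s perm_catCA.
  apply: ih => //; rewrite ?size_map //; first exact: iter_map_units.
  by rewrite /= size_map -sz /=; lia.
have cM := chM (sym_char F f urho) g.
have hT j : (j < n)%N -> sym_char F f urho B g (mono n B (delta j)) = 1.
  move=> jn; rewrite sym_charE mapE.
  apply: (sym_perm (s1 := [::]) (s := map (Lmap g) us ++ infs (push g xs) ++ vars B (j :: js))).
  - rewrite cat0s; apply: in_cat_units; first exact: iter_map_units.
    by apply: in_cat_units; [apply/units_infs/push_nil1 | apply: units_vars].
  - rewrite vars_cons !catA; apply/permEl.
    exact: (perm_catCA (map (Lmap g) us ++ infs (push g xs)) [:: mono n B (delta j)] (vars B js)).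
  apply: ih => //; rewrite ?size_map //; first exact: iter_map_units.
  - exact: push_nil1.
  - by rewrite /= jn.
  by rewrite -sz /=; lia.
apply: (@exponent_ind n) => [e e' ee' h||e j jn h|e j jn h].
- by rewrite -(mono_ext B ee').
- by rewrite mono0 ch1.
- by rewrite mono_delta cM ?h ?hT ?mul1r //; apply: isU_mono.
have e1 : mono n B e = mono n B (fun k => e k - delta j k) * mono n B (delta j).
  by rewrite -monoD; apply: mono_ext => k _; lia.
by move: h; rewrite e1 cM ?hT ?mulr1 //; apply: isU_mono.
Qed.
End SymbolRigidity.

(** * Morphisms from Milnor K-groups as symbols *)

Section GmRules.
Variable A : comPzRingType.
Implicit Types u v w : Gm A.

Lemma Gm_inj u v : Gm_val u = Gm_val v -> u = v.
Proof. exact: val_inj. Qed.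
Lemma isU_Gm u : isU (Gm_val u). Proof. exact: Gm_invP. Qed.
Lemma Gm_invvalE u b : Gm_val u * b = 1 -> Gm_invval u = b.
Proof. by move=> ub; apply: (isU_cancel (isU_Gm u)); rewrite Gm_mulV ub. Qed.
Lemma Gm_expz_inv u n : Gm_expz u n * Gm_expz u (- n) = 1.
Proof.
case: n => [[|n]|n]; rewrite ?mulr1 //= -?NegzE /= -?exprMn.
  by rewrite Gm_mulV expr1n.
by rewrite mulrC Gm_mulV expr1n.
Qed.
Lemma Gm_expzS u n : Gm_expz u (n + 1) = Gm_expz u n * Gm_val u.
Proof.
case: n => [n|[|n]].
- by rewrite (_ : n%:Z + 1 = n.+1) /= ?exprSr //; lia.
- by rewrite /= expr1 mulrC Gm_mulV.
rewrite (_ : Negz n.+1 + 1 = Negz n) /=; last by lia.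
by rewrite [in RHS]exprSr -mulrA [_ * Gm_val u]mulrC Gm_mulV mulr1.
Qed.
Lemma Gm_expzD u a b : Gm_expz u (a + b) = Gm_expz u a * Gm_expz u b.
Proof.
have D (k : nat) : forall a', Gm_expz u (a' + k%:Z) = Gm_expz u a' * Gm_expz u k%:Z.
  elim: k => [|k ih] a'; first by rewrite addr0 mulr1.
  by rewrite -[k.+1]addn1 PoszD addrA !Gm_expzS ih mulrA.
case: b => k; first exact: D.
apply: (isU_cancel (x := Gm_expz u k.+1)).
  by exists (Gm_expz u (- k.+1%:Z)); apply: Gm_expz_inv.
have e1 : Gm_expz u (a + Negz k) * Gm_expz u k.+1 = Gm_expz u a by rewrite -D NegzE subrK.
have e2 : Gm_expz u k.+1 * Gm_expz u (Negz k) = 1 by rewrite NegzE; apply: Gm_expz_inv.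
by rewrite mulrC e1 mulrCA e2 mulr1.
Qed.
Lemma Gm_expzM u v w k : Gm_val w = Gm_val u * Gm_val v ->
  Gm_expz w k = Gm_expz u k * Gm_expz v k.
Proof.
move=> e; have eV : Gm_invval w = Gm_invval u * Gm_invval v.
  by apply: Gm_invvalE; rewrite e mulrACA !Gm_mulV mulr1.
by case: k => k /=; rewrite ?e ?eV exprMn.
Qed.

Definition toGm (x : A) : Gm A :=
  match pselect (isU x) with
  | left h => mkGm (projT2 (cid h))
  | right _ => mkGm (mulr1 1)
  end.
Lemma toGmE x : isU x -> Gm_val (toGm x) = x.
Proof. by rewrite /toGm; case: pselect. Qed.
Lemma toGmK u : toGm (Gm_val u) = u.
Proof. by apply: Gm_inj; rewrite toGmE //; apply: isU_Gm. Qed.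
End GmRules.

Lemma Gm_map_expz (A B : comPzRingType) (h : {rmorphism A -> B}) u k :
  Gm_expz (Gm_map h u) k = h (Gm_expz u k).
Proof.
have e : Gm_invval (Gm_map h u) = h (Gm_invval u).
  by apply: Gm_invvalE; rewrite -rmorphM Gm_mulV rmorph1.
by case: k => k; rewrite /= ?e rmorphXn.
Qed.
Lemma toGm_map (A B : comPzRingType) (h : {rmorphism A -> B}) x : isU x ->
  toGm (h x) = Gm_map h (toGm x).
Proof.
move=> ux; apply: Gm_inj; rewrite toGmE; last exact: isU_map.
by rewrite -[RHS]/(h (Gm_val (toGm x))) toGmE.
Qed.

Section MilnorInduction.
Variables (m : nat) (A : comPzRingType).
Local Notation freeK := {freeg (m.-tuple (Gm A)) / int}.
Definition KM_pi (x : freeK) : KM m A := \pi_(Quotient.quot (@KM_sub m A)) x.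
Lemma KM_piB x y : KM_pi (x - y) = KM_pi x - KM_pi y.
Proof. by rewrite /KM_pi !piE. Qed.
Lemma KM_pi0 : KM_pi 0 = 0. Proof. by have := KM_piB 0 0; rewrite !subrr. Qed.
Lemma KM_piN x : KM_pi (- x) = - KM_pi x. Proof. by have := KM_piB 0 x; rewrite !sub0r KM_pi0 sub0r. Qed.
Lemma KM_piD x y : KM_pi (x + y) = KM_pi x + KM_pi y.
Proof. by rewrite -{1}[y]opprK KM_piB KM_piN opprK. Qed.
Lemma KM_rel_eq x y : KM_rel (x - y) -> KM_pi x = KM_pi y.
Proof. by move=> h; apply/eqP; rewrite -Quotient.idealrBE; apply/asboolP. Qed.

Lemma KM_symbolD (i : 'I_m) (s s1 s2 : m.-tuple (Gm A)) :
  Gm_val (tnth s i) = Gm_val (tnth s1 i) * Gm_val (tnth s2 i) ->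
  (forall j, j != i -> tnth s1 j = tnth s j /\ tnth s2 j = tnth s j) ->
  KM_symbol s = KM_symbol s1 + KM_symbol s2.
Proof.
move=> hi hj; have := KM_rel_multilinear hi hj.
by rewrite -addrA -opprD => /KM_rel_eq; rewrite KM_piD.
Qed.
Lemma KM_symbol0 (i j : 'I_m) (s : m.-tuple (Gm A)) :
  j = i.+1 :> nat -> Gm_val (tnth s i) + Gm_val (tnth s j) = 1 -> KM_symbol s = 0.
Proof.
move=> ij h; have := KM_rel_steinberg ij h; rewrite -[<< s >>]subr0 => /KM_rel_eq.
by rewrite KM_pi0.
Qed.

Lemma KM_ind (Q : KM m A -> Prop) : Q 0 -> (forall x y, Q x -> Q y -> Q (x + y)) ->
  (forall x, Q x -> Q (- x)) -> (forall s, Q (KM_symbol s)) -> forall x, Q x.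
Proof.
move=> Q0 QD QN Qs x; rewrite -[x]reprK -[repr x]freeg_sumE -/(KM_pi _).
elim/big_rec: _ => [|z D _ hD]; first by rewrite KM_pi0.
rewrite KM_piD; apply: (QD) => //.
have -> : << coeff z (repr x) *g z >> = << z >> *~ coeff z (repr x) by rewrite freegU_mulz intz.
have Qn (k : nat) : Q (KM_pi (<< z >> *+ k)).
  elim: k => [|k ih]; first by rewrite mulr0n KM_pi0.
  by rewrite mulrS KM_piD; apply: QD => //; apply: Qs.
case: (coeff z (repr x)) => k; first exact: Qn.
by rewrite NegzE mulrNz KM_piN; apply: QN; apply: Qn.
Qed.
End MilnorInduction.

Section LKMSymbol.
Variables (n : nat) (R : comPzRingType) (Psi : LKM_to_Gm n R).
Local Notation L := (iter_laurent n).

Definition lkm_seq (A : comPzRingType) (f : {rmorphism R -> A}) (s : seq (Gm (L A))) : A :=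
  if insub s : option (n.+1.-tuple (Gm (L A))) is Some t then Gm_val (Psi A f (KM_symbol t)) else 1.
Definition lkm_sym (A : comPzRingType) (f : {rmorphism R -> A}) (s : seq (L A)) : A :=
  lkm_seq f (map (@toGm _) s).

Lemma lkm_seqE (A : comPzRingType) (f : {rmorphism R -> A}) (t : n.+1.-tuple (Gm (L A))) :
  lkm_seq f t = Gm_val (Psi A f (KM_symbol t)).
Proof. by rewrite /lkm_seq valK. Qed.

Lemma lkm_val0 (A : comPzRingType) (f : {rmorphism R -> A}) : Gm_val (Psi A f 0) = 1.
Proof.
apply: (isU_cancel (isU_Gm (Psi A f 0))).
by rewrite -lkm_mul addr0 mulr1.
Qed.

Lemma lkm_symU (A : comPzRingType) (f : {rmorphism R -> A}) s : isU (lkm_sym f s).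
Proof.
by rewrite /lkm_sym /lkm_seq; case: insub => [t|]; [apply: isU_Gm | apply: isU1].
Qed.
Lemma lkm_symM (A : comPzRingType) (f : {rmorphism R -> A}) s (x y : L A) s' : isU x -> isU y ->
  lkm_sym f (s ++ x * y :: s') = lkm_sym f (s ++ x :: s') * lkm_sym f (s ++ y :: s').
Proof.
move=> ux uy; rewrite /lkm_sym !map_cat !map_cons.
move: (map _ s) (map _ s') => {}s {}s'.
have sz z : size (s ++ toGm z :: s') = (size s + size s').+1 by rewrite size_cat /= addnS.
case: (eqVneq (size s + size s')%N n) => [e|ne]; last first.
  by rewrite /lkm_seq !insubF ?mulr1 // sz eqSS (negbTE ne).
have T z : size (s ++ toGm z :: s') == n.+1 by rewrite sz e.
rewrite -[s ++ toGm (x * y) :: s']/(tval (Tuple (T (x * y)))) -[s ++ toGm x :: s']/(tval (Tuple (T x))).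
rewrite -[s ++ toGm y :: s']/(tval (Tuple (T y))) !lkm_seqE -lkm_mul.
have i_lt : (size s < n.+1)%N by lia.
congr (Gm_val (Psi A f _)); apply: (KM_symbolD (i := Ordinal i_lt)).
  by rewrite !(tnth_nth (toGm 1)) /= !nth_cat ltnn subnn /= !toGmE //; apply: isUM.
move=> j ij; have js : (j : nat) != size s by apply: contra ij => /eqP ej; apply/eqP/val_inj.
rewrite !(tnth_nth (toGm 1)) /= !nth_cat; case: ltngtP js => // js _.
by rewrite -[(j - size s)%N]prednK ?subn_gt0.
Qed.
Lemma lkm_symSt (A : comPzRingType) (f : {rmorphism R -> A}) s (x y : L A) s' : isU x -> isU y ->
  x + y = 1 -> lkm_sym f (s ++ x :: y :: s') = 1.
Proof.
move=> ux uy xy; rewrite /lkm_sym !map_cat !map_cons.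
move: (map _ s) (map _ s') => {}s {}s'.
have sz : size (s ++ [:: toGm x, toGm y & s']) = (size s + size s').+2 by rewrite size_cat /= !addnS.
case: (eqVneq (size s + size s').+1 n) => [e|ne]; last first.
  by rewrite /lkm_seq insubF // sz eqSS (negbTE ne).
have T : size (s ++ [:: toGm x, toGm y & s']) == n.+1 by rewrite sz e.
rewrite -[s ++ _]/(tval (Tuple T)) lkm_seqE.
have i_lt : (size s < n.+1)%N by lia.
have j_lt : ((size s).+1 < n.+1)%N by lia.
rewrite (@KM_symbol0 _ _ (Ordinal i_lt) (Ordinal j_lt)) ?lkm_val0 //.
rewrite !(tnth_nth (toGm 1)) /= !nth_cat ltnn subnn /= ltnNge leqnSn /= subSnn /=.
by rewrite !toGmE.
Qed.
Lemma lkm_symN (A B : comPzRingType) (f : {rmorphism R -> A}) (g : {rmorphism R -> B})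
    (h : {rmorphism A -> B}) : (forall r, h (f r) = g r) ->
  forall s, {in s, forall x, isU x} ->
  lkm_sym g (map (iter_laurent_map n h) s) = h (lkm_sym f s).
Proof.
move=> e s us; rewrite /lkm_sym.
have -> : map (@toGm _) (map (iter_laurent_map n h) s) =
    map (Gm_map (iter_laurent_map n h)) (map (@toGm _) s).
  by rewrite -!map_comp; apply/eq_in_map => x /us ux; apply: toGm_map.
move: (map _ s) => {us}s.
case: (eqVneq (size s) n.+1) => [sz|ne]; last first.
  by rewrite /lkm_seq !insubF ?rmorph1 ?size_map ?(negbTE ne).
rewrite -[s]/(tval (Tuple (introT eqP sz))) lkm_seqE.
move: (Tuple _) => t; rewrite -[map _ _]/(tval [tuple of map (Gm_map (iter_laurent_map n h)) t]).
by rewrite lkm_seqE -KM_map_symbol (lkm_natural Psi e).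
Qed.
Definition symbol_of_lkm : symbol n R := Symbol lkm_symU lkm_symM lkm_symSt lkm_symN.

Lemma symbol_of_lkmE (A : comPzRingType) (f : {rmorphism R -> A}) (t : n.+1.-tuple (Gm (L A))) :
  symbol_of_lkm A f (map (@Gm_val _) t) = Gm_val (Psi A f (KM_symbol t)).
Proof.
rewrite -lkm_seqE /= /lkm_sym -map_comp; congr lkm_seq.
by rewrite -[RHS]map_id; apply: eq_map => u /=; apply: toGmK.
Qed.

Lemma lkm_trivial (A : comPzRingType) (f : {rmorphism R -> A}) :
  (forall s, {in s, forall x, isU x} -> size s = n.+1 -> symbol_of_lkm A f s = 1) ->
  forall x, Gm_val (Psi A f x) = 1.
Proof.
move=> h; apply: KM_ind => [|x y hx hy|x hx|t].
- exact: lkm_val0.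
- by rewrite lkm_mul hx hy mulr1.
- by rewrite -[LHS]mul1r -hx -lkm_mul subrr lkm_val0.
rewrite -symbol_of_lkmE h ?size_map ?size_tuple //.
by move=> _ /mapP[u _ ->]; apply: isU_Gm.
Qed.
End LKMSymbol.

(** * The Contou-Carrere symbol on standard tuples *)

Lemma free_loop_unit (A : comPzRingType) (a : Gm A) f : free_loop (1%:M : 'M[A]_1) f ->
  free_loop ((Gm_val a)%:M : 'M[A]_1) (fun z =>
    geom_map (nerve_map (unit_aut (exP A) a)) (geom_map (nerve_map (forget_aut (exP A))) (f z))).
Proof.
case=> e1 [e2 [theta [[bt _] hl [hf hb] [h1 h2] hfz]]].
pose U := nerve_map (unit_aut (exP A) a); pose V := nerve_map (forget_aut (exP A)).
exists (U 1%N (V 1%N e1)), (U 1%N (V 1%N e2)), theta; split.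
- split=> // x; rewrite mul_mx_scalar -[LHS]/(theta (Gm_val a *: x)); exact: linearZ.
- by rewrite -!sfun_act hl.
- rewrite -!sfun_act hf; split=> //; rewrite -hb hf.
  move: (V 0%N (sact _ e2)) => -[o mo c1 c2]; apply: chain_eq => i j h.
  have E (M N : Qcat (exP A)) (G : rhom M N) :
    fhom (forget_aut (exP A)) (fhom (unit_aut (exP A) a) G) = G.
    by case: G => G q; apply: eq_exist.
  exact: E.
- by split=> h x y; [exact: (h1 h x y) | exact: (h2 h x y)].
by move=> z; rewrite hfz; case: ifP => _; rewrite !geom_map_point.
Qed.

Lemma Gm_map_comp (A B C : comPzRingType) (g : {rmorphism B -> C}) (h : {rmorphism A -> B})
    (k : {rmorphism A -> C}) u : (forall a, g (h a) = k a) -> Gm_map g (Gm_map h u) = Gm_map k u.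
Proof. by move=> e; apply: Gm_inj; apply: e. Qed.

Section ContouCarrere.
Variables (sym : loday_symbol) (bd : boundary_map) (dt : K1_det).

Lemma det_symbol (A : comPzRingType) (a : Gm A) :
  dt A (sym 1%N A (KM_symbol [tuple of rcons [tuple] a])) = a.
Proof.
have [f hf rf] := loday_sym0 sym A.
have := @loday_symS sym 0 A [tuple] a _ rf.
move/(k1det_aut dt (free_loop_unit a hf)) => e; apply: Gm_inj.
by rewrite e det_scalar1.
Qed.

(* The tuple [(a, t_1, ..., t_n)]. *)
Fixpoint std_tuple n (A : comPzRingType) (a : Gm A) : n.+1.-tuple (Gm (iter_laurent n A)) :=
  match n return n.+1.-tuple (Gm (iter_laurent n A)) with
  | 0 => [tuple of rcons [tuple] a]
  | n'.+1 => [tuple of rcons (map (Gm_map (lsC (iter_laurent n' A))) (std_tuple n' a)) (laurent_T _)]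
  end.

Lemma boundary_std n (A : comPzRingType) (a : Gm A) :
  bd n.+1 (iter_laurent n A) (sym n.+2 (iter_laurent n.+1 A) (KM_symbol (std_tuple n.+1 a))) =
  sym n.+1 (iter_laurent n A) (KM_symbol (std_tuple n a)).
Proof.
set S := iter_laurent n A; set s := std_tuple n a.
pose cps := [the {rmorphism S -> pseries S} of @ps_const S].
pose pls := [the {rmorphism pseries S -> laurent S} of @ps_to_ls S].
pose ev := [the {rmorphism pseries S -> S} of @ps_ev0 S].
pose sp := [tuple of map (Gm_map cps) s].
apply: (bdry_normalized bd (x := sym _ _ (KM_symbol sp))
  (x' := sym _ _ (KM_symbol [tuple of map (Gm_map pls) sp]))).
- by have := loday_sym_natural sym pls (KM_symbol sp); rewrite KM_map_symbol.
- have := loday_sym_natural sym ev (KM_symbol sp); rewrite KM_map_symbol.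
  congr (K_base_change _ _ (sym _ _ (KM_symbol _))); apply: val_inj => /=.
  rewrite -map_comp -[RHS]map_id; apply: eq_map => u; apply: Gm_inj.
  by [].
have := @loday_symS sym _ _ [tuple of map (Gm_map pls) sp] (laurent_T S).
congr (unit_product _ _ (sym _ _ (KM_symbol _))); apply: val_inj => /=.
rewrite -map_comp; congr (rcons _ _); apply: eq_map => u; exact: Gm_map_comp.
Qed.

Lemma CC_std n (A : comPzRingType) (a : Gm A) :
  @CC sym bd dt n A (KM_symbol (std_tuple n a)) = a.
Proof.
rewrite /CC; suff -> : bdry_iter bd (sym n.+1 (iter_laurent n A) (KM_symbol (std_tuple n a))) =
    sym 1%N A (KM_symbol (std_tuple 0 a)) by apply: det_symbol.
by elim: n => // n ih; rewrite [LHS]/= boundary_std ih.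
Qed.

Lemma CC_mul n (A : comPzRingType) (x y : KM n.+1 (iter_laurent n A)) :
  Gm_val (CC sym bd dt (x + y)) = Gm_val (CC sym bd dt x) * Gm_val (CC sym bd dt y).
Proof.
apply: (k1detD dt); have := loday_symD sym x y.
move: (sym _ _ x) (sym _ _ y) (sym _ _ (x + y)) => {x y}.
elim: n => // n ih x y z h; apply: ih; exact: (bdryD bd).
Qed.

Lemma CC_natural n (A B : comPzRingType) (h : {rmorphism A -> B}) (x : KM n.+1 (iter_laurent n A)) :
  CC sym bd dt (KM_map (iter_laurent_map n h) x) = Gm_map h (CC sym bd dt x).
Proof.
apply: (k1det_natural dt); have := loday_sym_natural sym (iter_laurent_map n h) x.
move: (sym _ _ x) (sym _ _ (KM_map _ x)) => {x}.
elim: n => // n ih x y hxy; apply: ih; exact: (bdry_natural bd).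
Qed.
End ContouCarrere.

(** * Conclusion *)

Lemma std_tuple_val n (A : comPzRingType) (a : Gm A) :
  map (@Gm_val _) (std_tuple n a) =
  constL n A (Gm_val a) :: [seq mono n A (delta j) | j <- iota 0 n].
Proof.
elim: n => // n ih.
have -> : map (@Gm_val _) (std_tuple n.+1 a) =
    rcons (map (lsC (iter_laurent n A)) (map (@Gm_val _) (std_tuple n a))) (ls_T (iter_laurent n A)).
  by rewrite /= map_rcons -!map_comp.
rewrite ih map_cons rcons_cons; congr (_ :: _).
have -> : iota 0 n.+1 = rcons (iota 0 n) n by rewrite -addn1 iotaD cats1.
rewrite map_rcons; congr (rcons _ _).
  rewrite -map_comp; apply/eq_in_map => j; rewrite mem_iota add0n => /andP[_ jn].
  rewrite [LHS]lsC_mono; apply: mono_ext => k _; case: eqP => // ->.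
  by rewrite /delta; case: eqP => //; lia.
rewrite -[LHS]/(tpow (iter_laurent n A) 1) tpow_mono; apply: mono_ext => k _.
by rewrite /delta; case: eqP.
Qed.

Section IdempotentPowers.
Variables (R : comPzRingType) (M : nat) (p : nat -> R).
Hypothesis orth : forall i j, (i < M)%N -> (j < M)%N -> p i * p j = if i == j then p i else 0.
Hypothesis p1 : \sum_(j < M) p j = 1.

Definition lcpow (A : comPzRingType) (f : {rmorphism R -> A}) (u : Gm A) (k : nat -> int) : A :=
  \sum_(j < M) f (p j) * Gm_expz u (k j).

Lemma lcpow_mul (A : comPzRingType) (f : {rmorphism R -> A}) (X Y : nat -> A) :
  (\sum_(j < M) f (p j) * X j) * (\sum_(j < M) f (p j) * Y j) =
  \sum_(j < M) f (p j) * (X j * Y j).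
Proof.
rewrite mulr_suml; apply: eq_bigr => i _; rewrite mulr_sumr (bigD1 i) //= big1 ?addr0 => [|j ji].
  by rewrite mulrACA -rmorphM orth // eqxx.
rewrite mulrACA -rmorphM orth //; case: eqP => [e|_]; last by rewrite rmorph0 mul0r.
by case/eqP: ji; apply: val_inj.
Qed.
Lemma lcpowD (A : comPzRingType) (f : {rmorphism R -> A}) u k l :
  lcpow f u k * lcpow f u l = lcpow f u (fun j => k j + l j).
Proof.
apply: (etrans (lcpow_mul f (fun j => Gm_expz u (k j)) (fun j => Gm_expz u (l j)))).
by apply: eq_bigr => j _; rewrite Gm_expzD.
Qed.
Lemma lcpow0 (A : comPzRingType) (f : {rmorphism R -> A}) u : lcpow f u (fun=> 0) = 1.
Proof.
rewrite -(rmorph1 f) -p1 rmorph_sum; apply: eq_bigr => j _; exact: mulr1.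
Qed.
Lemma lcpowV (A : comPzRingType) (f : {rmorphism R -> A}) u k :
  lcpow f u k * lcpow f u (fun j => - k j) = 1.
Proof. by rewrite lcpowD -(lcpow0 f u); apply: eq_bigr => j _; rewrite subrr. Qed.
Lemma lcpowM (A : comPzRingType) (f : {rmorphism R -> A}) u v w k :
  Gm_val w = Gm_val u * Gm_val v -> lcpow f w k = lcpow f u k * lcpow f v k.
Proof.
move=> e; symmetry; apply: (etrans (lcpow_mul f (fun j => Gm_expz u (k j)) (fun j => Gm_expz v (k j)))).
by apply: eq_bigr => j _; rewrite (Gm_expzM _ e).
Qed.
Lemma lcpow_natural (A B : comPzRingType) (f : {rmorphism R -> A}) (g : {rmorphism R -> B})
    (h : {rmorphism A -> B}) u k : (forall r, h (f r) = g r) ->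
  lcpow g (Gm_map h u) k = h (lcpow f u k).
Proof.
by move=> e; rewrite /lcpow rmorph_sum; apply: eq_bigr => j _; rewrite rmorphM e Gm_map_expz.
Qed.

Lemma idem_prime (q : prime_ideal R) : exists j : 'I_M, ~ q (p j).
Proof.
apply: contrapT => h; suff : q 1 by exact: pideal1.
rewrite -p1.
elim/big_ind: _ => [|x y|j _]; [exact: pideal0 | exact: pidealD|].
by apply: contrapT => hj; apply: h; exists j.
Qed.
Lemma idem_prime_uniq (q : prime_ideal R) (i j : 'I_M) : ~ q (p i) -> ~ q (p j) -> i = j.
Proof.
move=> hi hj; apply/val_inj/eqP/negPn/negP => ij.
have : q (p i * p j) by rewrite orth // (negbTE ij); apply: pideal0.
by case/pideal_prime.
Qed.
Variable k : nat -> int.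
Definition idem_lc_val (q : prime_ideal R) : int := k (projT1 (cid (idem_prime q))).
Lemma idem_lc_valE (q : prime_ideal R) (j : 'I_M) : ~ q (p j) -> idem_lc_val q = k j.
Proof.
by move=> hj; rewrite /idem_lc_val; case: cid => i /= hi; rewrite (idem_prime_uniq hi hj).
Qed.
Fact idem_lc_subproof (q : prime_ideal R) : exists s : R,
  ~ q s /\ forall q' : prime_ideal R, ~ q' s -> idem_lc_val q' = idem_lc_val q.
Proof.
have [j hj] := idem_prime q; exists (p j); split=> // q' hj'.
by rewrite !(idem_lc_valE (j := j)).
Qed.
Definition idem_lc : loc_const R := LocConst idem_lc_subproof.

Lemma idem_lcpow (A : comPzRingType) (f : {rmorphism R -> A}) (u v : Gm A) :
  Gm_val v = lcpow f u k -> is_lcpow (loc_const_map f idem_lc) u v.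
Proof.
move=> e; exists M, (fun j => f (p j)), (fun j => k j); split=> //.
- move=> j l; rewrite -rmorphM orth //; case: (eqVneq j l) => [->|jl]; first by rewrite eqxx.
  by case: eqP => [/val_inj ejl|_]; [rewrite ejl eqxx in jl | rewrite rmorph0].
- by rewrite -rmorph_sum p1 rmorph1.
by move=> q j hj; apply: (@idem_lc_valE (pullback_ideal f q)).
Qed.
End IdempotentPowers.

Section Twist.
Variables (n : nat) (R : comPzRingType) (Phi : LKM_to_Gm n R).
Variables (sym : loday_symbol) (bd : boundary_map) (dt : K1_det).
Variables (M : nat) (p : nat -> R) (k : nat -> int).
Hypothesis orth : forall i j, (i < M)%N -> (j < M)%N -> p i * p j = if i == j then p i else 0.
Hypothesis p1 : \sum_(j < M) p j = 1.

Definition twist_val (A : comPzRingType) (f : {rmorphism R -> A}) (x : KM n.+1 (iter_laurent n A)) : A :=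
  Gm_val (Phi A f x) * lcpow M p f (CC sym bd dt x) k.
Lemma twist_unit (A : comPzRingType) (f : {rmorphism R -> A}) (x : KM n.+1 (iter_laurent n A)) :
  twist_val f x * (Gm_invval (Phi A f x) * lcpow M p f (CC sym bd dt x) (fun j => - k j)) = 1.
Proof. by rewrite /twist_val mulrACA Gm_mulV lcpowV ?mul1r. Qed.
Definition twist_Gm (A : comPzRingType) (f : {rmorphism R -> A}) (x : KM n.+1 (iter_laurent n A)) : Gm A :=
  mkGm (twist_unit f x).
Lemma twist_mul (A : comPzRingType) (f : {rmorphism R -> A}) (x y : KM n.+1 (iter_laurent n A)) :
  Gm_val (twist_Gm f (x + y)) = Gm_val (twist_Gm f x) * Gm_val (twist_Gm f y).
Proof.
rewrite -[LHS]/(twist_val f (x + y)) -[RHS]/(twist_val f x * twist_val f y) /twist_val.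
by rewrite lkm_mul (lcpowM orth f k (CC_mul sym bd dt x y)) mulrACA.
Qed.
Lemma twist_natural (A B : comPzRingType) (f : {rmorphism R -> A}) (g : {rmorphism R -> B})
    (h : {rmorphism A -> B}) : (forall r, h (f r) = g r) ->
  forall x, twist_Gm g (KM_map (iter_laurent_map n h) x) = Gm_map h (twist_Gm f x).
Proof.
move=> e x; apply: Gm_inj; rewrite -[LHS]/(twist_val g _) -[RHS]/(h (twist_val f x)) /twist_val.
by rewrite (lkm_natural Phi e) CC_natural (lcpow_natural _ _ _ _ e) rmorphM.
Qed.
Definition lkm_twist : LKM_to_Gm n R := LKMToGm twist_mul twist_natural.
End Twist.

Theorem theorem8p10
  (sym : loday_symbol) (bd : boundary_map) (dt : K1_det)
  (n : nat) (hn : (1 <= n)%N)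
  (R : comPzRingType) (hR : torsion_free R)
  (Phi : LKM_to_Gm n R) :
  exists i : loc_const R,
    forall (A : comPzRingType) (f : {rmorphism R -> A})
           (x : KM n.+1 (iter_laurent n A)),
      is_lcpow (loc_const_map f i) (CC sym bd dt x) (Phi A f x).
Proof.
case: n hn Phi => // m _ Phi; set n := m.+1.
have uv := @units_vars m R (iota 0 n).
have [M [N [p [orth p1 ev]]]] := Gm_char (sym_char0 (symbol_of_lkm Phi) (rid R) uv).
pose k (j : nat) : int := j%:Z - N%:Z.
have Phi_std (A : comPzRingType) (f : {rmorphism R -> A}) (a : Gm A) :
    Gm_val (Phi A f (KM_symbol (std_tuple n a))) = lcpow M p f a k.
  rewrite -symbol_of_lkmE std_tuple_val.
  transitivity (Gm_invval a ^+ N * \sum_(j < M) f (p j) * Gm_val a ^+ j).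
    rewrite -(ev _ f _ _ (Gm_mulV a)) sym_char0E map_vars; apply: sym_ext => //.
    by apply: in_cons_units; [apply/isU_map/isU_Gm | apply: units_vars].
  rewrite mulr_sumr; apply: eq_bigr => j _; rewrite mulrCA /k addrC Gm_expzD; congr (_ * (_ * _)).
  by case: (N) => // N'.
have triv (A : comPzRingType) (f : {rmorphism R -> A}) x :
    Gm_val (lkm_twist Phi sym bd dt (fun j => - k j) orth p1 A f x) = 1.
  apply: lkm_trivial; apply: symbol_trivial => // {A f x} A f a ua.
  rewrite -(toGmE ua) -std_tuple_val symbol_of_lkmE.
  by rewrite -[LHS]/(twist_val _ _ _ _ _ _ _ _ _) /twist_val Phi_std CC_std lcpowV.
exists (idem_lc orth p1 k) => A f x; apply: idem_lcpow.
set c := CC sym bd dt x.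
have := triv A f x; rewrite -[X in X = 1]/(Gm_val (Phi A f x) * lcpow M p f c (fun j => - k j)) => e.
by rewrite -[LHS]mulr1 -(lcpowV orth p1 f c k) mulrCA e mulr1.
Qed.
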